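(* Let $w$ be an admissible sequence and $N\ge2$. (i) $NA\mathcal{P}(^Nd_*(w,1);c_0)$ is dense in $\mathcal{P}(^Nd_*(w,1);c_0)$ if and only if $w\notin\ell_N$. (ii) $NA\mathcal{P}_N(d_*(w,1);c_0)$ is dense in $\mathcal{P}_N(d_*(w,1);c_0)$ if and only if $w\notin\ell_N$.
   Context: The scalar field is $\mathbb{R}$ or $\mathbb{C}$ (the same for all spaces). An admissible sequence is a decreasing (i.e. nonincreasing) sequence $w=(w_i)_{i\in\mathbb{N}}$ of nonnegative reals with $w_1=1$, $\lim_iw_i=0$, $\sum_iw_i=\infty$. Put $W(n)=\sum_{i=1}^nw_i$. $d_*(w,1)$ (the predual of the Lorentz sequence space $d(w,1)$) is the Banach space of all bounded scalar sequences $x=(x(i))_i$ with $\lim_{n\to\infty}\frac{\sum_{i=1}^nx^*(i)}{W(n)}=0$, where $x^*=(x^*(i))_i$ is the decreasing rearrangement of $(|x(i)|)_i$, with norm $\|x\|_W=\sup_n\frac{\sum_{i=1}^nx^*(i)}{W(n)}$. $c_0$ carries its usual supremum norm. For Banach spaces $X,Y$: $\mathcal{P}(^NX;Y)$ is the Banach space of continuous $N$-homogeneous polynomials $X\to Y$ (maps $x\mapsto\Phi(x,\dots,x)$ with $\Phi$ continuous $N$-linear), and $\mathcal{P}_N(X;Y)$ that of continuous polynomials of degree at most $N$ (sums $\sum_{j=0}^NP_j$ of continuous $j$-homogeneous polynomials), both with norm $\|P\|=\sup_{x\in B_X}\|P(x)\|$, $B_X$ the closed unit ball. The prefix $NA$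 denotes the subset of norm attaining elements, i.e. those $P$ with $\|P(x_0)\|=\|P\|$ for some $x_0\in B_X$. *)

(* Defs.v *)
From HB Require Import structures.
From mathcomp Require Import all_boot all_order all_algebra.
From mathcomp Require Import all_classical all_reals all_analysis.
From mathcomp Require Import finmap complex ring.

Set Implicit Arguments.
Unset Strict Implicit.
Unset Printing Implicit Defensive.

Import Order.TTheory GRing.Theory Num.Theory.
Import numFieldNormedType.Exports.

Local Open Scope classical_set_scope.
Local Open Scope card_scope.
Local Open Scope ring_scope.

Variant scalar_kind := RealScalars | ComplexScalars.

Definition scalar_field (R : realType) (s : scalar_kind) : numFieldType :=
  match s with RealScalars => R | ComplexScalars => R[i] end.

Definition of_real (R : realType) (s : scalar_kind) : R -> scalar_field R s :=
  match s with RealScalars => id | ComplexScalars => real_complex R end.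

(* The real part; used only on norms. The norm of a [normedModType K] takes
   its values in [K], and for [K = R[i]] one needs it in [R] to speak of
   suprema. *)
Definition to_real (R : realType) (s : scalar_kind) : scalar_field R s -> R :=
  match s with RealScalars => id | ComplexScalars => @complex.Re R end.

Arguments of_real {R s}.
Arguments to_real {R s}.

Section Scalars.
Context (R : realType) (s : scalar_kind).
Implicit Types (r : R) (V : normedModType (scalar_field R s)).

Definition rnorm V (x : V) : R := to_real `|x|.

Lemma of_realK : cancel (@of_real R s) to_real.
Proof. by case: s. Qed.

Lemma of_real_inj : injective (@of_real R s).
Proof. exact: can_inj of_realK. Qed.

Lemma to_realK V (x : V) : of_real (rnorm x) = `|x|.
Proof.
rewrite /rnorm; case: s V x => //= V x.
have := normr_ge0 x; case: `|x| => a b; rewrite lecE /= => /andP[/eqP -> _] //.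
Qed.

Lemma of_realD r1 r2 :
  of_real (r1 + r2) = of_real r1 + of_real r2 :> scalar_field R s.
Proof. by case: s => //=; exact: rmorphD. Qed.

Lemma of_realM r1 r2 :
  of_real (r1 * r2) = of_real r1 * of_real r2 :> scalar_field R s.
Proof. by case: s => //=; exact: rmorphM. Qed.

Lemma of_real0 : of_real 0 = 0 :> scalar_field R s.
Proof. by case: s. Qed.

Lemma of_real1 : of_real 1 = 1 :> scalar_field R s.
Proof. by case: s. Qed.

Lemma ler_of_real r1 r2 :
  (of_real r1 <= of_real r2 :> scalar_field R s) = (r1 <= r2).
Proof. by case: s => //=; exact: lecR. Qed.

Lemma ltr_of_real r1 r2 :
  (of_real r1 < of_real r2 :> scalar_field R s) = (r1 < r2).
Proof. by case: s => //=; exact: ltcR. Qed.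

Lemma rnorm_ge0 V (x : V) : 0 <= rnorm x.
Proof. by rewrite -ler_of_real to_realK of_real0. Qed.

Lemma rnormD V (x y : V) : rnorm (x + y) <= rnorm x + rnorm y.
Proof. by rewrite -ler_of_real of_realD !to_realK ler_normD. Qed.

Lemma rnormZ V (c : scalar_field R s) (x : V) :
  rnorm (c *: x) = rnorm (c : (scalar_field R s)^o) * rnorm x.
Proof.
by apply: of_real_inj; rewrite of_realM !to_realK normrZ.
Qed.

Lemma rnorm0 V : rnorm (0 : V) = 0.
Proof. by apply: of_real_inj; rewrite to_realK normr0 of_real0. Qed.

Lemma rnorm1 : rnorm (1 : (scalar_field R s)^o) = 1.
Proof. by apply: of_real_inj; rewrite to_realK normr1 of_real1. Qed.

Lemma rnorm_eq0 V (x : V) : rnorm x = 0 -> x = 0.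
Proof.
by move=> x0; apply/eqP; rewrite -normr_eq0 -to_realK x0 of_real0.
Qed.

Lemma scale_le_eq (V : lmodType (scalar_field R s)) (p : V -> R) :
    (forall c x, p (c *: x) <= rnorm (c : (scalar_field R s)^o) * p x) ->
    (forall x, 0 <= p x) ->
  forall c x, p (c *: x) = rnorm (c : (scalar_field R s)^o) * p x.
Proof.
move=> ple p0 c x; apply/le_anti; rewrite ple/=.
have [->|c0] := eqVneq c 0; first by rewrite rnorm0 mul0r p0.
have := ple c^-1 (c *: x); rewrite scalerA mulVf// scale1r.
move=> /(ler_wpM2l (rnorm_ge0 (c : (scalar_field R s)^o))) /le_trans; apply.
rewrite mulrA -(rnormZ c (c^-1 : (scalar_field R s)^o)) /GRing.scale/= mulfV//.
by rewrite rnorm1 mul1r.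
Qed.

End Scalars.

Section Rearrangement.
Context (R : realType).
Implicit Types (a b : nat -> R) (n : nat).

(* Sequences are indexed from 0: [rearr a n] is the (n+1)-st term of the
   decreasing rearrangement of the nonnegative bounded sequence [a], namely
   inf {t >= 0 : #{i : a i > t} <= n}. *)
Definition rearr a n : R :=
  inf [set t | 0 <= t /\ [set i | t < a i] #<= `I_n].

Definition bounded_nonneg a := exists M, forall i, 0 <= a i <= M.

Lemma card_le_uniq (A : set nat) (t : seq nat) n :
  A #<= `I_n -> uniq t -> (forall i, i \in t -> A i) -> (size t <= n)%N.
Proof.
move=> An ut tA; pose F := [fset i in t]%fset.
have Ft : size t = #|` F| by rewrite card_fseq undup_id.
have /card_eq_fsetP FI := erefl #|` F|.
rewrite Ft -card_le_II -(card_le_eql FI) (card_le_trans _ An)//.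
by apply: subset_card_le => i /=; rewrite !inE; exact: tA.
Qed.

Lemma rearr_has_inf a n : bounded_nonneg a ->
  has_inf [set t | 0 <= t /\ [set i | t < a i] #<= `I_n].
Proof.
move=> [M aM]; split; last by exists 0 => t [].
exists M; split; first by have /andP[/le_trans h /h] := aM 0%N.
rewrite (_ : [set i | M < a i] = set0) ?card_ge0//.
by apply/seteqP; split => // i /=; have /andP[_] := aM i; rewrite leNgt => /negP.
Qed.

Lemma rearr_ge0 a n : bounded_nonneg a -> 0 <= rearr a n.
Proof.
by move=> /(rearr_has_inf n)[ne _]; apply: lb_le_inf => // t [].
Qed.

Lemma le_rearr a n (t : seq nat) c : bounded_nonneg a -> uniq t ->
  (n < size t)%N -> (forall i, i \in t -> c <= a i) -> c <= rearr a n.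
Proof.
move=> ba ut nt ct; have [ne _] := rearr_has_inf n ba.
apply: lb_le_inf => // x [_ xn]; rewrite leNgt; apply/negP => xc.
have := card_le_uniq xn ut (fun i it => lt_le_trans xc (ct i it)).
by rewrite leqNgt nt.
Qed.

Lemma lt_rearr a n (t : seq nat) c : bounded_nonneg a -> size t = n ->
  c < rearr a n -> exists2 i, i \notin t & c < a i.
Proof.
move=> ba tn cn; apply: contrapT => /forall2NP H.
have [M aM] := ba.
have [c0|c0] := leP 0 c; last first.
  have [i it] : exists i, i \notin t.
    exists (\max_(i <- t) i).+1; apply/negP => it.
    by have := @leq_bigmax_seq _ t xpredT id _ it isT; rewrite ltnn.
  case: (H i) => //; rewrite (lt_le_trans c0)//.
  by have /andP[] := aM i.
have [_ lb] := rearr_has_inf n ba.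
suff : rearr a n <= c by rewrite leNgt cn.
apply: ge_inf => //; split=> //.
have sub : [set i | c < a i] `<=` [set` t].
  by move=> i /= ci; case: (H i) => // /negP; rewrite negbK.
apply: card_le_trans (subset_card_le sub) _.
have /card_eq_fsetP FI := erefl #|` [fset i in t]%fset|.
rewrite (_ : [set` t] = [set` [fset i in t]%fset]); last first.
  by apply/seteqP; split=> i /=; rewrite !inE.
by rewrite (card_le_eql FI) card_le_II card_fseq -tn size_undup.
Qed.

Lemma sum_le_rearr a (t : seq nat) : bounded_nonneg a -> uniq t ->
  \sum_(i <- t) a i <= \sum_(j < size t) rearr a j.
Proof.
move=> ba; move: {2}(size t) (erefl (size t)) => n.
elim: n t => [|n IH] t tn ut.
  by rewrite tn (size0nil tn) big_nil big_ord0.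
have [i0 i0t mini] : exists2 i, i \in t & forall j, j \in t -> a i <= a j.
  case: t tn {ut} => // x t _; elim: t x => [|y t IHt] x.
    by exists x; rewrite ?inE// => j; rewrite inE => /eqP ->.
  have [i it mi] := IHt y.
  have [xi|ix] := leP (a x) (a i).
    exists x; first by rewrite mem_head.
    by move=> j; rewrite inE => /predU1P[->//|/mi]; exact: le_trans.
  exists i; first by rewrite inE it orbT.
  by move=> j; rewrite inE => /predU1P[->|/mi//]; exact: ltW.
rewrite (perm_big _ (perm_to_rem i0t))/= big_cons addrC tn big_ord_recr/=.
have srem : size (rem i0 t) = n by rewrite size_rem// tn.
rewrite lerD//; first by have := IH _ srem (rem_uniq _ ut); rewrite srem.
by apply: (@le_rearr _ _ t) => //; rewrite tn.
Qed.

Lemma rearr_le_sum a n (e : R) : bounded_nonneg a -> 0 < e ->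
  exists t : seq nat, [/\ uniq t, size t = n &
    \sum_(j < n) rearr a j <= \sum_(i <- t) a i + n%:R * e].
Proof.
move=> ba e0; elim: n => [|n [t [ut tn le]]].
  by exists [::]; split=> //; rewrite big_ord0 big_nil mul0r addr0.
have [i it ai] : exists2 i, i \notin t & rearr a n - e < a i.
  by apply: (@lt_rearr a n) => //; rewrite ltrBlDr ltrDl.
exists (i :: t); split; rewrite /= ?it ?tn//.
rewrite big_ord_recr/= big_cons -(natr1 n) mulrDl mul1r.
rewrite [leRHS](_ : _ = (\sum_(i <- t) a i + n%:R * e) + (a i + e)); last first.
  by ring.
by rewrite lerD// -lerBlDr ltW.
Qed.

Lemma sum_rearr_lub a n B : bounded_nonneg a ->
    (forall t : seq nat, uniq t -> size t = n -> \sum_(i <- t) a i <= B) ->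
  \sum_(j < n) rearr a j <= B.
Proof.
move=> ba aB; apply/ler_addgt0Pr => e e0.
have e'0 : 0 < e / n.+1%:R by rewrite divr_gt0.
have [t [ut tn le]] := rearr_le_sum n ba e'0.
apply: (le_trans le); rewrite lerD ?aB// mulrCA ler_piMr ?(ltW e0)//.
by rewrite ler_pdivrMr ?ltr0n// mul1r ler_nat.
Qed.

Lemma sum_rearr_lin (a b c : nat -> R) (k : R) n :
    bounded_nonneg a -> bounded_nonneg b -> bounded_nonneg c -> 0 <= k ->
    (forall i, c i <= k * a i + b i) ->
  \sum_(j < n) rearr c j <=
    k * \sum_(j < n) rearr a j + \sum_(j < n) rearr b j.
Proof.
move=> ba bb bc k0 le; apply: sum_rearr_lub => // t ut tn.
rewrite (le_trans (ler_sum _ (fun i _ => le i)))// big_split/= -mulr_sumr.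
by rewrite lerD ?ler_wpM2l// -?tn; exact: sum_le_rearr.
Qed.

Lemma sum_rearr0 n : \sum_(j < n) rearr (fun=> 0 : R) j = 0.
Proof.
have b0 : bounded_nonneg (fun=> 0 : R) by exists 0 => i; rewrite lexx.
apply/le_anti/andP; split.
  by apply: sum_rearr_lub => // t _ _; rewrite big1.
by apply: sumr_ge0 => i _; exact: rearr_ge0.
Qed.

End Rearrangement.

Record admissible (R : realType) := Admissible {
  weight :> nat -> R;
  weight_ge0 : forall i, 0 <= weight i;
  weight_nonincreasing : nonincreasing_seq weight;
  weight0 : weight 0%N = 1;
  weight_cvg0 : weight @ \oo --> 0;
  weight_dvg : series weight @ \oo --> +oo }.

Definition in_ell (R : realType) (p : nat) (w : nat -> R) : Prop :=
  cvgn (series (fun i => `|w i| ^+ p)).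

Section C0.
Context (R : realType) (s : scalar_kind).
Local Notation K := (scalar_field R s).
Implicit Types x y : nat -> K^o.

Definition c0_pred : {pred nat -> K^o} := fun x => `[< x @ \oo --> 0 >].

Lemma c0_submod_closed : submod_closed c0_pred.
Proof.
split; first by rewrite unfold_in; apply/asboolP; exact: cvg_cst.
move=> c x y; rewrite !unfold_in => /asboolP x0 /asboolP y0; apply/asboolP.
rewrite -(addr0 (0 : K^o)) -{1}(scaler0 _ c).
by apply: cvgD => //; apply: cvgZr.
Qed.

HB.instance Definition _ :=
  GRing.isSubmodClosed.Build K (nat -> K^o) c0_pred c0_submod_closed.

Record c0 := C0 { c0_val :> nat -> K^o; _ : c0_val \in c0_pred }.

HB.instance Definition _ := [isSub for c0_val].
HB.instance Definition _ := [Choice of c0 by <:].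
HB.instance Definition _ := [SubChoice_isSubLmodule of c0 by <:].

Definition c0_norm (x : c0) : R := sup [set rnorm (x i) | i in setT].

Lemma c0_has_sup (x : c0) : has_sup [set rnorm (x i) | i in setT].
Proof.
split; first by exists (rnorm (x 0%N)), 0%N.
case: x => x /= /asboolP x0.
have [N _ xN] : \forall i \near \oo, `|x i| < 1.
  by move/cvgr0Pnorm_lt : x0; apply.
exists (1 + \sum_(i < N) rnorm (x i)) => _ [i _ <-].
have [iN|Ni] := ltnP i N.
  rewrite (bigD1 (Ordinal iN))//= addrCA lerDl addr_ge0//.
  by apply: sumr_ge0 => j _; exact: rnorm_ge0.
rewrite (@le_trans _ _ 1)// ?lerDl; last first.
  by apply: sumr_ge0 => j _; exact: rnorm_ge0.
by rewrite -(@ler_of_real R s) to_realK of_real1 ltW// xN.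
Qed.

Lemma le_c0_norm (x : c0) i : rnorm (x i) <= c0_norm x.
Proof. by apply: ub_le_sup; [exact: (c0_has_sup x).2|exists i]. Qed.

Lemma c0_norm_lub (x : c0) B : (forall i, rnorm (x i) <= B) -> c0_norm x <= B.
Proof.
by move=> xB; apply: ge_sup => [|_ [i _ <-]//]; exists (rnorm (x 0%N)), 0%N.
Qed.

Lemma c0_normD (x y : c0) : c0_norm (x + y) <= c0_norm x + c0_norm y.
Proof.
apply: c0_norm_lub => i; apply: le_trans (rnormD _ _) _.
by apply: lerD; exact: le_c0_norm.
Qed.

Lemma c0_normZ_le (c : K) (x : c0) :
  c0_norm (c *: x) <= rnorm (c : K^o) * c0_norm x.
Proof.
apply: c0_norm_lub => i; rewrite rnormZ.
by apply: ler_wpM2l; [exact: rnorm_ge0|exact: le_c0_norm].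
Qed.

Lemma c0_norm_eq0 (x : c0) : c0_norm x = 0 -> x = 0.
Proof.
move=> x0; apply/val_inj/funext => i; apply: rnorm_eq0.
by apply/le_anti; rewrite rnorm_ge0 -x0 le_c0_norm.
Qed.

Lemma c0_norm_ge0 (x : c0) : 0 <= c0_norm x.
Proof. exact: le_trans (rnorm_ge0 _) (le_c0_norm x 0). Qed.

Lemma c0_normZ (c : K) (x : c0) :
  c0_norm (c *: x) = rnorm (c : K^o) * c0_norm x.
Proof. exact: scale_le_eq c0_normZ_le c0_norm_ge0 c x. Qed.

Definition c0_normK (x : c0) : K := of_real (c0_norm x).

Lemma c0_normK_triangle (x y : c0) :
  c0_normK (x + y) <= c0_normK x + c0_normK y.
Proof. by rewrite -of_realD ler_of_real c0_normD. Qed.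

Lemma c0_normKZ (c : K) (x : c0) : c0_normK (c *: x) = `|c| * c0_normK x.
Proof. by rewrite /c0_normK c0_normZ of_realM to_realK. Qed.

Lemma c0_normK_eq0 (x : c0) : c0_normK x = 0 -> x = 0.
Proof.
by move=> x0; apply/c0_norm_eq0/(@of_real_inj R s); rewrite of_real0.
Qed.

HB.instance Definition _ :=
  Lmodule_isNormed.Build K c0 c0_normK_triangle c0_normKZ c0_normK_eq0.

End C0.

Section DStar.
Context (R : realType) (s : scalar_kind) (w : admissible R).
Local Notation K := (scalar_field R s).
Implicit Types x y : nat -> K^o.

Definition bounded_seq x := exists M : R, forall i, rnorm (x i) <= M.

Definition weight_sum n : R := \sum_(i < n) w i.

Definition lorentz_mean x n : R :=
  (\sum_(i < n) rearr (fun j => rnorm (x j)) i) / weight_sum n.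

Definition d_star_pred : {pred nat -> K^o} :=
  fun x => `[< bounded_seq x /\ lorentz_mean x n @[n --> \oo] --> (0 : R) >].

Lemma bounded_seqP x :
  bounded_seq x -> bounded_nonneg (fun j => rnorm (x j)).
Proof. by move=> [M xM]; exists M => i; rewrite rnorm_ge0 xM. Qed.

Lemma bounded_seq_lin (c : K) x y :
  bounded_seq x -> bounded_seq y -> bounded_seq (c *: x + y).
Proof.
move=> [M xM] [N yN]; exists (rnorm (c : K^o) * M + N) => i.
apply: le_trans (rnormD _ _) _; rewrite rnormZ lerD// ler_wpM2l//.
exact: rnorm_ge0.
Qed.

Lemma weight_sum_gt0 n : 0 < weight_sum n.+1.
Proof.
rewrite /weight_sum big_ord_recl/= weight0 ltr_wpDr//.
by apply: sumr_ge0 => i _; exact: weight_ge0.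
Qed.

Lemma weight_sum_ge0 n : 0 <= weight_sum n.
Proof. by apply: sumr_ge0 => i _; exact: weight_ge0. Qed.

Lemma lorentz_mean_ge0 x n : bounded_seq x -> 0 <= lorentz_mean x n.
Proof.
move=> bx; rewrite /lorentz_mean divr_ge0 ?weight_sum_ge0//.
by apply: sumr_ge0 => i _; apply: rearr_ge0; exact: bounded_seqP.
Qed.

Lemma lorentz_mean_lin (c : K) x y n : bounded_seq x -> bounded_seq y ->
  lorentz_mean (c *: x + y) n <=
    rnorm (c : K^o) * lorentz_mean x n + lorentz_mean y n.
Proof.
move=> bx by_; rewrite mulrA -mulrDl ler_wpM2r ?invr_ge0 ?weight_sum_ge0//.
apply: sum_rearr_lin; [exact: bounded_seqP|exact: bounded_seqP| | |].
- by apply: bounded_seqP; exact: bounded_seq_lin.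
- exact: rnorm_ge0.
- by move=> i; apply: le_trans (rnormD _ _) _; rewrite rnormZ.
Qed.

Lemma lorentz_mean0 n : lorentz_mean (0 : nat -> K^o) n = 0.
Proof.
rewrite /lorentz_mean (_ : (fun j => _) = fun=> 0) ?sum_rearr0 ?mul0r//.
by apply/funext => j; rewrite rnorm0.
Qed.

Lemma d_star_submod_closed : submod_closed d_star_pred.
Proof.
split.
  rewrite unfold_in; apply/asboolP; split.
    by exists 0 => i; rewrite rnorm0.
  under eq_fun do rewrite lorentz_mean0.
  exact: cvg_cst.
move=> c x y; rewrite !unfold_in => /asboolP[bx x0] /asboolP[by_ y0].
have bxy := bounded_seq_lin c bx by_.
apply/asboolP; split => //.
have lim0 : (rnorm (c : K^o) * lorentz_mean x n + lorentz_mean y n)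
    @[n --> \oo] --> (0 : R).
  rewrite -(addr0 (0 : R)) -{1}(mulr0 (rnorm (c : K^o))).
  by apply: cvgD => //; apply: cvgMr.
apply: (squeeze_cvgr _ (cvg_cst 0) lim0); apply: nearW => n.
by rewrite lorentz_mean_ge0//= lorentz_mean_lin.
Qed.

HB.instance Definition _ :=
  GRing.isSubmodClosed.Build K (nat -> K^o) d_star_pred d_star_submod_closed.

Record d_star :=
  DStar { d_star_val :> nat -> K^o; _ : d_star_val \in d_star_pred }.

HB.instance Definition _ := [isSub for d_star_val].
HB.instance Definition _ := [Choice of d_star by <:].
HB.instance Definition _ := [SubChoice_isSubLmodule of d_star by <:].

(* [weight_sum 0 = 0], so the supremum is over [lorentz_mean x n], n >= 1. *)
Definition d_star_norm (x : d_star) : R :=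
  sup [set lorentz_mean x n.+1 | n in setT].

Lemma d_star_bounded (x : d_star) : bounded_seq x.
Proof. by case: x => x /= /asboolP[]. Qed.

Lemma d_star_has_sup (x : d_star) :
  has_sup [set lorentz_mean x n.+1 | n in setT].
Proof.
split; first by exists (lorentz_mean x 1), 0%N.
have : cvgn (lorentz_mean x).
  by apply/cvg_ex; exists 0; case: x => x /= /asboolP[].
move=> /cvg_has_sup[_ [M uM]]; exists M => _ [n _ <-].
by apply: uM; exists n.+1.
Qed.

Lemma le_d_star_norm (x : d_star) n : lorentz_mean x n.+1 <= d_star_norm x.
Proof. by apply: ub_le_sup; [exact: (d_star_has_sup x).2|exists n]. Qed.

Lemma d_star_norm_lub (x : d_star) B :
  (forall n, lorentz_mean x n.+1 <= B) -> d_star_norm x <= B.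
Proof.
by move=> xB; apply: ge_sup => [|_ [i _ <-]//]; exists (lorentz_mean x 1), 0%N.
Qed.

Lemma d_star_norm_ge0 (x : d_star) : 0 <= d_star_norm x.
Proof.
exact: le_trans (lorentz_mean_ge0 _ (d_star_bounded x)) (le_d_star_norm x 0).
Qed.

Lemma d_star_norm_lin (c : K) (x y : d_star) :
  d_star_norm (c *: x + y) <= rnorm (c : K^o) * d_star_norm x + d_star_norm y.
Proof.
apply: d_star_norm_lub => n.
have bx := d_star_bounded x; have by_ := d_star_bounded y.
apply: le_trans (lorentz_mean_lin c n.+1 bx by_) _.
rewrite lerD ?le_d_star_norm// ler_wpM2l ?le_d_star_norm//.
exact: rnorm_ge0.
Qed.

Lemma d_star_norm0 : d_star_norm 0 = 0.
Proof.
apply/le_anti; rewrite d_star_norm_ge0 andbT.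
by apply: d_star_norm_lub => n; rewrite lorentz_mean0.
Qed.

Lemma d_star_normD (x y : d_star) :
  d_star_norm (x + y) <= d_star_norm x + d_star_norm y.
Proof. by have := d_star_norm_lin 1 x y; rewrite scale1r rnorm1 mul1r. Qed.

Lemma d_star_normZ (c : K) (x : d_star) :
  d_star_norm (c *: x) = rnorm (c : K^o) * d_star_norm x.
Proof.
apply: scale_le_eq c x => [c x|]; last exact: d_star_norm_ge0.
by have := d_star_norm_lin c x 0; rewrite d_star_norm0 !addr0.
Qed.

Lemma le_d_star_norm_coord (x : d_star) i : rnorm (x i) <= d_star_norm x.
Proof.
apply: le_trans (le_d_star_norm x 0).
rewrite /lorentz_mean /weight_sum !big_ord1 weight0 divr1.
apply: (@le_rearr _ _ _ [:: i]) => //; first exact/bounded_seqP/d_star_bounded.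
by move=> j; rewrite inE => /eqP ->.
Qed.

Lemma d_star_norm_eq0 (x : d_star) : d_star_norm x = 0 -> x = 0.
Proof.
move=> x0; apply/val_inj/funext => i; apply: rnorm_eq0.
by apply/le_anti; rewrite rnorm_ge0 -x0 le_d_star_norm_coord.
Qed.

Definition d_star_normK (x : d_star) : K := of_real (d_star_norm x).

Lemma d_star_normK_triangle (x y : d_star) :
  d_star_normK (x + y) <= d_star_normK x + d_star_normK y.
Proof. by rewrite -of_realD ler_of_real d_star_normD. Qed.

Lemma d_star_normKZ (c : K) (x : d_star) :
  d_star_normK (c *: x) = `|c| * d_star_normK x.
Proof. by rewrite /d_star_normK d_star_normZ of_realM to_realK. Qed.

Lemma d_star_normK_eq0 (x : d_star) : d_star_normK x = 0 -> x = 0.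
Proof.
by move=> x0; apply/d_star_norm_eq0/(@of_real_inj R s); rewrite of_real0.
Qed.

HB.instance Definition _ := Lmodule_isNormed.Build K d_star
  d_star_normK_triangle d_star_normKZ d_star_normK_eq0.

End DStar.

Arguments c0 : clear implicits.
Arguments d_star {R} s w.

Section Polynomials.
Context (K : numFieldType) (X Y : normedModType K).

Definition multilinear n (phi : ('I_n -> X) -> Y) : Prop :=
  forall (i : 'I_n) (v : 'I_n -> X), linear (fun x : X => phi (dfwith v i x)).

(* [P(^n X; Y)]; [{ptws 'I_n -> X}] is [X^n] with the product topology. *)
Definition hom_polynomial n : set (X -> Y) :=
  [set P | exists phi : {ptws 'I_n -> X} -> Y,
    [/\ multilinear phi, continuous phi & P = fun x => phi (fun=> x)]].

(* [P_n(X; Y)] *)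
Definition polynomial_le n : set (X -> Y) :=
  [set P | exists2 p : 'I_n.+1 -> X -> Y,
    forall j : 'I_n.+1, hom_polynomial j (p j) & P = fun x => \sum_j p j x].

End Polynomials.

Arguments hom_polynomial {K} X Y n.
Arguments polynomial_le {K} X Y n.

Section NormAttaining.
Context (R : realType) (s : scalar_kind).
Context (X Y : normedModType (scalar_field R s)).
Implicit Types (P Q : X -> Y) (A S : set (X -> Y)).

Definition unit_ball : set X := [set x | `|x| <= 1].

(* Continuous polynomials are bounded on the unit ball, so on them this [sup]
   is a genuine supremum. *)
Definition poly_norm P : R := sup [set rnorm (P x) | x in unit_ball].

Definition norm_attaining P : Prop :=
  exists2 x0, unit_ball x0 & rnorm (P x0) = poly_norm P.

Definition NA S : set (X -> Y) := S `&` norm_attaining.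

Definition norm_dense A S : Prop :=
  forall P, S P -> forall e, 0 < e -> exists2 Q, A Q & poly_norm (P \- Q) < e.

End NormAttaining.

(* Main.v *)
(* If [w] is not in [ell_N], every form of degree at most [N] on [d_star] is uniformly
   approximated on the ball by its truncations to finitely many coordinates:
   otherwise there are disjoint blocks on which the form stays away from [0]; each
   argument can be replaced either by unit vectors or by a [c_0]-like sequence, so
   that the sums [sum_k +-w_k v_k] are bounded, while a choice of signs makes the
   form at these sums at least a multiple of the divergent [sum_k w_k^N].  Given
   [P], it suffices to replace one almost norming coordinate of [P] by a multiple
   of its truncation, which attains its maximum by compactness.

   If [w] is in [ell_N], let [M] be minimal with [w] in [ell_M], and let [P] have
   first coordinate [x_0^(N-M) * sum_(i >= 1) x_i^M] and all others zero.  Suppose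
   that [Q] is close to [P] and attains its norm at [x0]; then [Q]'s first coordinate
   does.  As [x0 + t u e_n] stays in the ball for large [n] and small [t], and as the
   coefficients of [t^b], [0 < b < M], vanish as [n] grows, the coefficient of [t^M],
   which is close to that of [P], makes [Q] larger than its norm for a suitable
   unimodular [u]. *)
Require Import Defs.
From mathcomp Require Import all_boot all_order all_algebra.
From mathcomp Require Import all_classical all_reals all_analysis.
From mathcomp Require Import complex lra ring.

Set Implicit Arguments.
Unset Strict Implicit.
Unset Printing Implicit Defensive.

Import Order.TTheory GRing.Theory Num.Theory.
Import numFieldNormedType.Exports.

Local Open Scope classical_set_scope.
Local Open Scope ring_scope.

(** How far [x0] can be moved along [u e_n] inside the ball depends on [x0], while the distance
    between [P] and [Q] must be fixed before [Q] and [x0] are known. The coefficients of [P] and [Q]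
    in [t] are therefore compared on a fixed interval, where [x0 + t u e_n] may leave the unit ball
    but not the ball of radius 2; only afterwards is [t] made small. Write [S] for the sum of
    [x0_i^M] over [i >= 1], and consider first coordinates. The coefficient of [t^M] in
    [P (x0 + t u e_n)] is [d = x0_0^(N-M) u^M]. If [u^M] is the phase of [S], then [d |S| = P x0]:
    thus [d] is aligned with [P x0], hence nearly with [Q x0], and [|S| <= sum_i w_i^M] bounds it
    from below. The terms of order [b < M] vanish because [w] is not in [ell_b], by the same choice
    of signs that yields uniform truncation. The norm of [c_0] is a supremum of coordinates. So
    raising one coordinate of [P] to the old norm suffices for attainment, and a polynomial near one
    with a single nonzero coordinate can attain its norm only in that coordinate. *)

Local Notation absK c := (rnorm (c : (scalar_field _ _)^o)).

(** * Multilinear maps *)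

Lemma finset_ind (T : finType) (P : {set T} -> Prop) :
  P finset.set0 -> (forall i (A : {set T}), i \notin A -> P A -> P (i |: A)%SET) ->
  forall A, P A.
Proof.
move=> P0 PU A; move: {2}#|A| (erefl #|A|) => k; elim: k A => [|k IH] A.
  by move=> /eqP; rewrite cards_eq0 => /eqP ->.
move=> Ak; have /card_gt0P[i iA] : (0 < #|A|)%N by rewrite Ak.
rewrite -(finset.setD1K iA); apply: PU; first by rewrite !inE eqxx.
by apply: IH; apply/eqP; rewrite -(eqn_add2l 1) -[X in _ == X]Ak (cardsD1 i A) iA.
Qed.

(** Turns the failure of an eventual estimate into a strictly increasing sequence of
    counterexamples. *)
Lemma subseq_of_frequent (P : nat -> nat -> Prop) :
  (forall l k, exists2 k', (k <= k')%N & P l k') ->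
  exists2 sigma : nat -> nat, {homo sigma : m n / (m < n)%N} & forall l, P l (sigma l).
Proof.
move=> h; have /choice[g gP] : forall lk : nat * nat, exists k', (lk.2 <= k')%N /\ P lk.1 k'.
  by move=> [l k]; have [k' h1 h2] := h l k; exists k'.
pose f := fix f n := if n is n'.+1 then g (n, (f n').+1) else g (0, 0)%N.
exists f; last by case=> [|n]; [exact: (gP (0, 0)%N).2|exact: (gP (n.+1, (f n).+1)).2].
by apply: homo_ltn => [|n]; [exact: ltn_trans|exact: (gP (n.+1, (f n).+1)).1].
Qed.

Lemma homo_ltn_inj (sigma : nat -> nat) : {homo sigma : m n / (m < n)%N} -> injective sigma.
Proof.
by move=> h m n mn; case: (ltngtP m n) => // /h; rewrite mn ltnn.
Qed.

Section Mix.
Context {n : nat} {X : Type}.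
Implicit Types (A : {set 'I_n}) (x y : 'I_n -> X).

(** Slots are changed one at a time with [dfwith]; [mix] records the set already changed, so that
    such arguments become inductions on [A] through [mixU1]. *)
Definition mix A x y : 'I_n -> X := fun i => if i \in A then x i else y i.

Lemma mix0 x y : mix finset.set0 x y = y.
Proof. by apply/funext => i; rewrite /mix inE. Qed.

Lemma mixT x y : mix [set: 'I_n]%SET x y = x.
Proof. by apply/funext => i; rewrite /mix inE. Qed.

Lemma mixU1 i A x y : mix (i |: A)%SET x y = dfwith (mix A x y) i (x i).
Proof.
apply/funext => j; have [<-|ij] := eqVneq i j.
  by rewrite dfwithin /mix !inE eqxx.
by rewrite dfwithout// /mix !inE eq_sym (negPf ij).
Qed.

Lemma dfwith_self (v : 'I_n -> X) i : dfwith v i (v i) = v.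
Proof.
by apply/funext => j; have [<-|ij] := eqVneq i j; rewrite ?dfwithin ?dfwithout.
Qed.

Lemma mix_dfwith_out i A x y u : i \notin A ->
  mix A x (dfwith y i u) = dfwith (mix A x y) i u.
Proof.
move=> iA; apply/funext => j; have [<-|ij] := eqVneq i j.
  by rewrite /mix (negPf iA) !dfwithin.
by rewrite dfwithout// /mix dfwithout.
Qed.

Lemma mix_dfwith_in i A x y u : i \in A ->
  mix A (dfwith x i u) y = dfwith (mix A x y) i u.
Proof.
move=> iA; apply/funext => j; have [<-|ij] := eqVneq i j.
  by rewrite /mix iA !dfwithin.
by rewrite dfwithout// /mix dfwithout.
Qed.

End Mix.

Section Multilinear.
Context {K : numFieldType} {X Y : normedModType K} {n : nat}.
Context (phi : ('I_n -> X) -> Y) (hphi : multilinear phi).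
Implicit Types (A S : {set 'I_n}) (x y z v : 'I_n -> X).

Lemma multilinearD v i a b :
  phi (dfwith v i (a + b)) = phi (dfwith v i a) + phi (dfwith v i b).
Proof. by have := hphi i v 1 a b; rewrite !scale1r. Qed.

Lemma multilinear0 v i : phi (dfwith v i 0) = 0.
Proof. by apply: (addrI (phi (dfwith v i 0))); rewrite -multilinearD !addr0. Qed.

Lemma multilinearZ v i c a : phi (dfwith v i (c *: a)) = c *: phi (dfwith v i a).
Proof. by have := hphi i v c a 0; rewrite multilinear0 !addr0. Qed.

Lemma multilinear_sum v i I (r : seq I) (P : pred I) (F : I -> X) :
  phi (dfwith v i (\sum_(k <- r | P k) F k)) =
  \sum_(k <- r | P k) phi (dfwith v i (F k)).
Proof.
by apply: (big_morph (fun a => phi (dfwith v i a))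
  (fun a b => multilinearD v i a b) (multilinear0 v i)).
Qed.

Lemma multilinear_scale A (a : 'I_n -> K) x y :
  phi (mix A (fun i => a i *: x i) y) = (\prod_(i in A) a i) *: phi (mix A x y).
Proof.
elim/finset_ind: A y => [|i A iA IH] y; first by rewrite !mix0 big_set0 scale1r.
rewrite !mixU1 multilinearZ big_setU1//= -scalerA -!(mix_dfwith_out _ _ _ iA).
by rewrite IH.
Qed.

Lemma multilinear_expand x y (c : K) :
  phi (fun i => x i + c *: y i) = \sum_(S : {set 'I_n}) c ^+ #|S| *: phi (mix S y x).
Proof.
suff H A : forall x, phi (mix A (fun i => x i + c *: y i) x) =
    \sum_(S : {set 'I_n} | S \subset A) c ^+ #|S| *: phi (mix S y x).
  rewrite -[LHS]/(phi _) -(mixT (fun i => x i + c *: y i) x) H.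
  by apply: eq_bigl => S; rewrite finset.subsetT.
elim/finset_ind: A => [|i A iA IH] {}x.
  rewrite mix0 (big_pred1 finset.set0) ?cards0 ?scale1r ?mix0// => S.
  by rewrite finset.subset0.
have mixi : mix A (fun i => x i + c *: y i) x i = x i by rewrite /mix (negPf iA).
rewrite mixU1 multilinearD multilinearZ -{1}mixi.
rewrite dfwith_self IH [RHS](bigID (fun S : {set 'I_n} => i \in S))/= [RHS]addrC.
congr (_ + _); last first.
  rewrite (reindex_onto (fun S : {set 'I_n} => i |: S)%SET (fun S => S :\ i)%SET)/=; last first.
    by move=> S /andP[_ iS]; rewrite finset.setD1K.
  rewrite -(mix_dfwith_out _ _ _ iA).
  (* Slot [i] now holds [y i]. The induction hypothesis is applied at the base point
     [dfwith x i (y i)], whose altered slot lies outside [A]. *)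
  have -> : (fun j => x j + c *: y j) =
      dfwith (fun j => dfwith x i (y i) j + c *: y j) i (x i + c *: y i).
    apply/funext => j; have [<-|ij] := eqVneq i j; first by rewrite dfwithin.
    by rewrite !dfwithout.
  have mixE w : mix A (dfwith (fun j : 'I_n => dfwith x i (y i) j + c *: y j) i w)
      (dfwith x i (y i)) = mix A (fun j : 'I_n => dfwith x i (y i) j + c *: y j)
      (dfwith x i (y i)).
    apply/funext => j; rewrite /mix; case: ifPn => // jA.
    by rewrite dfwithout//; apply: contraNneq iA => ->.
  rewrite mixE IH scaler_sumr; apply: eq_big => S.
    rewrite finset.subUset finset.sub1set finset.setU11/=.
    apply/idP/andP => [SA|[/andP[SiA _] /eqP <-]].
      have iS : i \notin S by apply: contraNN iA; exact: (fintype.subsetP SA).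
      rewrite finset.setU1K// eqxx !inE eqxx/=; split=> //.
      by rewrite andbT (fintype.subset_trans SA)// finset.subsetU1.
    rewrite -[A](finset.setU1K iA); apply: finset.setSD.
    by rewrite finset.subUset finset.sub1set finset.setU11/=.
  move=> SA; have iS : i \notin S by apply: contraNN iA; exact: (fintype.subsetP SA).
  by rewrite cardsU1 iS/= exprS scalerA mixU1 (mix_dfwith_out _ _ _ iS).
by apply: eq_bigl => S; rewrite -finset.subsetD1 finset.setU1K.
Qed.

End Multilinear.

Section Bounded.
Context {R : realType} {s : scalar_kind}.
Local Notation K := (scalar_field R s).
Implicit Types (V : normedModType K) (c : K).

Lemma rnormN V (x : V) : rnorm (- x) = rnorm x.
Proof. by rewrite /rnorm normrN. Qed.

Lemma rnormB V (x y : V) : rnorm (x - y) = rnorm (y - x).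
Proof. by rewrite /rnorm distrC. Qed.

Lemma ler_rnormB V (x y : V) : rnorm x - rnorm y <= rnorm (x + y).
Proof.
by rewrite lerBlDr -[X in rnorm X <= _](addrK y x) (le_trans (rnormD _ _))// rnormN.
Qed.

Lemma ler_dist_rnorm V (x y : V) : `|rnorm x - rnorm y| <= rnorm (x - y).
Proof.
rewrite ler_norml; apply/andP; split.
  by rewrite lerNl opprB rnormB -[X in _ - X]rnormN ler_rnormB.
by rewrite -[X in _ - X]rnormN ler_rnormB.
Qed.

Lemma rnorm_sum V I (r : seq I) (P : pred I) (F : I -> V) :
  rnorm (\sum_(i <- r | P i) F i) <= \sum_(i <- r | P i) rnorm (F i).
Proof.
elim/big_ind2 : _ => [|x1 x2 y1 y2 h1 h2|//]; first by rewrite rnorm0.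
by rewrite (le_trans (rnormD _ _))// lerD.
Qed.

Lemma absM (a b : K) : absK (a * b) = absK a * absK b.
Proof. exact: (@rnormZ R s K^o). Qed.

Lemma absX (a : K) k : absK (a ^+ k) = absK a ^+ k.
Proof. by elim: k => [|k IH]; rewrite ?expr0 ?rnorm1// !exprS absM IH. Qed.

Lemma abs_prod I (r : seq I) (P : pred I) (F : I -> K) :
  absK (\prod_(i <- r | P i) F i) = \prod_(i <- r | P i) absK (F i).
Proof. by apply: (big_morph (fun c : K => absK c) absM (@rnorm1 R s)). Qed.

Lemma abs_of_real (r : R) : absK (of_real r : K) = `|r|.
Proof.
apply: (@of_real_inj R s); rewrite to_realK.
have [r0|r0] := leP 0 r.
  by rewrite [LHS]ger0_norm ?[in RHS]ger0_norm// -(@of_real0 R s) ler_of_real.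
rewrite [LHS]ltr0_norm ?[in RHS]ltr0_norm// -?(@of_real0 R s) ?ltr_of_real//.
apply: (addrI (of_real r)); rewrite subrr -of_realD subrr; exact/esym/of_real0.
Qed.

Lemma of_realB (a b : R) : of_real (a - b) = of_real a - of_real b :> K.
Proof. by have := @of_realD R s (a - b) b; rewrite subrK => ->; rewrite addrK. Qed.

Lemma le1_rnorm V (x : V) : (`|x| <= 1) = (rnorm x <= 1).
Proof. by rewrite -to_realK -(@of_real1 R s) ler_of_real. Qed.

Lemma normalize_phase (a : K) : exists2 u : K, absK u = 1 & u * of_real (absK a) = a.
Proof.
have [->|a0] := eqVneq a 0.
  by exists 1; rewrite ?rnorm1// rnorm0 of_real0 mulr0.
exists (a / `|a|); last first.
  by rewrite to_realK mulfVK// normr_eq0.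
rewrite absM; apply: (@of_real_inj R s); rewrite of_realM !to_realK normfV normr_id.
by rewrite mulfV ?normr_eq0// of_real1.
Qed.

(** The mean of [a + b] and [a - b] is [a], so one of them is at least as long as [a]. *)
Lemma rnorm_pm V (a b : V) : exists2 t : K, t = 1 \/ t = -1 & rnorm a <= rnorm (a + t *: b).
Proof.
have [h|h] := leP (rnorm a) (rnorm (a + b)); first by exists 1; [left|rewrite scale1r].
exists (-1); [by right|rewrite scaleN1r].
have := rnormD (a + b) (a - b); rewrite addrACA subrr addr0.
rewrite (_ : a + a = (1 + 1) *: a); last by rewrite scalerDl scale1r.
rewrite rnormZ.
have -> : absK (1 + 1 : K) = 2.
  by rewrite -(@of_real1 R s) -of_realD abs_of_real ger0_norm.
lra.
Qed.

Context {X Y : normedModType K} {n : nat}.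
Context (phi : ('I_n -> X) -> Y) (hphi : multilinear phi).
Implicit Types (A S : {set 'I_n}) (x y z v : 'I_n -> X).

(* With the product of the [theta i] forced to be [tau], the mixed terms of the
   expansion can be cancelled one slot at a time. *)
Lemma sign_choice A x u z (tau : K) : A != finset.set0 -> absK tau = 1 ->
  exists2 theta : 'I_n -> K, forall i, absK (theta i) = 1 &
    rnorm (phi (mix A x z) + tau *: phi (mix A u z)) <=
    rnorm (phi (mix A (fun i => x i + theta i *: u i) z)).
Proof.
elim/finset_ind: A z tau => [|i A iA IH] z tau; first by rewrite eqxx.
move=> _ t1; have [->|A0] := eqVneq A finset.set0.
  exists (fun=> tau) => //.
  by rewrite !mixU1 !mix0 (multilinearD hphi) (multilinearZ hphi).
rewrite !mixU1 -!(mix_dfwith_out _ _ _ iA).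
pose zz a := dfwith z i a.
(* The sign [t] is such that adding the cross terms does not lower the norm. As [t * t = 1], the
   four terms form the two-term expression for [A], with slot [i] set to [x i + t *: u i] and [tau]
   replaced by [tau * t]. *)
have [t tE le1] := rnorm_pm (phi (mix A x (zz (x i))) + tau *: phi (mix A u (zz (u i))))
  (phi (mix A x (zz (u i))) + tau *: phi (mix A u (zz (x i)))).
have tt : t * t = 1 by case: tE => ->; rewrite ?mulr1// mulrNN mulr1.
have at1 : absK t = 1.
  by case: tE => ->; rewrite ?rnorm1// rnormN rnorm1.
have [|theta th le2] := IH (zz (x i + t *: u i)) (tau * t) A0.
  by rewrite absM t1 at1 mulr1.
exists (fun j => if j == i then t else theta j).
  by move=> j; case: ifP.
apply: (le_trans le1); rewrite mixU1 eqxx -(mix_dfwith_out _ _ _ iA).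
rewrite [X in _ <= rnorm (phi X)](_ : _ =
  mix A (fun i0 : 'I_n => x i0 + theta i0 *: u i0) (zz (x i + t *: u i))); last first.
  apply/funext => j; rewrite /mix; case: ifP => // jA; case: eqP => // ji.
  by rewrite ji (negPf iA) in jA.
apply: le_trans le2; rewrite le_eqVlt; apply/orP; left; apply/eqP; congr rnorm.
rewrite !(mix_dfwith_out _ _ _ iA) !(multilinearD hphi) !(multilinearZ hphi).
rewrite !scalerDr !scalerA -[in RHS]mulrA tt mulr1.
by rewrite [t * tau]mulrC addrACA; congr (_ + _); rewrite addrC.
Qed.

Definition bounded_on_ball (C : R) := forall x, (forall i, rnorm (x i) <= 1) -> rnorm (phi x) <= C.

End Bounded.

(** * Continuity of multilinear maps as boundedness on the ball *)

Section Continuity.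
Context {R : realType} {s : scalar_kind}.
Local Notation K := (scalar_field R s).
Implicit Types (V : normedModType K) (c : K).

Lemma posK (e : K) : 0 < e -> exists2 r : R, 0 < r & e = of_real r.
Proof.
move=> e0; have eE : e = of_real (absK e : R) by rewrite to_realK ger0_norm// ltW.
by exists (absK e); rewrite // -(@ltr_of_real R s) of_real0 -eE.
Qed.

Lemma rnorm_cvgP V (T : Type) (F : set_system T) (FF : Filter F) (f : T -> V) (l : V) :
  f @ F --> l <-> forall e : R, 0 < e -> \forall t \near F, rnorm (l - f t) < e.
Proof.
split=> [/cvgrPdist_lt fl e e0|fl].
  have /fl : (0 : K) < of_real e by rewrite -(@of_real0 R s) ltr_of_real.
  by apply: filterS => t; rewrite -to_realK ltr_of_real.
apply/cvgrPdist_lt => e e0; have [r r0 ->] := posK e0.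
by move=> {e0}; have h := fl _ r0; apply: (filterS _ h) => t; rewrite -to_realK ltr_of_real.
Qed.

Lemma ptws_cvg (I : Type) (V : topologicalType) (F : set_system {ptws I -> V})
    (FF : Filter F) (f : {ptws I -> V}) :
  (forall i, (fun g : {ptws I -> V} => g i) @ F --> f i) -> F --> f.
Proof.
move=> Fi; apply/cvg_sup => i U [/= _ [[W /= oW <- /= Wfi]]] /filterS.
by apply; apply: (Fi i); exact: open_nbhs_nbhs.
Qed.

Context {X Y : normedModType K} {n : nat}.
Context (phi : ('I_n -> X) -> Y) (hphi : multilinear phi).
Implicit Types (A S : {set 'I_n}) (x y z v : 'I_n -> X) (C B : R).

Lemma bounded_on_ball_ge0 C : bounded_on_ball phi C -> 0 <= C.
Proof.
by move=> /(_ (fun=> 0)) h; apply: le_trans (rnorm_ge0 _) (h _) => i; rewrite rnorm0.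
Qed.

Lemma multilinear_le_prod C x : bounded_on_ball phi C ->
  rnorm (phi x) <= C * \prod_i rnorm (x i).
Proof.
move=> bC; have C0 := bounded_on_ball_ge0 bC.
have [[i xi0]|nz] := pselect (exists i, x i = 0).
  rewrite -(dfwith_self x i) xi0 (multilinear0 hphi) rnorm0.
  by rewrite mulr_ge0// prodr_ge0// => j _; exact: rnorm_ge0.
have xn0 i : rnorm (x i) != 0.
  by apply/eqP => /rnorm_eq0 xi; apply: nz; exists i.
pose a i : K := of_real (rnorm (x i)).
have a0 i : a i != 0 by apply/eqP; rewrite -(@of_real0 R s) => /of_real_inj/eqP; exact/negP.
have -> : phi x = phi (mix [set: 'I_n]%SET (fun i => a i *: ((a i)^-1 *: x i)) x).
  rewrite mixT; congr phi; apply/funext => i.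
  by rewrite scalerA mulfV// scale1r.
rewrite (multilinear_scale hphi) mixT rnormZ abs_prod mulrC.
apply: ler_pM; rewrite ?rnorm_ge0//.
- by apply: prodr_ge0 => i _; exact: rnorm_ge0.
- apply: bC => i; rewrite rnormZ /a.
  have -> : absK ((of_real (rnorm (x i)) : K)^-1) = (rnorm (x i))^-1.
    apply: (@mulfI _ (rnorm (x i)) (xn0 i)); rewrite mulfV//.
    by rewrite -[X in X * _](ger0_norm (rnorm_ge0 _)) -(@abs_of_real R s) -absM mulfV ?rnorm1// a0.
  by rewrite mulVf.
- under eq_bigl do rewrite inE.
  by apply: ler_prod => i _; rewrite rnorm_ge0 abs_of_real ger0_norm ?rnorm_ge0//=.
Qed.

Lemma multilinear_bounded_scale C B x : bounded_on_ball phi C -> 0 <= B ->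
  (forall i, rnorm (x i) <= B) -> rnorm (phi x) <= C * B ^+ n.
Proof.
move=> bC B0 xB; apply: le_trans (multilinear_le_prod x bC) _.
apply: ler_wpM2l; first exact: bounded_on_ball_ge0 bC.
have -> : B ^+ n = \prod_(i < n) B by rewrite prodr_const card_ord.
by apply: ler_prod => i _; rewrite rnorm_ge0 xB.
Qed.

(** The slots are exchanged one by one; each exchange costs a product with one factor
    [rnorm (x i - y i)] and [n - 1] factors at most [B], and [1 <= B] absorbs the missing factor. *)
Lemma multilinear_lipschitz C B x y : bounded_on_ball phi C -> 1 <= B ->
  (forall i, rnorm (x i) <= B) -> (forall i, rnorm (y i) <= B) ->
  rnorm (phi x - phi y) <= C * B ^+ n * \sum_i rnorm (x i - y i).
Proof.
move=> bC B1 xB yB.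
suff H A : rnorm (phi (mix A x y) - phi y) <=
    C * B ^+ n * \sum_(i in A) rnorm (x i - y i).
  have := H [set: 'I_n]%SET; rewrite mixT => /le_trans; apply.
  by rewrite le_eqVlt; apply/orP; left; apply/eqP; congr (_ * _); apply: eq_bigl => i; rewrite inE.
elim/finset_ind: A => [|i A iA IH].
  by rewrite mix0 subrr rnorm0 big_set0 mulr0.
rewrite mixU1 big_setU1//= mulrDr.
have mi : mix A x y i = y i by rewrite /mix (negPf iA).
have xE : x i = (x i - y i) + y i by rewrite subrK.
rewrite {1}xE (multilinearD hphi) -{2}mi dfwith_self -addrA.
rewrite (le_trans (rnormD _ _))// lerD//.
rewrite (le_trans (multilinear_le_prod _ bC))// (bigD1 i)//= dfwithin mulrCA [leRHS]mulrC.
apply: ler_wpM2l; first exact: rnorm_ge0.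
apply: ler_wpM2l; first exact: bounded_on_ball_ge0 bC.
have -> : B ^+ n = \prod_(i < n) B by rewrite prodr_const card_ord.
rewrite [leRHS](bigD1 i)//=.
rewrite -[leLHS]mul1r ler_pM//; first by apply: prodr_ge0 => j _; exact: rnorm_ge0.
apply: ler_prod => j ji; rewrite rnorm_ge0/= dfwithout 1?eq_sym//.
by rewrite /mix; case: ifP.
Qed.

Lemma multilinear_continuousP :
  continuous (phi : {ptws 'I_n -> X} -> Y) <-> exists C, bounded_on_ball phi C.
Proof.
split=> [cphi|[C bC] x].
  apply: contrapT => nb.
  (* Dividing all [n] slots by [k.+1] leaves one factor [k.+1] of this power, so [y k] tends to 0
     while [phi (y k)] is unbounded. For [n = 0] the value [phi z0] need not vanish, hence the
     comparison with its norm below. *)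
  have /choice[x xP] : forall k : nat, exists x : 'I_n -> X,
      (forall i, rnorm (x i) <= 1) /\ (k.+1%:R ^+ n.+1 : R) < rnorm (phi x).
    move=> k; apply: contrapT => H; apply: nb; exists (k.+1%:R ^+ n.+1) => x xb.
    by rewrite leNgt; apply/negP => lt; apply: H; exists x.
  pose y k : {ptws 'I_n -> X} := fun i => (of_real (k.+1%:R^-1) : K) *: x k i.
  have y0 : y @ \oo --> ((fun=> 0) : {ptws 'I_n -> X}).
    apply: ptws_cvg => i; suff : (fun k => y k i) @ \oo --> (0 : X) by [].
    apply/rnorm_cvgP => e e0; near=> k.
    rewrite sub0r rnormN rnormZ abs_of_real ger0_norm//.
    apply: (@le_lt_trans _ _ k.+1%:R^-1); first by rewrite ler_piMr// (xP k).1.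
    by near: k; exact: near_infty_natSinv_lt (PosNum e0).
  pose z0 : 'I_n -> X := fun=> 0.
  have := cvg_comp _ _ y0 (cphi z0).
  move=> /rnorm_cvgP /(_ _ ltr01) [N _ /(_ (N + (Num.truncn (rnorm (phi z0))).+1)%N)].
  set k := (N + _)%N => /(_ (leq_addr _ _))/=; rewrite rnormB => lt1.
  have kt : rnorm (phi z0) < k%:R.
    apply: lt_le_trans (truncnS_gt _) _.
    by rewrite ler_nat leq_addl.
  clearbody k.
  have phiy : rnorm (phi (y k)) = k.+1%:R ^- n * rnorm (phi (x k)).
    have -> : y k = mix [set: 'I_n]%SET
        (fun i => (of_real k.+1%:R^-1 : K) *: x k i) (x k) by rewrite mixT.
    rewrite (multilinear_scale hphi) mixT rnormZ; congr (_ * _).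
    under eq_bigl do rewrite inE.
    by rewrite prodr_const card_ord absX abs_of_real ger0_norm// exprVn.
  have := ler_rnormB (phi (y k)) (- phi z0); rewrite rnormN => lt2.
  have : k.+1%:R < rnorm (phi (y k)).
    rewrite phiy mulrC ltr_pdivlMr ?exprn_gt0// -exprS.
    exact: (xP k).2.
  move: kt.
  rewrite -natr1; lra.
apply: (@rnorm_cvgP Y {ptws 'I_n -> X} (nbhs (x : {ptws 'I_n -> X}))
  (nbhs_filter (x : {ptws 'I_n -> X})) phi (phi x)).2 => e e0.
have [B [B1 xB]] : exists B, 1 <= B /\ forall i, rnorm (x i) + 1 <= B.
  exists (1 + \sum_i rnorm (x i)).
  split; first by rewrite lerDl sumr_ge0// => i _; exact: rnorm_ge0.
  move=> i; rewrite addrC lerD2l (bigD1 i)//= lerDl sumr_ge0// => j _.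
  exact: rnorm_ge0.
pose D := C * B ^+ n * n%:R + 1.
have C0 := bounded_on_ball_ge0 bC.
have B0 : 0 <= B by apply: le_trans B1.
have D0 : 0 < D by rewrite ltr_wpDl// !mulr_ge0// exprn_ge0.
pose d := Num.min 1 (e / D).
have d0 : 0 < d by rewrite lt_min ltr01 divr_gt0.
have near_y : \forall y \near (x : {ptws 'I_n -> X}), forall i, rnorm (x i - y i) < d.
  suff H i : \forall y \near (x : {ptws 'I_n -> X}), rnorm (x i - y i) < d.
    exact: (@filter_forall _ _ (fun i (y : {ptws 'I_n -> X}) => rnorm (x i - y i) < d)
      (nbhs (x : {ptws 'I_n -> X})) (nbhs_filter (x : {ptws 'I_n -> X})) H).
  have cvi : (fun g : {ptws 'I_n -> X} => g i) @ (x : {ptws 'I_n -> X}) --> x i.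
    exact: (@proj_continuous _ (fun=> X) i x).
  exact: (@rnorm_cvgP X {ptws 'I_n -> X} (nbhs (x : {ptws 'I_n -> X}))
    (nbhs_filter (x : {ptws 'I_n -> X})) (fun g => g i) (x i)).1 cvi _ d0.
apply: (@filterS _ _ (nbhs_filter (x : {ptws 'I_n -> X})) _ _ _ near_y) => y yd.
have yB i : rnorm (y i) <= B.
  apply: le_trans (xB i); have yE : y i = x i + (y i - x i) by rewrite addrC subrK.
  rewrite yE; apply: le_trans (rnormD _ _) _; rewrite lerD2l rnormB.
  by rewrite ltW// (lt_le_trans (yd i))// ge_min lexx.
have xB' i : rnorm (x i) <= B by apply: le_trans (xB i); rewrite lerDl.
apply: le_lt_trans (multilinear_lipschitz bC B1 xB' yB) _.
apply: (@le_lt_trans _ _ (C * B ^+ n * (n%:R * d))).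
  rewrite ler_wpM2l ?mulr_ge0 ?exprn_ge0//.
  have -> : n%:R = \sum_(i < n) 1 :> R by rewrite sumr_const card_ord.
  rewrite mulr_suml; apply: ler_sum => i _.
  by rewrite mul1r ltW.
have : C * B ^+ n * (n%:R * d) <= (D - 1) * (e / D).
  have -> : D - 1 = C * B ^+ n * n%:R by rewrite /D addrK.
  rewrite [leLHS]mulrA; apply: ler_wpM2l; first by rewrite !mulr_ge0// exprn_ge0.
  by rewrite ge_min lexx orbT.
move=> /le_lt_trans; apply; rewrite mulrCA -[ltRHS]mulr1 ltr_pM2l//.
by rewrite ltr_pdivrMr// mul1r ltrBlDr ltrDl.
Unshelve. all: by end_near.
Qed.

End Continuity.

(** * Weights and the norm of [d_star] *)

Section Weight.
Context {R : realType} (w : admissible R).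
Local Notation W := (weight_sum w).

Lemma weight_le1 i : w i <= 1.
Proof. by rewrite -(weight0 w); apply: weight_nonincreasing. Qed.

Lemma weight_sumS n : W n.+1 = W n + w n.
Proof. by rewrite /weight_sum big_ord_recr. Qed.

Lemma weight_sum0 : W 0 = 0.
Proof. by rewrite /weight_sum big_ord0. Qed.

Lemma weight_sum_nondecreasing m n : (m <= n)%N -> W m <= W n.
Proof.
move=> /subnK <-; elim: (n - m)%N => // k IH.
by rewrite addSn weight_sumS (le_trans IH)// lerDl weight_ge0.
Qed.

Lemma weight_sum_unbounded B : exists n0, forall n, (n0 <= n)%N -> B <= W n.
Proof.
have /cvgryPge/(_ B)[n0 _ h] := weight_dvg w.
by exists n0 => n /h; rewrite /series/= big_mkord.
Qed.

(** By monotonicity a vanishing weight would make [W] constant from there on, against its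
    divergence. *)
Lemma weight_gt0 i : 0 < w i.
Proof.
rewrite lt_neqAle weight_ge0 andbT; apply/eqP => wi0.
have [n0 /(_ _ (leq_addl i n0))] := weight_sum_unbounded (W i + 1).
suff -> : W (i + n0) = W i by rewrite leNgt ltrDl ltr01.
elim: n0 => [|k IH]; first by rewrite addn0.
rewrite addnS weight_sumS IH; apply/eqP; rewrite -subr_eq0 addrAC subrr add0r.
by rewrite eq_le weight_ge0 andbT wi0 weight_nonincreasing// leq_addr.
Qed.

Lemma weight_sum_add a b m : (a + b <= m.+1)%N -> W a + b%:R * w m <= W (a + b).
Proof.
elim: b => [|b IH] abm; first by rewrite mul0r addr0 addn0.
rewrite addnS weight_sumS -natr1 mulrDl mul1r addrA lerD//.
  by apply: IH; apply: ltnW; rewrite -addnS.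
by apply: weight_nonincreasing; rewrite -ltnS -addnS.
Qed.

Lemma weight_sum_le n : W n <= n%:R.
Proof.
by elim: n => [|n IH]; rewrite ?weight_sum0// weight_sumS -natr1 lerD// weight_le1.
Qed.

Lemma weight_sum_ge1 n : 1 <= W n.+1.
Proof.
apply: le_trans (weight_sum_nondecreasing (ltn0Sn n)).
by rewrite weight_sumS weight_sum0 add0r weight0.
Qed.

(** Since [w] tends to 0, so do its averages. *)
Lemma weight_sum_small e : 0 < e -> exists m, forall n, (m <= n)%N -> W n <= e * n%:R.
Proof.
move=> e0; have e20 : 0 < e / 2 by rewrite divr_gt0.
have /cvgrPdist_le/(_ _ e20)[k _ hk] := weight_cvg0 w.
have le n : W n <= k%:R + (e / 2) * n%:R.
  elim: n => [|n IH]; first by rewrite weight_sum0 mulr0 addr0.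
  have [nk|kn] := ltnP n k; last first.
    rewrite weight_sumS -[n.+1%:R]natr1 mulrDr mulr1 addrA.
    rewrite lerD//; have := hk _ kn; rewrite sub0r normrN ger0_norm//.
    exact: weight_ge0.
  apply: (@le_trans _ _ n.+1%:R); first exact: weight_sum_le.
  apply: (@le_trans _ _ k%:R); first by rewrite ler_nat.
  by rewrite lerDl mulr_ge0// ltW.
exists (Num.truncn (k%:R / (e / 2))).+1 => n hn.
apply: le_trans (le n) _; rewrite {2}(splitr e) mulrDl lerD2r.
rewrite mulrC -ler_pdivrMr//.
apply: (@le_trans _ _ (Num.truncn (k%:R / (e / 2))).+1%:R); last by rewrite ler_nat.
exact/ltW/truncnS_gt.
Qed.

Lemma sum_weight_uniq t : uniq t -> \sum_(l <- t) w l <= W (size t).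
Proof.
move: {2}(size t) (erefl (size t)) => n; elim: n t => [|n IH] t tn ut.
  by rewrite (size0nil tn) big_nil weight_sum0.
have [M Mt Mn] : exists2 M, M \in t & (n <= M)%N.
  apply: contrapT => h.
  have : (size t <= size (iota 0 n))%N.
    apply: uniq_leq_size => // i it; rewrite mem_iota/= add0n ltnNge; apply/negP => ni.
    by apply: h; exists i.
  by rewrite size_iota tn ltnn.
rewrite (perm_big _ (perm_to_rem Mt))/= big_cons addrC tn weight_sumS lerD//.
  by have := IH (rem M t); rewrite size_rem// tn; apply; rewrite ?rem_uniq.
exact: weight_nonincreasing.
Qed.

Lemma in_ellP p : in_ell p w <-> exists B, forall n, \sum_(i < n) w i ^+ p <= B.
Proof.
have E n : series (fun i => `|w i| ^+ p) n = \sum_(i < n) w i ^+ p.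
  by rewrite /series/= big_mkord; apply: eq_bigr => i _; rewrite ger0_norm ?weight_ge0.
have nd : nondecreasing_seq (series (fun i => `|w i| ^+ p)).
  by apply: nondecreasing_series => i _ _; rewrite exprn_ge0.
split=> [cv|[B hB]].
  by exists (limn (series (fun i => `|w i| ^+ p))) => n; rewrite -E; exact: nondecreasing_cvgn_le.
apply: nondecreasing_is_cvgn => //; exists B => _ [n _ <-]; rewrite E; exact: hB.
Qed.

Lemma not_in_ell p : ~ in_ell p w -> forall B, exists n, B < \sum_(i < n) w i ^+ p.
Proof.
move=> nl B; apply: contrapT => h; apply: nl; apply/in_ellP; exists B => n.
by rewrite leNgt; apply/negP => lt; apply: h; exists n.
Qed.

Lemma in_ell_le p q : (p <= q)%N -> in_ell p w -> in_ell q w.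
Proof.
move=> pq /in_ellP[B hB]; apply/in_ellP; exists B => n; apply: le_trans (hB n).
by apply: ler_sum => i _; rewrite ler_wiXn2l ?weight_ge0 ?weight_le1.
Qed.

Lemma not_in_ell1 : ~ in_ell 1 w.
Proof.
move=> /in_ellP[B hB]; have [n /(_ n (leqnn n))] := weight_sum_unbounded (B + 1).
have := hB n; under eq_bigr do rewrite expr1.
by rewrite -/(weight_sum w n); lra.
Qed.

End Weight.

(** * Descriptions of [d_star] free of rearrangements *)

Section DStarTools.
Context {R : realType} {s : scalar_kind} {w : admissible R}.
Local Notation K := (scalar_field R s).
Local Notation X := (d_star s w).
Local Notation W := (weight_sum w).
Implicit Types (x y : X) (t : seq nat) (i n m : nat).

Lemma d_starDE x y i : (x + y) i = x i + y i. Proof. by []. Qed.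
Lemma d_starNE x i : (- x) i = - x i. Proof. by []. Qed.
Lemma d_starZE (c : K) x i : (c *: x) i = c *: x i. Proof. by []. Qed.
Lemma d_star_sumE I (r : seq I) (P : pred I) (F : I -> X) i :
  (\sum_(k <- r | P k) F k) i = \sum_(k <- r | P k) F k i.
Proof. by apply: (big_morph (fun x : X => x i)). Qed.

Lemma rnorm_d_starE x : rnorm x = d_star_norm x.
Proof. by rewrite /rnorm /= /Num.norm/= /d_star_normK of_realK. Qed.

(** The first [n] rearranged terms add up to the supremum of the sums over [n] distinct indices. All
    later norm estimates use this form. *)
Lemma d_star_normP x C : rnorm x <= C <->
  forall t, uniq t -> \sum_(i <- t) rnorm (x i) <= C * W (size t).
Proof.
have bx := bounded_seqP (d_star_bounded x).
rewrite rnorm_d_starE; split=> [xC t ut|h].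
  apply: le_trans (sum_le_rearr bx ut) _.
  case: (size t) => [|n]; first by rewrite big_ord0 weight_sum0 mulr0.
  rewrite -ler_pdivrMr ?weight_sum_gt0//; exact: le_trans (le_d_star_norm x n) xC.
apply: d_star_norm_lub => n; rewrite ler_pdivrMr ?weight_sum_gt0//.
by apply: sum_rearr_lub => // t ut tn; rewrite -tn; exact: h.
Qed.

(** The limit condition for membership in [d_star], in the same form. *)
Definition mean_vanishes (x : nat -> K^o) := forall e : R, 0 < e -> exists m, forall n t,
  (m <= n)%N -> uniq t -> size t = n -> \sum_(i <- t) rnorm (x i) <= e * W n.

Lemma d_star_mean_vanishes x : mean_vanishes x.
Proof.
have bx := bounded_seqP (d_star_bounded x).
move=> e e0; case: x bx => x /= xX bx; move/asboolP: (xX) => [_].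
move=> /cvgrPdist_le/(_ _ e0)[m _ hm]; exists m.+1 => -[//|n] t mn ut tn.
have := hm n.+1 (ltnW mn); rewrite sub0r normrN ger0_norm; last first.
  by rewrite lorentz_mean_ge0//; move/asboolP: xX => [].
rewrite /lorentz_mean ler_pdivrMr ?weight_sum_gt0//; apply: le_trans.
by rewrite -tn; exact: sum_le_rearr.
Qed.

Lemma d_star_predP (x : nat -> K^o) : (exists M : R, forall i, rnorm (x i) <= M) ->
  mean_vanishes x -> x \in @d_star_pred R s w.
Proof.
move=> bx h; apply/asboolP; split=> //.
apply/cvgrPdist_le => e e0; have [m hm] := h e e0.
exists m.+1 => // -[//|n] mn; rewrite sub0r normrN ger0_norm ?lorentz_mean_ge0//.
rewrite /lorentz_mean ler_pdivrMr ?weight_sum_gt0//.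
by apply: sum_rearr_lub => [|t ut tn]; [exact: bounded_seqP|apply: hm => //; exact: ltnW].
Qed.

Lemma le_rnorm_coord x i : rnorm (x i) <= rnorm x.
Proof. by rewrite rnorm_d_starE; exact: le_d_star_norm_coord. Qed.

(** Otherwise arbitrarily many coordinates exceed [e]; as [W n <= n], their sums contradict the
    vanishing of the means at [e / 2]. *)
Lemma d_star_coord_small x (e : R) : 0 < e -> exists m, forall i, (m <= i)%N -> rnorm (x i) <= e.
Proof.
move=> e0; apply: contrapT => h.
have fr (l k : nat) : exists2 k', (k <= k')%N & e < rnorm (x k').
  apply: contrapT => h2; apply: h; exists k => i ki; rewrite leNgt; apply/negP => lt.
  by apply: h2; exists i.
have [sg shomo hs] := subseq_of_frequent (P := fun _ k => e < rnorm (x k)) fr.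
have e20 : 0 < e / 2 by rewrite divr_gt0.
have [m /(_ m.+1 [seq sg i | i <- iota 0 m.+1] (leqnSn m))] := d_star_mean_vanishes x e20.
rewrite map_inj_uniq ?iota_uniq; last exact: homo_ltn_inj.
rewrite size_map size_iota => /(_ isT erefl); rewrite big_map.
have : e * m.+1%:R <= \sum_(j <- iota 0 m.+1) rnorm (x (sg j)).
  have -> : e * m.+1%:R = \sum_(j <- iota 0 m.+1) e.
    by rewrite big_const_seq count_predT size_iota iter_addr addr0 mulr_natr.
  by apply: ler_sum => i _; rewrite ltW.
have : e / 2 * W m.+1 <= e / 2 * m.+1%:R by rewrite ler_pM2l// weight_sum_le.
have : 0 < e / 2 * m.+1%:R by rewrite mulr_gt0.
lra.
Qed.

End DStarTools.

(** * Coordinate projections, unit vectors and perturbations in [d_star] *)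

Section DStarMask.
Context {R : realType} {s : scalar_kind} {w : admissible R}.
Local Notation K := (scalar_field R s).
Local Notation X := (d_star s w).
Local Notation W := (weight_sum w).
Implicit Types (x y : X) (t : seq nat) (i n m : nat) (p : pred nat).

Lemma d_star_pred_dominated x (y : nat -> K^o) :
  (forall i, rnorm (y i) <= rnorm (x i)) -> y \in @d_star_pred R s w.
Proof.
move=> yx; apply: d_star_predP.
  by exists (rnorm x) => i; apply: le_trans (yx i) (le_rnorm_coord x i).
move=> e /(d_star_mean_vanishes x)[m hm]; exists m => n t mn ut tn.
by apply: le_trans (hm n t mn ut tn); exact: ler_sum.
Qed.

Lemma rnorm_dominated x y : (forall i, rnorm (y i) <= rnorm (x i)) -> rnorm y <= rnorm x.
Proof.
move=> yx; apply/d_star_normP => t ut.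
by apply: le_trans ((d_star_normP x _).1 (lexx _) t ut); exact: ler_sum.
Qed.

Lemma d_mask_subproof p x : (fun i => if p i then x i else 0) \in @d_star_pred R s w.
Proof.
apply: (d_star_pred_dominated (x := x)) => i.
by case: ifP => // _; rewrite rnorm0 rnorm_ge0.
Qed.

Definition d_mask p x : X := locked (DStar (d_mask_subproof p x)).

Lemma d_maskE p x i : d_mask p x i = if p i then x i else 0. Proof. by rewrite /d_mask -lock. Qed.

Lemma d_star_eqP x y : (forall i, x i = y i) -> x = y.
Proof. by move=> xy; apply/val_inj/funext. Qed.

Lemma d_mask_linear p (c : K) x y : d_mask p (c *: x + y) = c *: d_mask p x + d_mask p y.
Proof.
apply: d_star_eqP => i; rewrite d_starDE d_starZE !d_maskE; case: ifP => //.
by rewrite scaler0 addr0.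
Qed.

Lemma rnorm_d_mask p x : rnorm (d_mask p x) <= rnorm x.
Proof.
by apply: rnorm_dominated => i; rewrite d_maskE; case: ifP => // _; rewrite rnorm0 rnorm_ge0.
Qed.

Lemma d_maskC p x : x = d_mask p x + d_mask (predC p) x.
Proof.
by apply: d_star_eqP => i; rewrite d_starDE !d_maskE /=; case: ifP; rewrite ?addr0 ?add0r.
Qed.

Lemma basis_subproof n : (fun i => (i == n)%:R) \in @d_star_pred R s w.
Proof.
have E t : uniq t -> \sum_(i <- t) rnorm ((i == n)%:R : K^o) <= 1.
  move=> ut; rewrite (bigID (pred1 n))/= [X in _ + X]big1 ?addr0; last first.
    by move=> i /negPf ->; rewrite rnorm0.
  have [nt|nt] := boolP (n \in t); last first.
    rewrite big_seq_cond big1 ?ler01// => i /andP[it /eqP ni].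
    by move: nt; rewrite -ni it.
  by rewrite -big_filter filter_pred1_uniq// big_seq1 eqxx rnorm1.
apply: d_star_predP.
  by exists 1 => i; case: eqP => _; rewrite ?rnorm1 ?rnorm0.
move=> e e0; have [m hm] := weight_sum_unbounded w (1 / e); exists m => k t mk ut tk.
by apply: le_trans (E _ ut) _; rewrite mulrC -ler_pdivrMr// hm.
Qed.

Definition d_basis n : X := locked (DStar (basis_subproof n)).

Lemma d_basisE n i : d_basis n i = (i == n)%:R. Proof. by rewrite /d_basis -lock. Qed.

Lemma rnorm_d_basis n : rnorm (d_basis n) <= 1.
Proof.
apply/d_star_normP => t ut; rewrite mul1r.
case: t ut => [_|a t ut]; first by rewrite big_nil weight_sum0.
apply: le_trans (weight_sum_ge1 w (size t)).
rewrite (bigID (pred1 n))/= [X in _ + X]big1 ?addr0; last first.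
  by move=> i /negPf ni; rewrite ?d_basisE ni rnorm0.
have [nt|nt] := boolP (n \in a :: t); last first.
  rewrite big_seq_cond big1 ?ler01// => i /andP[it /eqP ni].
  by move: nt; rewrite -ni it.
by rewrite -big_filter filter_pred1_uniq// big_seq1 ?d_basisE eqxx rnorm1.
Qed.

Lemma d_mask_finite p x L : (forall i, p i -> x i != 0 -> (i < L)%N) ->
  d_mask p x = \sum_(i < L | p i) x i *: d_basis i.
Proof.
move=> pL; apply: d_star_eqP => i; rewrite d_maskE d_star_sumE.
case: ifP => [pi|npi]; last first.
  rewrite big1// => j pj; rewrite d_starZE d_basisE; case: eqP => [ij|_]; last by rewrite scaler0.
  by rewrite ij pj in npi.
have [xi0|/(pL _ pi) iL] := eqVneq (x i) 0.
  rewrite xi0 big1// => j pj; rewrite d_starZE d_basisE; case: eqP => [<-|_].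
    by rewrite xi0 scale0r.
  by rewrite scaler0.
rewrite (bigD1 (Ordinal iL) pi) big1 => [|j /andP[_ ji]].
  by rewrite [RHS]addr0 d_starZE d_basisE/= eqxx /GRing.scale/= mulr1.
rewrite d_starZE d_basisE; case: eqP => [ij|_]; last by rewrite scaler0.
by move: ji; rewrite -val_eqE/= ij eqxx.
Qed.

Definition d_trunc m x : X := d_mask (fun i => (i < m)%N) x.

Lemma d_truncE m x i : d_trunc m x i = if (i < m)%N then x i else 0.
Proof. exact: d_maskE. Qed.

Lemma d_trunc_basis m n : (n < m)%N -> d_trunc m (d_basis n) = d_basis n.
Proof.
move=> nm; apply: d_star_eqP => i; rewrite d_truncE d_basisE.
by case: ltnP => // mi; case: eqP => // ni; move: mi; rewrite ni leqNgt nm.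
Qed.

Lemma d_trunc_sum m x : d_trunc m x = \sum_(i < m) x i *: d_basis i.
Proof.
rewrite /d_trunc (@d_mask_finite _ _ m)//; apply: eq_bigl => i; exact: ltn_ord.
Qed.

(* [W (a + b) >= W a + b w_m] when [a + b <= m + 1]: below length [m] a small
   tail is absorbed by the weights. *)
Lemma sum_split_le (F : nat -> R) (C : R) p t m : 0 <= C -> uniq t -> (size t <= m.+1)%N ->
  (forall u, uniq u -> {subset u <= p} -> \sum_(i <- u) F i <= C * W (size u)) ->
  (forall i, ~~ p i -> F i <= C * w m) ->
  \sum_(i <- t) F i <= C * W (size t).
Proof.
move=> C0 ut tm hp hnp; rewrite (bigID p)/= -big_filter -[X in _ + X]big_filter.
have <- := count_predC p t; rewrite -!size_filter.
apply: (@le_trans _ _ (C * (W (size (seq.filter p t)) + (size (seq.filter (predC p) t))%:R * w m))).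
  rewrite mulrDr lerD//.
    apply: hp; first exact: filter_uniq.
    by move=> i; rewrite mem_filter => /andP[].
  rewrite mulrCA mulr_natl -iter_addr_0 -[X in iter X]count_predT -big_const_seq.
  by rewrite !big_seq; apply: ler_sum => i; rewrite mem_filter => /andP[/hnp].
rewrite ler_wpM2l// weight_sum_add// (leq_trans _ tm)//.
by rewrite !size_filter count_predC.
Qed.

(** Index sets of size at least [k] are controlled by the vanishing means of [x], shorter ones by
    making the remaining coordinates small against [w k]. The next two lemmas split in the same
    way. *)
Lemma d_trunc_cvg x (e : R) : 0 < e ->
  exists m0, forall m, (m0 <= m)%N -> rnorm (x - d_trunc m x) <= e.
Proof.
move=> e0; have [k hk] := d_star_mean_vanishes x e0.
have [m0 hm] := d_star_coord_small x (mulr_gt0 e0 (weight_gt0 w k)).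
exists m0 => m mm; apply/d_star_normP => t ut.
have le i : rnorm ((x - d_trunc m x) i) <= rnorm (x i).
  rewrite d_starDE d_starNE d_truncE; case: ifP => _; last by rewrite subr0.
  by rewrite subrr rnorm0 rnorm_ge0.
have [kt|tk] := leqP k (size t).
  by apply: le_trans (hk _ t kt ut erefl); exact: ler_sum.
apply: (@sum_split_le _ _ pred0 _ k) => //; [exact: ltW|exact/ltnW/(leq_trans tk)| |].
  case=> [|a u _ /(_ a (mem_head _ _))//]; by rewrite big_nil mulr_ge0 ?(ltW e0) ?weight_sum_ge0.
move=> i _; rewrite d_starDE d_starNE d_truncE; case: ltnP => im.
  by rewrite subrr rnorm0 mulr_ge0 ?(ltW e0) ?weight_ge0.
by rewrite subr0 hm// (leq_trans mm).
Qed.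

(** On long index sets [x] uses at most half of the bound and the added vector at most the other
    half. On short ones the coordinates below [n0] are unchanged, and each later coordinate is at
    most [w k], half from [x] and half from [c]. *)
Lemma d_star_perturb x : rnorm x <= 1 -> exists2 d : R, 0 < d & exists n0,
  forall n (c : K), (n0 <= n)%N -> absK c <= d -> rnorm (x + c *: d_basis n) <= 1.
Proof.
move=> x1; have h20 : (0 : R) < 2^-1 by rewrite invr_gt0.
have [k hk] := d_star_mean_vanishes x h20.
have [n0 hn] := d_star_coord_small x (mulr_gt0 h20 (weight_gt0 w k)).
exists (2^-1 * w k); first exact: mulr_gt0 h20 (weight_gt0 w k).
exists n0 => n c nn cd; apply/d_star_normP => t ut.
have le i : rnorm ((x + c *: d_basis n) i) <= rnorm (x i) + absK c * rnorm (d_basis n i).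
  by rewrite d_starDE d_starZE (le_trans (rnormD _ _))// rnormZ.
have [kt|tk] := leqP k (size t).
  case: t ut kt => [|a t] ut kt; first by rewrite big_nil weight_sum0 mulr0.
  apply: (@le_trans _ _ (\sum_(i <- a :: t) (rnorm (x i) + absK c * rnorm (d_basis n i)))).
    exact: ler_sum.
  rewrite big_split/= -mulr_sumr.
  have h1 := hk _ _ kt ut erefl.
  have := (d_star_normP _ _).1 (rnorm_d_basis n) _ ut; rewrite mul1r.
  set S := \sum_(i <- _) rnorm (d_basis _ _) => h2.
  have h3 : absK c * S <= 2^-1 * W (size (a :: t)).
    apply: ler_pM => //; rewrite ?rnorm_ge0//.
      by apply: sumr_ge0 => i _; exact: rnorm_ge0.
    by apply: (le_trans cd); rewrite -[leRHS]mulr1 ler_pM2l// weight_le1.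
  apply: le_trans (lerD h1 h3) _; rewrite -mulrDl.
  by rewrite -[2^-1]mul1r -splitr mul1r.
apply: (@sum_split_le _ _ (fun i => (i < n0)%N) _ k) => //.
- exact: ltnW (leq_trans tk _).
- move=> u uu un; apply: le_trans ((d_star_normP x 1).1 x1 u uu).
  rewrite !big_seq; apply: ler_sum => i /un; rewrite unfold_in => iu.
  by rewrite d_starDE d_starZE d_basisE (ltn_eqF (leq_trans iu nn)) scaler0 addr0.
- move=> i; rewrite -leqNgt => ni; apply: le_trans (le i) _; rewrite mul1r.
  rewrite [w k](splitr _) lerD//; first by rewrite mulrC hn.
  apply: (@le_trans _ _ (absK c)); last by rewrite mulrC.
  by rewrite ler_piMr ?rnorm_ge0// (le_trans (le_rnorm_coord _ _))// rnorm_d_basis.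
Qed.

(** The bound 2 is reproduced, which permits iteration: on long index sets the means of [x] have
    dropped below 1, leaving room for [y]; on short ones the coordinates of [y] are absorbed by the
    weights. *)
Lemma d_star_disjoint_add x : rnorm x <= 2 -> exists2 d : R, 0 < d & forall y,
  rnorm y <= 1 -> (forall i, rnorm (y i) <= d) -> (forall i, x i = 0 \/ y i = 0) ->
  rnorm (x + y) <= 2.
Proof.
move=> x2; have [k hk] := d_star_mean_vanishes x ltr01.
exists (w k) => [|y y1 yd xy]; first exact: weight_gt0.
apply/d_star_normP => t ut; have [kt|tk] := leqP k (size t).
  apply: (@le_trans _ _ (\sum_(i <- t) (rnorm (x i) + rnorm (y i)))).
    by apply: ler_sum => i _; rewrite d_starDE rnormD.
  rewrite big_split/= [X in X * _](_ : _ = 1 + 1)// mulrDl lerD//; first exact: hk.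
  exact: (d_star_normP y 1).1.
apply: (@sum_split_le _ _ (fun i => x i != 0) _ k) => //.
- exact: ltnW (leq_trans tk _).
- move=> u uu un; apply: le_trans ((d_star_normP x 2).1 x2 u uu).
  rewrite !big_seq; apply: ler_sum => i /un; rewrite unfold_in => iu.
  by rewrite d_starDE; case: (xy i) => h; [rewrite h eqxx in iu|rewrite h addr0].
- move=> i; rewrite negbK => /eqP xi; rewrite d_starDE xi add0r.
  by apply: le_trans (yd i) _; rewrite ler_peMl ?weight_ge0// ler1n.
Qed.

End DStarMask.

(** * Forms on block sequences *)

Section Good.
Context {R : realType} {s : scalar_kind} {w : admissible R}.
Local Notation K := (scalar_field R s).
Local Notation X := (d_star s w).
Local Notation W := (weight_sum w).
Implicit Types (x y : X) (t : seq nat) (p : pred nat) (v : nat -> X).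

(* The weighted sums [sum_l theta_l w_l v_l] stay bounded, along every
   subsequence; this holds for the unit vectors and for [c_0]-like blocks. *)
Definition weight_bounded v := exists C : R, forall sigma : nat -> nat, injective sigma ->
  forall n (theta : nat -> K), (forall l, absK (theta l) <= 1) ->
  rnorm (\sum_(l < n) (theta l * of_real (w l)) *: v (sigma l)) <= C.

Lemma weight_bounded_comp v sigma : injective sigma -> weight_bounded v ->
  weight_bounded (v \o sigma).
Proof.
move=> inj [C hC]; exists C => tau injt n theta th.
exact: (hC (sigma \o tau) (inj_comp inj injt)).
Qed.

Lemma weight_boundedZ v (c : K) : weight_bounded v -> weight_bounded (fun k => c *: v k).
Proof.
move=> [C hC]; exists (absK c * C) => tau injt n theta th.
under eq_bigr do rewrite scalerA mulrC -scalerA.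
by rewrite -scaler_sumr rnormZ ler_wpM2l ?rnorm_ge0// hC.
Qed.

Lemma abs_weight l : absK (of_real (w l) : K) = w l.
Proof. by rewrite abs_of_real ger0_norm// weight_ge0. Qed.

(** An index set of size [n] meets at most [n] of the unit vectors, and [n] distinct weights add up
    to at most [W n]. *)
Lemma weight_bounded_basis iota_ : injective iota_ ->
  weight_bounded (fun k => d_basis (iota_ k)).
Proof.
move=> inj; exists 1 => sigma injs n theta th; apply/d_star_normP => t ut; rewrite mul1r.
pose j l := iota_ (sigma l); have jinj : injective j by move=> a b /inj/injs.
pose T := [seq l <- iota 0 n | j l \in t].
have uT : uniq T by rewrite filter_uniq ?iota_uniq.
apply: (@le_trans _ _ (\sum_(l <- T) w l)); last first.
  apply: le_trans (sum_weight_uniq w uT) _; apply: weight_sum_nondecreasing.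
  rewrite -(size_map j T); apply: uniq_leq_size; first by rewrite map_inj_uniq.
  by move=> i /mapP[l]; rewrite mem_filter => /andP[jt _] ->.
apply: (@le_trans _ _ (\sum_(i <- t) \sum_(l < n) w l * (i == j l)%:R)).
  apply: ler_sum => i _; rewrite d_star_sumE; apply: le_trans (rnorm_sum _ _ _) _.
  apply: ler_sum => l _; rewrite d_starZE rnormZ absM abs_weight d_basisE.
  case: eqP => _; rewrite ?rnorm1 ?rnorm0 ?mulr0// !mulr1.
  by rewrite ler_piMl ?weight_ge0.
rewrite exchange_big/= /T big_filter.
rewrite -(big_mkord xpredT (fun l => \sum_(i <- t) w l * (i == j l)%:R)).
rewrite /index_iota subn0 [leRHS]big_mkcond/=; apply: ler_sum => l _.
rewrite -mulr_sumr; case: ifPn => [jt|jnt]; last first.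
  rewrite big_seq big1 ?mulr0// => i it; case: eqP => // ij.
  by move: jnt; rewrite -ij it.
rewrite (bigID (pred1 (j l)))/= [X in _ + X]big1 => [|i /negPf ->//].
by rewrite -big_filter filter_pred1_uniq// big_seq1 eqxx addr0 mulr1.
Qed.

Lemma align_phase (a b : K) : exists2 tau : K, absK tau = 1 &
  absK a + absK b <= absK (a + tau * b).
Proof.
have [ua ua1 aE] := normalize_phase a; have [ub ub1 bE] := normalize_phase b.
have ub0 : ub != 0 by apply/eqP => ub0; move: ub1; rewrite ub0 rnorm0; lra.
exists (ua / ub).
  have := absM ua^-1 ua; have := absM (ua / ub) ub.
  by rewrite mulfVK// ua1 ub1 mulr1 => <-.
rewrite -{2}aE -{2}bE mulrA mulfVK// -mulrDr absM ua1 mul1r -of_realD abs_of_real.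
by rewrite ger0_norm// addr_ge0// rnorm_ge0.
Qed.

Section Diagonal.
Context {n : nat} (phi : ('I_n -> X) -> K^o) (hphi : multilinear phi).
Context (C : R) (bC : bounded_on_ball phi C).

(** Blocks are added one at a time: [align_phase] makes the pure term of the new block, of size at
    least [w m ^+ #|A| * e], add to the value reached so far, and [sign_choice] disposes of the
    mixed terms. *)
Lemma diagonal_greedy (A : {set 'I_n}) (z : 'I_n -> X) (v : nat -> 'I_n -> X) (e : R) :
  A != finset.set0 -> (forall k, e <= rnorm (phi (mix A (v k) z))) ->
  forall m, exists2 theta : nat -> 'I_n -> K, forall k (i : 'I_n), absK (theta k i) = 1 &
    \sum_(k < m) w k ^+ #|A| * e <= rnorm (phi (mix A
      (fun i => \sum_(k < m) (theta k i * of_real (w k)) *: v k i) z)).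
Proof.
move=> A0 ve; elim=> [|m [th th1 le]].
  by exists (fun _ _ => 1) => [k i|]; rewrite ?rnorm1// big_ord0 rnorm_ge0.
pose x i := \sum_(k < m) (th k i * of_real (w k)) *: v k i.
pose u i := (of_real (w m) : K) *: v m i.
have [tau tau1 tauE] := align_phase (phi (mix A x z)) (phi (mix A u z)).
have [eta eta1 etaE] := sign_choice hphi x u z A0 tau1.
exists (fun k => if k == m then eta else th k) => [k i|]; first by case: ifP.
rewrite [in leRHS](_ : (fun i => _) = (fun i => x i + eta i *: u i)); last first.
  apply/funext => i; rewrite big_ord_recr/= eqxx scalerA; congr (_ + _).
  by apply: eq_bigr => k _; rewrite (ltn_eqF (ltn_ord k)).
apply: le_trans etaE; apply: le_trans tauE; rewrite big_ord_recr/= lerD//.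
rewrite /u (multilinear_scale hphi) prodr_const rnormZ absX abs_weight.
by rewrite ler_wpM2l ?exprn_ge0 ?weight_ge0.
Qed.

(** Serves both directions of the theorem: the blocks on which truncation fails, and the low order
    coefficients along unit vectors. *)
Lemma diagonal_contra (A : {set 'I_n}) (z : 'I_n -> X) (v : nat -> 'I_n -> X) (e : R) :
  A != finset.set0 -> ~ in_ell #|A| w ->
  (forall i : 'I_n, i \in A -> weight_bounded (fun k => v k i)) ->
  0 < e -> (forall k, e <= rnorm (phi (mix A (v k) z))) -> False.
Proof.
move=> A0 nl vA e0 ve.
have /fin_all_exists[D hD] : forall i : 'I_n, exists D : R, i \in A ->
    forall m (theta : nat -> K), (forall l, absK (theta l) <= 1) ->
    rnorm (\sum_(l < m) (theta l * of_real (w l)) *: v l i) <= D.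
  move=> i; have [/vA[D hD]|_] := boolP (i \in A); last by exists 0.
  by exists D => _ m theta th; apply: (hD id) => // a b.
pose B := \sum_i (`|D i| + rnorm (z i)).
have B0 : 0 <= B by apply: sumr_ge0 => i _; rewrite addr_ge0// rnorm_ge0.
have Di i : `|D i| + rnorm (z i) <= B.
  rewrite /B (bigD1 i)//= lerDl; apply: sumr_ge0 => j _.
  by rewrite addr_ge0// rnorm_ge0.
have [m hm] := not_in_ell nl (C * B ^+ n / e).
have [th th1 le] := diagonal_greedy A0 ve m.
have := le_trans le (multilinear_bounded_scale hphi bC B0 _).
rewrite -mulr_suml leNgt -ltr_pdivrMr// hm => H.
suff : false by [].
apply: H => i; rewrite /mix; case: ifPn => iA; apply: le_trans (Di i); last by rewrite lerDr.
rewrite -[leLHS]addr0 lerD ?rnorm_ge0//.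
by rewrite (le_trans (hD i iA m (fun l => th l i) _))// ?ler_norm// => l; rewrite th1.
Qed.

End Diagonal.

(** * Replacing the blocks in one slot *)

Section Extract.
Context (f : nat -> X -> K^o).
Context (flin : forall k, linear (f k)).
Context (u : nat -> X) (e : R).
Context (u1 : forall k, rnorm (u k) <= 1).
Context (ufin : forall k, exists L : nat, forall i, u k i != 0 -> (i < L)%N).
Context (udis : forall k l i, k != l -> u k i = 0 \/ u l i = 0).
Context (e0 : 0 < e).
Context (fu : forall k, e <= rnorm (f k (u k))).

(** Here [f k] is the form as a function of one slot, the others holding the [k]-th block. The new
    entries go with the functionals [f (sigma l)], so the other slots have to follow the subsequence
    [sigma]. *)
Definition selection (sigma : nat -> nat) (v : nat -> X) (d : R) :=
  [/\ injective sigma, weight_bounded v, forall l, rnorm (v l) <= 1, 0 < d &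
      forall l, d <= rnorm (f (sigma l) (v l))].

Lemma extract_basis d : 0 < d ->
  (forall k0, exists2 k, (k0 <= k)%N & exists i, u k i != 0 /\ d <= rnorm (f k (d_basis i))) ->
  exists sigma v, selection sigma v d.
Proof.
move=> d0 fr; have [sigma shomo sP] := subseq_of_frequent (fun _ => fr).
have [iota_ iP] := choice sP; have sinj := homo_ltn_inj shomo.
exists sigma, (fun l => d_basis (iota_ l)); split=> //.
- apply: weight_bounded_basis => l m lm; apply/eqP; apply: contrapT => /negP nlm.
  have [] := udis (iota_ l) (_ : sigma l != sigma m); first by rewrite (inj_eq sinj).
  + by move/eqP; apply/negP; exact: (iP l).1.
  + by rewrite lm => /eqP; apply/negP; exact: (iP m).1.
- by move=> l; exact: rnorm_d_basis.
- by move=> l; exact: (iP l).2.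
Qed.

(** At most [m] coordinates of [u k] exceed [eta]: otherwise their sum would be above [eta] times
    their number, whereas [W n <= eta / 2 * n] for [n >= m]. Each contributes at most
    [e / 2 / m.+1], so these coordinates carry at most half of [e]. *)
Lemma flat_part :
  (forall d, 0 < d -> exists k0, forall k, (k0 <= k)%N ->
     forall i, u k i != 0 -> rnorm (f k (d_basis i)) <= d) ->
  forall eta, 0 < eta -> exists k0, forall k, (k0 <= k)%N ->
  e / 2 <= rnorm (f k (d_mask (fun i => rnorm (u k i) <= eta) (u k))).
Proof.
move=> small eta eta0; have eta20 : 0 < eta / 2 by rewrite divr_gt0.
have [m hm] := weight_sum_small w eta20.
have [k0 hk] := small (e / 2 / m.+1%:R) ltac:(by rewrite !divr_gt0).
exists k0 => k kk; set p := fun i => _; have [L uL] := ufin k.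
suff big : rnorm (f k (d_mask (predC p) (u k))) <= e / 2.
  have := fu k; rewrite {1}(d_maskC p (u k)).
  have -> : f k (d_mask p (u k) + d_mask (predC p) (u k)) =
      f k (d_mask p (u k)) + f k (d_mask (predC p) (u k)).
    by have := flin k 1 (d_mask p (u k)) (d_mask (predC p) (u k)); rewrite !scale1r.
  move=> /le_trans/(_ (rnormD _ _)) h.
  by rewrite -(lerD2r (e / 2)) -splitr (le_trans h)// lerD2l.
rewrite (d_mask_finite (L := L)); last by move=> i _; exact: uL.
have f0 : f k 0 = 0 by apply: (addrI (f k 0)); have := flin k 1 0 0; rewrite !scale1r !addr0 => <-.
have -> : f k (\sum_(i < L | predC p i) u k i *: d_basis i) =
    \sum_(i < L | predC p i) u k i *: f k (d_basis i).
  rewrite (big_morph (f k) (id1 := 0) (op1 := +%R))//; last first.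
    by move=> a b; have := flin k 1 a b; rewrite !scale1r.
  apply: eq_bigr => i _; have := flin k (u k i) (d_basis i) 0.
  by rewrite f0 !addr0.
apply: le_trans (rnorm_sum _ _ _) _.
pose t := [seq i <- iota 0 L | predC p i].
have ut : uniq t by rewrite filter_uniq ?iota_uniq.
have tm : (size t <= m)%N.
  rewrite leqNgt; apply/negP => mt.
  have h1 : \sum_(i <- t) rnorm (u k i) <= eta / 2 * (size t)%:R.
    apply: le_trans (hm _ (ltnW mt)); have := (d_star_normP (u k) 1).1 (u1 k) t ut.
    by rewrite mul1r.
  have : eta * (size t)%:R <= \sum_(i <- t) rnorm (u k i).
    have -> : eta * (size t)%:R = \sum_(j <- t) eta.
      by rewrite big_const_seq count_predT iter_addr addr0 mulr_natr.
    rewrite !big_seq; apply: ler_sum => i; rewrite mem_filter /= -ltNge => /andP[h _].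
    exact: ltW.
  have : 0 < eta / 2 * (size t)%:R by rewrite mulr_gt0// ltr0n (leq_ltn_trans _ mt).
  lra.
apply: (@le_trans _ _ (\sum_(i <- t) e / 2 / m.+1%:R)).
  rewrite /t big_filter -(big_mkord (predC p) (fun i => rnorm (u k i *: f k (d_basis i)))).
  rewrite /index_iota subn0; apply: ler_sum => i _; rewrite rnormZ.
  have [->|ui] := eqVneq (u k i) 0.
    by rewrite rnorm0 mul0r !divr_ge0// ltW.
  rewrite -[leRHS]mul1r ler_pM ?rnorm_ge0//; last exact: hk.
  exact: le_trans (le_rnorm_coord _ _) (u1 k).
rewrite big_const_seq count_predT iter_addr addr0 -[leLHS]mulr_natr -mulrA.
apply: ler_piMr; first by rewrite divr_ge0// ltW.
rewrite mulrC ler_pdivrMr// mul1r ler_nat.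
exact: leqW.
Qed.

(* Blocks chosen with rapidly decreasing sup norms span a copy of [c_0]: all
   their partial sums have norm at most 2. *)
Lemma extract_flat :
  (forall eta, 0 < eta -> exists k0, forall k, (k0 <= k)%N ->
    e / 2 <= rnorm (f k (d_mask (fun i => rnorm (u k i) <= eta) (u k)))) ->
  exists sigma v, selection sigma v (e / 2).
Proof.
move=> flat.
have /choice[g gP] : forall xk : X * nat, exists kv : nat * X,
    [/\ (xk.2 <= kv.1)%N, exists p, kv.2 = d_mask p (u kv.1), e / 2 <= rnorm (f kv.1 kv.2) &
     rnorm xk.1 <= 2 -> (forall i, xk.1 i = 0 \/ kv.2 i = 0) -> rnorm (xk.1 + kv.2) <= 2].
  move=> [x k0]; have [d d0 hd] : exists2 d : R, 0 < d & rnorm x <= 2 -> forall y,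
      rnorm y <= 1 -> (forall i, rnorm (y i) <= d) -> (forall i, x i = 0 \/ y i = 0) ->
      rnorm (x + y) <= 2.
    have [/d_star_disjoint_add[d d0 hd]|_] := leP (rnorm x) 2; first by exists d.
    by exists 1.
  have [k1 hk1] := flat d d0.
  exists (maxn k0 k1, d_mask (fun i => rnorm (u (maxn k0 k1) i) <= d) (u (maxn k0 k1))).
  split=> /=; [exact: leq_maxl|by eexists|by apply: hk1; exact: leq_maxr|].
  move=> x2; apply: hd => // [|i]; first exact: le_trans (rnorm_d_mask _ _) (u1 _).
  by rewrite d_maskE; case: ifP => // _; rewrite rnorm0 ltW.
(* The state holds the sum of the blocks chosen so far and the least index allowed for the next
   one. *)
pose st := fix st l : X * nat := if l is l'.+1 then
  ((st l').1 + (g (st l')).2, (g (st l')).1.+1) else (0, 0%N).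
pose sigma l := (g (st l)).1; pose v l := (g (st l)).2.
have shomo : {homo sigma : m n / (m < n)%N}.
  by apply: homo_ltn => [|n]; [exact: ltn_trans|have [] := gP (st n.+1)].
have sinj := homo_ltn_inj shomo.
have vmask l : exists p, v l = d_mask p (u (sigma l)) by have [] := gP (st l).
have vdis k l i : k != l -> v k i = 0 \/ v l i = 0.
  move=> kl; have [p ->] := vmask k; have [q ->] := vmask l; rewrite !d_maskE.
  have [|->|->] := udis i (_ : sigma k != sigma l); first by rewrite (inj_eq sinj).
    by left; rewrite if_same.
  by right; rewrite if_same.
have stE l : (st l).1 = \sum_(k < l) v k.
  by elim: l => [|l IH]; rewrite ?big_ord0// big_ord_recr/= -IH.
have sum2 l : rnorm (\sum_(k < l) v k) <= 2.
  elim: l => [|l IH]; first by rewrite big_ord0 rnorm0.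
  rewrite big_ord_recr/= -stE; have [_ _ _] := gP (st l); apply; rewrite stE// => i.
  have [->|vi] := eqVneq (v l i) 0; first by right.
  left; rewrite d_star_sumE big1// => k _.
  have [//|/eqP] := @vdis k l i (negbT (ltn_eqF (ltn_ord k))).
  by rewrite (negPf vi).
exists sigma, v; split=> //.
- exists 2 => tau tinj n theta th.
  (* Each coordinate meets at most one block, so the weighted sum along [tau] is dominated
     coordinatewise by the plain sum of the first [M] blocks. *)
  pose M := (\max_(l < n) tau l).+1.
  apply: le_trans (sum2 M); apply: rnorm_dominated => i.
  have [[l vl]|none] := pselect (exists l : 'I_n, v (tau l) i != 0); last first.
    rewrite d_star_sumE big1 ?rnorm0 ?rnorm_ge0// => l _; rewrite d_starZE.
    have [->|vl] := eqVneq (v (tau l) i) 0; first by rewrite scaler0.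
    by case: none; exists l.
  have v0 k : k != tau l -> v k i = 0.
    by move=> kl; have [//|/eqP] := vdis k (tau l) i kl; rewrite (negPf vl).
  have lM : (tau l < M)%N by rewrite ltnS (leq_bigmax l).
  rewrite !d_star_sumE (bigD1 l)// big1 => [|j jl]; last first.
    by rewrite d_starZE v0 ?scaler0// (inj_eq tinj).
  rewrite [in leRHS](bigD1 (Ordinal lM))// big1 => [|j jl]; last first.
    by apply: v0; apply: contraNneq jl => jE; apply/eqP/val_inj.
  rewrite [X in rnorm X <= _]addr0 [X in _ <= rnorm X]addr0 d_starZE rnormZ ler_piMl ?rnorm_ge0//.
  rewrite absM abs_weight -[leRHS]mulr1 ler_pM ?rnorm_ge0 ?weight_ge0 ?weight_le1//.
- by move=> l; have [p ->] := vmask l; exact: le_trans (rnorm_d_mask _ _) (u1 _).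
- by rewrite divr_gt0.
- by move=> l; have [] := gP (st l).
Qed.

(* Either the [f k] are bounded below on unit vectors of the blocks, or their
   mass sits on the small coordinates of the blocks. *)
Lemma extract_weight_bounded : exists sigma v d, selection sigma v d.
Proof.
have [[d [d0 fr]]|nfr] := pselect (exists d, 0 < d /\ forall k0, exists2 k, (k0 <= k)%N &
    exists i, u k i != 0 /\ d <= rnorm (f k (d_basis i))).
  by have [sigma [v h]] := extract_basis d0 fr; exists sigma, v, d.
have [|sigma [v h]] := extract_flat; last by exists sigma, v, (e / 2).
apply: flat_part => d d0; apply: contrapT => h; apply: nfr; exists d; split=> // k0.
apply: contrapT => h2; apply: h; exists k0 => k kk i ui; rewrite leNgt; apply/negP => lt.
by apply: h2; exists k => //; exists i; split=> //; exact: ltW.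
Qed.

End Extract.
End Good.

(** * Uniform truncation when [w] is not in [ell_n] *)

Section Truncation.
Context {R : realType} {s : scalar_kind} {w : admissible R}.
Local Notation K := (scalar_field R s).
Local Notation X := (d_star s w).
Context {n : nat} (phi : ('I_n -> X) -> K^o) (hphi : multilinear phi).
Context (C : R) (bC : bounded_on_ball phi C) (nl : ~ in_ell n w).
Implicit Types (A B : {set 'I_n}) (x y v : 'I_n -> X) (z : 'I_n -> nat).

Definition trunc_all m x : 'I_n -> X := fun i => d_trunc m (x i).
Definition basis_all z : 'I_n -> X := fun i => d_basis (z i).
Definition trunc_err m x : K^o := phi x - phi (trunc_all m x).

Lemma trunc_all_dfwith m v i a :
  trunc_all m (dfwith v i a) = dfwith (trunc_all m v) i (d_trunc m a).
Proof.
apply/funext => j; rewrite /trunc_all; have [<-|ij] := eqVneq i j.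
  by rewrite !dfwithin.
by rewrite !dfwithout.
Qed.

Lemma trunc_err_multilinear m : multilinear (trunc_err m).
Proof.
move=> i v c a b; rewrite /trunc_err !trunc_all_dfwith /d_trunc d_mask_linear.
rewrite !(multilinearD hphi) !(multilinearZ hphi) scalerBr opprD.
by rewrite addrACA.
Qed.

(* The slots outside [A] are frozen at unit vectors, so that the induction on
   [#|A|] runs over slots of one fixed form instead of forms of lower degree. *)
Definition trunc_uniform A := forall z (e : R), 0 < e -> exists m0, forall m, (m0 <= m)%N ->
  forall x, (forall i, rnorm (x i) <= 1) ->
  rnorm (trunc_err m (mix A x (basis_all z))) <= e.

Lemma trunc_uniform0 : trunc_uniform finset.set0.
Proof.
move=> z e e0; exists (\max_i (z i)).+1 => m hm x _; rewrite mix0 /trunc_err.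
suff -> : trunc_all m (basis_all z) = basis_all z by rewrite subrr rnorm0 ltW.
apply/funext => i; rewrite /trunc_all d_trunc_basis// (leq_trans _ hm)// ltnS.
exact: leq_bigmax.
Qed.

Section Step.
Context (A : {set 'I_n}) (A0 : A != finset.set0).
Context (IH : forall i, i \in A -> trunc_uniform (A :\ i)%SET) (z : 'I_n -> nat).
Local Notation ez := (basis_all z).
Local Notation tail l a := (d_mask (predC (fun i => (i < l)%N)) a).

(** [d_trunc l a] is a combination of [l] unit vectors, each of which freezes slot [i], so the
    induction hypothesis for [A :\ i] applies to every term. The resulting [m0] does not depend on
    [y], [i] or [a]. *)
Lemma trunc_slot_small l d : 0 < d -> exists m0, forall m, (m0 <= m)%N ->
  forall y i (a : X), i \in A -> (forall i, rnorm (y i) <= 1) -> rnorm a <= 1 ->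
  rnorm (trunc_err m (dfwith (mix A y ez) i (d_trunc l a))) <= d.
Proof.
move=> d0; pose d' := d / l.+1%:R; have d'0 : 0 < d' by rewrite divr_gt0.
have /fin_all_exists[f fP] : forall ij : 'I_n * 'I_l, exists m0, ij.1 \in A ->
    forall m, (m0 <= m)%N -> forall x, (forall i, rnorm (x i) <= 1) ->
    rnorm (trunc_err m (mix (A :\ ij.1)%SET x (basis_all (dfwith z ij.1 (ij.2 : nat))))) <= d'.
  move=> [i j] /=; have [iA|_] := boolP (i \in A); last by exists 0%N.
  by have [m0 hm] := IH iA (dfwith z i (j : nat)) d'0; exists m0.
exists (\max_ij f ij) => m hm y i a iA y1 a1.
rewrite d_trunc_sum (multilinear_sum (trunc_err_multilinear m)).
apply: le_trans (rnorm_sum _ _ _) _.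
apply: (@le_trans _ _ (\sum_(j < l) d')); last first.
  rewrite sumr_const card_ord -mulr_natr /d' mulrAC ler_pdivrMr// ler_pM2l// ler_nat.
  exact: leqnSn.
apply: ler_sum => j _; rewrite (multilinearZ (trunc_err_multilinear m)) rnormZ.
have -> : dfwith (mix A y ez) i (d_basis j) =
    mix (A :\ i)%SET y (basis_all (dfwith z i (j : nat))).
  apply/funext => k; rewrite /mix /basis_all !inE; have [->|ki] := eqVneq k i.
    by rewrite /= !dfwithin.
  by rewrite !dfwithout 1?eq_sym.
rewrite -[leRHS]mul1r ler_pM ?rnorm_ge0//; first exact: le_trans (le_rnorm_coord _ _) a1.
by apply: (fP (i, j)) => //; apply: leq_trans hm; exact: (leq_bigmax (i, j)).
Qed.

(** The heads are removed slot by slot. A large truncation error thus persists on vectors supported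
    beyond [l], which is what makes the blocks disjoint. *)
Lemma trunc_tails l d : 0 < d -> exists m0, forall m, (m0 <= m)%N ->
  forall x, (forall i, rnorm (x i) <= 1) ->
  rnorm (trunc_err m (mix A x ez)) <=
  rnorm (trunc_err m (mix A (fun i => tail l (x i)) ez)) + d.
Proof.
move=> d0; have d'0 : 0 < d / n.+1%:R by rewrite divr_gt0.
have [m0 hm] := trunc_slot_small l d'0.
exists m0 => m mm x x1.
pose T i := tail l (x i).
have T1 i : rnorm (T i) <= 1 by exact: le_trans (rnorm_d_mask _ _) (x1 i).
suff H B : B \subset A -> rnorm (trunc_err m (mix A x ez)) <=
    rnorm (trunc_err m (mix A (mix B T x) ez)) + #|B|%:R * (d / n.+1%:R).
  have := H A (fintype.subxx A); have -> : mix A (mix A T x) ez = mix A T ez.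
    by apply/funext => i; rewrite /mix; case: (i \in A).
  move=> /le_trans; apply; rewrite lerD2l mulrA ler_pdivrMr// mulrC ler_pM2l// ler_nat.
  by rewrite (leq_trans (max_card _))// card_ord.
elim/finset_ind: B => [_|i B iB HB]; first by rewrite mix0 cards0 mul0r addr0.
rewrite finset.subUset finset.sub1set => /andP[iA BA].
apply: le_trans (HB BA) _; rewrite cardsU1 iB/= -[(1 + _)%N]addn1 natrD mulrDl mul1r.
rewrite addrA [leRHS]addrAC lerD2r.
rewrite mixU1 (mix_dfwith_in _ _ _ iA).
have yi : mix A (mix B T x) ez i = x i by rewrite /mix iA (negPf iB).
rewrite -{1}[mix A (mix B T x) ez](dfwith_self _ i) yi {1}(d_maskC (fun i => (i < l)%N) (x i)).
rewrite (multilinearD (trunc_err_multilinear m)).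
rewrite [X in rnorm X <= _]addrC; apply: le_trans (rnormD _ _) _; rewrite lerD2l.
apply: hm => // j; rewrite /mix; case: ifP => // _; exact: T1.
Qed.

Context (e : R) (e0 : 0 < e).
Context (bad : forall m0, exists2 m, (m0 <= m)%N & exists2 x, (forall i, rnorm (x i) <= 1) &
  e < rnorm (trunc_err m (mix A x ez))).

Lemma trunc_block l : exists Ly : nat * ('I_n -> X),
  [/\ (l <= Ly.1)%N, forall i, rnorm (Ly.2 i) <= 1,
      forall i j, Ly.2 i j != 0 -> (l <= j < Ly.1)%N &
      e / 8 <= rnorm (phi (mix A Ly.2 ez))].
Proof.
have e20 : 0 < e / 2 by rewrite divr_gt0.
have [m0 hm] := trunc_tails l e20.
pose mz := (\max_i (z i)).+1.
have hz i : (z i < mz)%N by rewrite ltnS; exact: leq_bigmax.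
have [m mm [x x1 xe]] := bad (maxn m0 (maxn l mz)).
move: mm; rewrite !geq_max => /and3P[m0m lm mzm].
pose Y i := tail l (x i).
have Y1 i : rnorm (Y i) <= 1 by exact: le_trans (rnorm_d_mask _ _) (x1 i).
have truncY m' : (mz <= m')%N -> trunc_all m' (mix A Y ez) = mix A (trunc_all m' Y) ez.
  move=> zm; apply/funext => i; rewrite /trunc_all /mix; case: ifP => // _.
  by rewrite d_trunc_basis// (leq_trans (hz i)).
have supp m' i j : trunc_all m' Y i j != 0 -> (l <= j < m')%N.
  rewrite /trunc_all d_truncE; case: ifP => [jm|]; last by rewrite eqxx.
  by rewrite andbT leqNgt /Y d_maskE /=; case: ifP => [//|_]; rewrite eqxx.
have trunc1 m' i : rnorm (trunc_all m' Y i) <= 1 by exact: le_trans (rnorm_d_mask _ _) (Y1 i).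
have : e / 2 < rnorm (trunc_err m (mix A Y ez)).
  by have := hm m m0m x x1; move: xe; rewrite -/Y; set a := rnorm _; set b := rnorm _; lra.
rewrite /trunc_err truncY// => ineq.
have [big|small] := leP (e / 8) (rnorm (phi (mix A (trunc_all m Y) ez))).
  by exists (m, trunc_all m Y); split=> //= i j; exact: supp.
have bigY : e / 4 <= rnorm (phi (mix A Y ez)).
  move: (rnormD (phi (mix A Y ez)) (- phi (mix A (trunc_all m Y) ez))) small ineq.
  rewrite rnormN; lra.
have C0 := bounded_on_ball_ge0 bC.
have eta0 : 0 < e / 8 / (C * n%:R + 1).
  by rewrite divr_gt0 ?divr_gt0// ltr_wpDl// mulr_ge0.
have /fin_all_exists[g gP] : forall i, exists m1, forall m, (m1 <= m)%N ->
    rnorm (mix A Y ez i - d_trunc m (mix A Y ez i)) <= e / 8 / (C * n%:R + 1).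
  by move=> i; exact: d_trunc_cvg.
pose M := maxn (maxn l mz) (\max_i g i).
have zM : (mz <= M)%N by rewrite /M !leq_max leqnn orbT.
exists (M, trunc_all M Y); split=> //=.
- by rewrite /M !leq_max leqnn.
- by move=> i j; exact: supp.
rewrite -truncY//.
have m1 i : rnorm (mix A Y ez i) <= 1.
  by rewrite /mix; case: ifP => // _; exact: rnorm_d_basis.
have m2 i : rnorm (trunc_all M (mix A Y ez) i) <= 1.
  exact: le_trans (rnorm_d_mask _ _) (m1 i).
have := multilinear_lipschitz hphi bC (lexx 1) m1 m2; rewrite expr1n mulr1.
move=> /le_trans/(_ (_ : _ <= e / 8)) close.
have : rnorm (phi (mix A Y ez) - phi (trunc_all M (mix A Y ez))) <= e / 8.
  apply: close; apply: (@le_trans _ _ (C * (n%:R * (e / 8 / (C * n%:R + 1))))).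
    rewrite ler_wpM2l//.
    rewrite mulr_natl -[X in _ *+ X]card_ord -sumr_const; apply: ler_sum => i _; apply: gP.
    by rewrite /M leq_max; apply/orP; right; exact: leq_bigmax.
  rewrite mulrA mulrCA ler_piMr ?divr_ge0// ?(ltW e0)//.
  by rewrite ler_pdivrMr ?mul1r ?lerDl// ltr_wpDl// mulr_ge0.
move: bigY (rnormD (phi (mix A Y ez) - phi (trunc_all M (mix A Y ez)))
  (phi (trunc_all M (mix A Y ez)))).
rewrite subrK; lra.
Qed.

(** Induction on the set [B] of slots already treated. Treating one slot passes to a subsequence,
    which preserves both weight-boundedness of the treated slots and disjointness of the blocks in
    the others; only the lower bound [d] changes. *)
Lemma trunc_blocks_processed B : exists v : nat -> 'I_n -> X, exists2 d, 0 < d &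
  [/\ forall k i, rnorm (v k i) <= 1, forall k, d <= rnorm (phi (mix A (v k) ez)) &
   forall i, i \in A -> if i \in B then weight_bounded (fun k => v k i) else
    (forall k, exists L : nat, forall j, v k i j != 0 -> (j < L)%N) /\
    (forall k l j, k != l -> v k i j = 0 \/ v l i j = 0)].
Proof.
elim/finset_ind: B => [|i B iB [v [d d0 [v1 vd vP]]]].
  have [g gP] := choice trunc_block.
  pose ls := fix ls k := if k is k'.+1 then (g (ls k')).1 else 0%N.
  have lsmono : {homo ls : m n / (m <= n)%N}.
    by apply: homo_leq => [//|l m k|k]; [exact: leq_trans|have [] := gP (ls k)].
  exists (fun k => (g (ls k)).2), (e / 8); first by rewrite divr_gt0.
  split=> [k i|k|i iA]; [by have [] := gP (ls k)|by have [] := gP (ls k)|rewrite inE].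
  have supp k j : (g (ls k)).2 i j != 0 -> (ls k <= j < ls k.+1)%N.
    by have [_ _ h _] := gP (ls k); exact: h.
  split=> [k|k l j kl]; first by exists (ls k.+1) => j /supp /andP[].
  have [->|nz] := eqVneq ((g (ls k)).2 i j) 0; first by left.
  have [->|nz'] := eqVneq ((g (ls l)).2 i j) 0; first by right.
  have /andP[k1 k2] := supp _ _ nz; have /andP[l1 l2] := supp _ _ nz'.
  move: kl; rewrite neq_ltn => /orP[/lsmono kl|/lsmono kl].
    by move: (leq_trans kl l1); rewrite leqNgt k2.
  by move: (leq_trans kl k1); rewrite leqNgt l2.
have [iA|iA] := boolP (i \in A); last first.
  exists v, d => //; split=> // j jA; rewrite !inE; case: eqVneq => [ji|_]; last exact: vP.
  by rewrite -ji jA in iA.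
have := vP i iA; rewrite (negPf iB) => -[ufin udis].
pose f k (a : X) := phi (dfwith (mix A (v k) ez) i a).
have flin k : linear (f k) by exact: hphi.
have vE k : mix A (v k) ez i = v k i by rewrite /mix iA.
have fu k : d <= rnorm (f k (v k i)) by rewrite /f -vE dfwith_self.
have [sg [v' [d' [sinj gd v'1 d'0 fv']]]] :=
  extract_weight_bounded flin (fun k => v1 k i) ufin udis d0 fu.
exists (fun l => dfwith (v (sg l)) i (v' l)), d' => //; split.
- by move=> k j; case: dfwithP.
- by move=> k; rewrite (mix_dfwith_in _ _ _ iA); exact: fv'.
- move=> j jA; rewrite !inE; have [->|ji] := eqVneq j i.
    by under eq_fun do rewrite dfwithin.
  have ij : i != j by rewrite eq_sym.
  rewrite /=; have := vP j jA; case: ifP => _.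
    move=> h; under eq_fun do rewrite (dfwithout _ _ ij).
    exact: (weight_bounded_comp sinj h).
  move=> [h1 h2]; split=> [k|k l b kl].
    by have [L hL] := h1 (sg k); exists L => b; rewrite (dfwithout _ _ ij); exact: hL.
  by rewrite !(dfwithout _ _ ij); apply: h2; rewrite (inj_eq sinj).
Qed.

Lemma trunc_step_contra : False.
Proof.
have [v [d d0 [v1 vd vP]]] := trunc_blocks_processed [set: 'I_n]%SET.
apply: (diagonal_contra hphi bC A0 _ _ d0 vd).
  by move=> /in_ell_le h; apply: nl; apply: h; rewrite -[leqRHS]card_ord max_card.
by move=> i /vP; rewrite inE.
Qed.

End Step.

Lemma trunc_uniform_all A : trunc_uniform A.
Proof.
move: {2}#|A| (leqnn #|A|) => k; elim: k A => [|k IH] A.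
  by rewrite leqn0 cards_eq0 => /eqP ->; exact: trunc_uniform0.
move=> Ak; have [->|A0] := eqVneq A finset.set0; first exact: trunc_uniform0.
move=> z e e0; apply: contrapT => h; apply: (@trunc_step_contra A A0 _ z e e0).
  by move=> i iA; apply: IH; move: Ak; rewrite (cardsD1 i A) iA.
move=> m0; apply: contrapT => h2; apply: h; exists m0 => m mm x x1.
by rewrite leNgt; apply/negP => lt; apply: h2; exists m => //; exists x.
Qed.

Lemma truncation (e : R) : 0 < e -> exists m0, forall m, (m0 <= m)%N ->
  forall x, (forall i, rnorm (x i) <= 1) ->
  rnorm (phi x - phi (fun i => d_trunc m (x i))) <= e.
Proof.
move=> e0; have [m0 hm] := trunc_uniform_all [set: 'I_n]%SET (fun=> 0%N) e0.
by exists m0 => m mm x x1; have := hm m mm x x1; rewrite mixT.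
Qed.

End Truncation.

(** * Density when [w] is not in [ell_N] *)

Section ScalarParts.
Context {R : realType} {s : scalar_kind}.
Local Notation K := (scalar_field R s).

(** Zero for real scalars, so that one decomposition into parts serves both fields. *)
Definition imag_unit : K := match s with RealScalars => 0 | ComplexScalars => 'i%C end.

Lemma abs_complex (a b : R) :
  rnorm ((Complex a b : scalar_field R ComplexScalars) : (scalar_field R ComplexScalars)^o) =
  Num.sqrt (a ^+ 2 + b ^+ 2).
Proof. by rewrite /rnorm [X in to_real X]normc_def. Qed.

Lemma abs_imag_unit : absK imag_unit <= 1.
Proof.
rewrite /imag_unit; case: s => [|]; first by rewrite rnorm0.
by rewrite abs_complex expr0n expr1n add0r sqrtr1.
Qed.

Lemma scalar_parts (z : K) : exists2 ab : R * R, z = of_real ab.1 + imag_unit * of_real ab.2 &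
  `|ab.1| <= absK z /\ `|ab.2| <= absK z.
Proof.
rewrite /imag_unit; case: s z => [z|[a b]].
  by exists (z, 0) => /=; rewrite ?mul0r ?addr0 ?normr0 ?rnorm_ge0.
exists (a, b); last first.
  by rewrite abs_complex -!sqrtr_sqr !ler_wsqrtr// ?lerDl ?lerDr ?sqr_ge0.
by simpc.
Qed.

End ScalarParts.

(** * Maxima over truncated vectors *)

Section Attain.
Context {R : realType} {s : scalar_kind} {w : admissible R}.
Local Notation K := (scalar_field R s).
Local Notation X := (d_star s w).

Definition locally_lipschitz (V V' : normedModType K) (P : V -> V') :=
  forall B : R, 1 <= B -> exists2 L : R, 0 <= L & forall x y,
  rnorm x <= B -> rnorm y <= B -> rnorm (P x - P y) <= L * rnorm (x - y).

Lemma rV_continuous n (h : 'rV[R]_n -> R) :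
  (forall (a : 'rV[R]_n) (e : R), 0 < e -> exists2 d : R, 0 < d & forall a' : 'rV[R]_n,
    (forall j, `|a ord0 j - a' ord0 j| < d) -> `|h a - h a'| < e) ->
  continuous h.
Proof.
move=> H a.
apply: (@cvgrPdist_lt _ _ _ (nbhs a) (nbhs_filter a) h (h a)).2 => e /(H a)[d d0 hd].
suff near_a : nbhs a [set a' : 'rV[R]_n | forall j, `|a ord0 j - a' ord0 j| < d].
  by apply: (@filterS _ _ (nbhs_filter a) _ _ _ near_a) => a' /hd.
apply: (@filter_forall _ _ (fun j (a' : 'rV[R]_n) => `|a ord0 j - a' ord0 j| < d)
  _ (nbhs_filter a)) => j.
exact: (@cvgrPdist_lt _ _ _ (nbhs a) (nbhs_filter a) (fun a' : 'rV[R]_n => a' ord0 j) (a ord0 j)).1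
  (@coord_continuous _ _ _ ord0 j a) d d0.
Qed.

Context (m : nat).

(** Truncated vectors in real coordinates, real parts before imaginary parts, so that compactness of
    cubes in ['rV[R]_(m + m)] serves both fields. *)
Definition combo (a : 'rV[R]_(m + m)) : X := \sum_(i < m)
  (of_real (a ord0 (lshift m i)) + imag_unit * of_real (a ord0 (rshift m i)) : K) *: d_basis i.

Lemma combo_lipschitz (d : R) (a a' : 'rV[R]_(m + m)) :
  0 <= d -> (forall j, `|a ord0 j - a' ord0 j| <= d) ->
  rnorm (combo a - combo a') <= 2 * m%:R * d.
Proof.
move=> d0 ad; rewrite /combo -sumrB; apply: le_trans (rnorm_sum _ _ _) _.
apply: (@le_trans _ _ (\sum_(i < m) (d + d))); last first.
  by rewrite sumr_const card_ord -mulr_natr le_eqVlt; apply/orP; left; apply/eqP; ring.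
apply: ler_sum => i _.
rewrite -scalerBl rnormZ opprD addrACA -mulrBr -!of_realB -[leRHS]mulr1.
apply: ler_pM; rewrite ?rnorm_ge0 ?rnorm_d_basis//.
rewrite (le_trans (rnormD _ _))// absM !abs_of_real lerD//.
by rewrite -[leRHS]mul1r ler_pM ?rnorm_ge0 ?abs_imag_unit.
Qed.

Lemma trunc_combo a : d_trunc m (combo a) = combo a.
Proof.
apply: d_star_eqP => j; rewrite d_truncE; case: ltnP => // mj.
rewrite d_star_sumE big1// => i _; rewrite d_starZE d_basisE.
by rewrite (gtn_eqF (leq_trans (ltn_ord i) mj)) scaler0.
Qed.

Lemma combo_surj (x : X) : rnorm x <= 1 -> exists2 a : 'rV[R]_(m + m),
  combo a = d_trunc m x & forall j, `|a ord0 j| <= 1.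
Proof.
move=> x1; have /choice[ab abP] : forall i, exists ab : R * R,
    x i = of_real ab.1 + imag_unit * of_real ab.2 /\ (`|ab.1| <= 1 /\ `|ab.2| <= 1).
  move=> i; have [ab abE [a1 b1]] := scalar_parts (x i); exists ab; split=> //.
  have xi := le_trans (le_rnorm_coord x i) x1.
  by split; [exact: le_trans a1 xi|exact: le_trans b1 xi].
exists (\row_(j < m + m) match fintype.split j with inl i => (ab i).1 | inr i => (ab i).2 end).
  rewrite d_trunc_sum /combo; apply: eq_bigr => i _; rewrite !mxE.
  by rewrite (unsplitK (inl i)) (unsplitK (inr i)) -(abP i).1.
by move=> j; rewrite mxE; case: (fintype.split j) => i; have [_ []] := abP i.
Qed.

Lemma trunc_attains (Y : normedModType K) (P : X -> Y) (p : Y -> R) :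
  locally_lipschitz P -> (forall y y', `|p y - p y'| <= rnorm (y - y')) ->
  exists x0, [/\ rnorm x0 <= 1, d_trunc m x0 = x0 &
    forall x, rnorm x <= 1 -> p (P (d_trunc m x)) <= p (P x0)].
Proof.
move=> lip plip.
have cont_combo (a : 'rV[R]_(m + m)) (e : R) : 0 < e ->
    exists2 d, 0 < d & forall a' : 'rV[R]_(m + m),
    (forall j, `|a ord0 j - a' ord0 j| < d) -> rnorm (combo a - combo a') < e.
  move=> e0; pose d := e / (2 * m%:R + 1).
  have d0 : 0 < d by rewrite divr_gt0// ltr_wpDl// mulr_ge0.
  exists d => // a' h.
  apply: le_lt_trans (combo_lipschitz (ltW d0) (fun j => ltW (h j))) _.
  have : (2 * m%:R + 1) * d = e by rewrite mulrC divfK// gt_eqF// ltr_wpDl// mulr_ge0.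
  lra.
have c1 : continuous (fun a => rnorm (combo a)).
  apply: rV_continuous => a e /(cont_combo a)[d d0 hd]; exists d => // a' /hd.
  by apply: le_lt_trans; exact: ler_dist_rnorm.
have c2 : continuous (fun a => p (P (combo a))).
  apply: rV_continuous => a e e0.
  pose B := rnorm (combo a) + 1; have B1 : 1 <= B by rewrite lerDr rnorm_ge0.
  have [L L0 hL] := lip B B1.
  have L10 : 0 < L + 1 by rewrite ltr_wpDl.
  have e'0 : 0 < Num.min 1 (e / (L + 1)) by rewrite lt_min ltr01 divr_gt0.
  have [d d0 hd] := cont_combo a _ e'0.
  exists d => // a' /hd; rewrite lt_min => /andP[lt1 lt2].
  apply: le_lt_trans (plip _ _) _.
  have aB : rnorm (combo a) <= B by rewrite lerDl.
  have a'B : rnorm (combo a') <= B.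
    have -> : combo a' = combo a + (combo a' - combo a) by rewrite addrC subrK.
    by rewrite (le_trans (rnormD _ _))// lerD2l rnormB ltW.
  apply: le_lt_trans (hL _ _ aB a'B) _; move: lt2; rewrite ltr_pdivlMr//.
  apply: le_lt_trans; rewrite mulrC ler_wpM2l ?rnorm_ge0// lerDl.
  exact: ler01.
pose cube := [set a : 'rV[R]_(m + m) | forall j, `[-1, 1]%classic (a ord0 j)].
(* The cube is needed for compactness: for real scalars [combo] ignores the second half of the
   coordinates. It loses no vector, by [combo_surj]. *)
pose D := cube `&` [set a | rnorm (combo a) <= 1].
have cD : compact D.
  apply: compact_closedI.
    by apply: (@rV_compact R^o _ (fun=> `[-1, 1]%classic)) => i; exact: segment_compact.
  apply: (@preimage_closed _ R (fun a => rnorm (combo a)) [set r | r <= 1]).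
    by move=> a _; exact: c1.
  exact: closed_le.
have D0 : D !=set0.
  exists 0; split=> [j|]; first by rewrite /= mxE in_itv/= lerN10 ler01.
  rewrite /= (_ : combo 0 = 0) ?rnorm0// /combo big1// => i _.
  by rewrite !mxE of_real0 mulr0 addr0 scale0r.
have [a aD amax] := @compact_EVT_max _ R _ D D0 cD (continuous_subspaceT c2).
have [_ a1] := set_mem aD.
exists (combo a); split=> //; first exact: trunc_combo.
move=> x x1; have [b bE b1] := combo_surj x1; rewrite -bE; apply: amax.
apply/mem_set; split=> [j|]; first by rewrite /= in_itv/= -ler_norml.
by rewrite /= bE; exact: le_trans (rnorm_d_mask _ _) x1.
Qed.

End Attain.

Section C0Tools.
Context {R : realType} {s : scalar_kind}.
Local Notation K := (scalar_field R s).
Local Notation Y := (c0 R s).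
Implicit Types (x y : Y).

Lemma c0DE x y k : (x + y) k = x k + y k. Proof. by []. Qed.
Lemma c0NE x k : (- x) k = - x k. Proof. by []. Qed.
Lemma c0ZE (c : K) x k : (c *: x) k = c *: x k. Proof. by []. Qed.
Lemma c0_sumE I (r : seq I) (P : pred I) (F : I -> Y) k :
  (\sum_(i <- r | P i) F i) k = \sum_(i <- r | P i) F i k.
Proof. by apply: (big_morph (fun x : Y => x k)). Qed.

Lemma rnorm_c0E x : rnorm x = c0_norm x.
Proof. by rewrite /rnorm /= /Num.norm/= /c0_normK of_realK. Qed.

Lemma le_rnorm_c0 x k : rnorm (x k) <= rnorm x.
Proof. by rewrite rnorm_c0E; exact: le_c0_norm. Qed.

Lemma rnorm_c0_lub x (B : R) : (forall k, rnorm (x k) <= B) -> rnorm x <= B.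
Proof. by rewrite rnorm_c0E; exact: c0_norm_lub. Qed.

Lemma c0_unit_subproof k : (fun j => (j == k)%:R) \in @c0_pred R s.
Proof.
apply/asboolP; apply: cvg_near_cst; exists k.+1 => // j /= kj.
by rewrite gtn_eqF.
Qed.

Definition c0_unit k : Y := locked (C0 (c0_unit_subproof k)).

Lemma c0_unitE k j : c0_unit k j = (j == k)%:R.
Proof. by rewrite /c0_unit -lock. Qed.

Lemma rnorm_c0_unit k : rnorm (c0_unit k) <= 1.
Proof.
by apply: rnorm_c0_lub => j; rewrite c0_unitE; case: eqP; rewrite ?rnorm1 ?rnorm0.
Qed.

End C0Tools.

(** * Bounds and Lipschitz estimates for polynomials *)

Section Polynomial.
Context {R : realType} {s : scalar_kind}.
Local Notation K := (scalar_field R s).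
Context {V V' : normedModType K}.
Implicit Types (P : V -> V').

Lemma hom_polynomialP n P : hom_polynomial V V' n P <->
  exists phi : ('I_n -> V) -> V', [/\ multilinear phi,
    exists C, bounded_on_ball phi C & P = fun x => phi (fun=> x)].
Proof.
split=> [[phi [hphi cphi PE]]|[phi [hphi bphi PE]]]; exists phi; split=> //.
  by apply/multilinear_continuousP.
by apply/multilinear_continuousP.
Qed.

Definition ball_bounded P := exists C : R, forall x, rnorm x <= 1 -> rnorm (P x) <= C.

Lemma hom_polynomial_bounded n P : hom_polynomial V V' n P -> ball_bounded P.
Proof.
by move=> /hom_polynomialP[phi [_ [C bC] ->]]; exists C => x x1; apply: bC.
Qed.

Lemma hom_polynomial_lipschitz n P : hom_polynomial V V' n P -> locally_lipschitz P.
Proof.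
move=> /hom_polynomialP[phi [hphi [C bC] ->]] B B1.
have C0 := bounded_on_ball_ge0 bC; have B0 : 0 <= B by exact: le_trans B1.
exists (C * B ^+ n * n%:R); first by rewrite !mulr_ge0// exprn_ge0.
move=> x y xB yB; rewrite -mulrA.
have := multilinear_lipschitz hphi bC B1 (fun=> xB) (fun=> yB).
by rewrite sumr_const card_ord mulr_natl.
Qed.

Lemma polynomial_le_bounded n P : polynomial_le V V' n P -> ball_bounded P.
Proof.
move=> [p /(_ _)/hom_polynomial_bounded pb ->]; have /fin_all_exists[C hC] := pb.
exists (\sum_j C j) => x x1; apply: le_trans (rnorm_sum _ _ _) _.
by apply: ler_sum => j _; exact: hC.
Qed.

Lemma polynomial_le_lipschitz n P : polynomial_le V V' n P -> locally_lipschitz P.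
Proof.
move=> [p ph ->] B B1.
have /fin_all_exists2[L L0 hL] := fun j => hom_polynomial_lipschitz (ph j) B1.
exists (\sum_j L j) => [|x y xB yB]; first exact: sumr_ge0.
rewrite -sumrB mulr_suml; apply: le_trans (rnorm_sum _ _ _) _.
by apply: ler_sum => j _; exact: hL.
Qed.

Lemma hom_polynomial_cst0 n : hom_polynomial V V' n (fun=> 0).
Proof.
apply/hom_polynomialP; exists (fun=> 0); split=> //.
  by move=> i v c x y; rewrite scaler0 addr0.
by exists 0 => x _; rewrite rnorm0.
Qed.

Lemma polynomial_le_cst0 n : polynomial_le V V' n (fun=> 0).
Proof.
exists (fun _ _ => 0) => [j|]; first exact: hom_polynomial_cst0.
by apply/funext => x; rewrite big1.
Qed.

Lemma hom_polynomial_le n P : hom_polynomial V V' n P -> polynomial_le V V' n P.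
Proof.
move=> hP; exists (fun j => if (j : nat) == n then P else fun=> 0) => [j|].
  by case: eqP => [->//|_]; exact: hom_polynomial_cst0.
apply/funext => x; rewrite (bigD1 ord_max)//= eqxx big1 ?addr0// => j jn.
by case: eqP => // jE; move: jn; rewrite -val_eqE/= jE eqxx.
Qed.

Lemma poly_norm_has_sup P : ball_bounded P -> has_sup [set rnorm (P x) | x in @unit_ball R s V].
Proof.
move=> [C hC]; split; first by exists (rnorm (P 0)), 0; rewrite // /unit_ball/= normr0 ler01.
by exists C => _ [x + <-]; rewrite /unit_ball/= le1_rnorm; exact: hC.
Qed.

Lemma le_poly_norm P x : ball_bounded P -> rnorm x <= 1 -> rnorm (P x) <= poly_norm P.
Proof.
move=> /poly_norm_has_sup[_ ub] x1; apply: ub_le_sup => //.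
by exists x => //; rewrite /unit_ball/= le1_rnorm.
Qed.

Lemma poly_norm_lub P (B : R) : (forall x, rnorm x <= 1 -> rnorm (P x) <= B) -> poly_norm P <= B.
Proof.
move=> h; apply: ge_sup.
  by exists (rnorm (P 0)), 0; rewrite // /unit_ball/= normr0 ler01.
by move=> _ [x + <-]; rewrite /unit_ball/= le1_rnorm; exact: h.
Qed.

Lemma poly_norm_adherent P (e : R) : ball_bounded P -> 0 < e ->
  exists2 x, rnorm x <= 1 & poly_norm P - e < rnorm (P x).
Proof.
move=> /poly_norm_has_sup hs e0; have [_ [x x1 <-] lt] := sup_adherent e0 hs.
by exists x => //; rewrite -le1_rnorm.
Qed.

End Polynomial.

(** * Perturbing one coordinate of a polynomial *)

Section Density.
Context {R : realType} {s : scalar_kind} {w : admissible R}.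
Local Notation K := (scalar_field R s).
Local Notation X := (d_star s w).
Local Notation Y := (c0 R s).
Implicit Types (P : X -> Y) (S : set (X -> Y)).

Definition trunc_coord k m (c : K) P : X -> Y :=
  fun x => P x + (c * P (d_trunc m x) k - P x k) *: c0_unit k.

Lemma trunc_coord_eq k m c P x : trunc_coord k m c P x k = c * P (d_trunc m x) k.
Proof.
by rewrite c0DE c0ZE c0_unitE eqxx /GRing.scale/= mulr1 addrC subrK.
Qed.

Lemma trunc_coord_neq k m c P x j : j != k -> trunc_coord k m c P x j = P x j.
Proof. by move=> /negPf jk; rewrite c0DE c0ZE c0_unitE jk scaler0 addr0. Qed.

Lemma hom_polynomial_trunc_coord n k m c P :
  hom_polynomial X Y n P -> hom_polynomial X Y n (trunc_coord k m c P).
Proof.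
move=> /hom_polynomialP[phi [hphi [C bC] ->]]; apply/hom_polynomialP.
exists (fun x => phi x + (c * phi (trunc_all m x) k - phi x k) *: c0_unit k); split=> //.
  move=> i v a x y; rewrite !trunc_all_dfwith /d_trunc d_mask_linear.
  rewrite !(multilinearD hphi) !(multilinearZ hphi) !c0DE !c0ZE scalerDr addrACA.
  congr (_ + _); rewrite scalerA -scalerDl; congr (_ *: _).
  by rewrite /GRing.scale/=; ring.
have C0 := bounded_on_ball_ge0 bC.
exists (C + (absK c * C + C)) => x x1; apply: le_trans (rnormD _ _) _.
rewrite lerD ?bC// rnormZ -[leRHS]mulr1 ler_pM ?rnorm_ge0 ?rnorm_c0_unit//.
rewrite (le_trans (rnormD _ _))// rnormN absM.
have tx1 i : rnorm (trunc_all m x i) <= 1 by exact: le_trans (rnorm_d_mask _ _) (x1 i).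
rewrite lerD//; last exact: le_trans (le_rnorm_c0 _ _) (bC _ x1).
by rewrite ler_wpM2l ?rnorm_ge0// (le_trans (le_rnorm_c0 _ _))// bC.
Qed.

Lemma polynomial_le_trunc_coord n k m c P :
  polynomial_le X Y n P -> polynomial_le X Y n (trunc_coord k m c P).
Proof.
move=> [p ph ->]; exists (fun j => trunc_coord k m c (p j)) => [j|].
  exact: hom_polynomial_trunc_coord.
apply/funext => x; rewrite /trunc_coord big_split/= -scaler_suml; congr (_ + _ *: _).
by rewrite !c0_sumE mulr_sumr sumrB.
Qed.

Definition coord_truncatable P := forall k (e : R), 0 < e -> exists m0, forall m, (m0 <= m)%N ->
  forall x, rnorm x <= 1 -> rnorm (P x k - P (d_trunc m x) k) <= e.

Lemma hom_polynomial_truncatable n P :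
  ~ in_ell n w -> hom_polynomial X Y n P -> coord_truncatable P.
Proof.
move=> nl /hom_polynomialP[phi [hphi [C bC] ->]] k e e0.
have hk : multilinear (fun x => phi x k).
  by move=> i v a x y; rewrite (multilinearD hphi) (multilinearZ hphi) c0DE c0ZE.
have bk : bounded_on_ball (fun x => phi x k) C.
  by move=> x x1; exact: le_trans (le_rnorm_c0 _ _) (bC x x1).
have [m0 hm] := truncation hk bk nl e0.
by exists m0 => m mm x x1; exact: (hm m mm (fun=> x)).
Qed.

Lemma polynomial_le_truncatable n P :
  ~ in_ell n w -> polynomial_le X Y n P -> coord_truncatable P.
Proof.
move=> nl [p ph ->] k e e0.
have e'0 : 0 < e / n.+1%:R by rewrite divr_gt0.
have nj (j : 'I_n.+1) : ~ in_ell j w by move=> /in_ell_le h; apply: nl; apply: h; rewrite -ltnS.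
have /fin_all_exists[g gP] := fun j => hom_polynomial_truncatable (nj j) (ph j) k e'0.
exists (\max_j g j) => m mm x x1; rewrite !c0_sumE -sumrB.
apply: le_trans (rnorm_sum _ _ _) _; apply: (@le_trans _ _ (\sum_(j < n.+1) e / n.+1%:R)).
  by apply: ler_sum => j _; apply: gP => //; apply: leq_trans mm; exact: leq_bigmax.
by rewrite sumr_const card_ord -[leLHS]mulr_natr divfK// pnatr_eq0.
Qed.

(** Stated for a class [S] closed under [trunc_coord], to cover homogeneous polynomials and
    polynomials of bounded degree at once. *)
Lemma NA_dense S : S (fun=> 0) -> (forall P, S P -> ball_bounded P) ->
  (forall P k m c, S P -> S (trunc_coord k m c P)) ->
  (forall P, S P -> coord_truncatable P) -> (forall P, S P -> locally_lipschitz P) ->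
  norm_dense (NA S) S.
Proof.
move=> S0 Sb Sm St Sl P SP e e0; have bP := Sb P SP; set A := poly_norm P.
have [A_small|A_big] := leP A (e / 2).
  exists (fun=> 0).
    split=> //; exists 0; first by rewrite /unit_ball/= normr0 ler01.
    rewrite rnorm0; apply/le_anti/andP; split.
      apply: le_trans (le_poly_norm (x := 0) (Sb _ S0) _); rewrite ?rnorm0//.
    by apply: poly_norm_lub => x _; rewrite rnorm0.
  apply: (@le_lt_trans _ _ A); last by move: A_small e0; lra.
  by apply: poly_norm_lub => x x1; rewrite /= subr0; exact: le_poly_norm.
have [x1 x11 x1A] : exists2 x, rnorm x <= 1 & A - e / 16 < rnorm (P x).
  by apply: poly_norm_adherent; rewrite ?divr_gt0.
have [k kA] : exists k, A - e / 8 < rnorm (P x1 k).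
  apply: contrapT => h; have : rnorm (P x1) <= A - e / 8.
    by apply: rnorm_c0_lub => k; rewrite leNgt; apply/negP => lt; apply: h; exists k.
  by move: x1A e0; lra.
have [m hm] := St P SP k (e / 8) ltac:(by rewrite divr_gt0); have {}hm := hm m (leqnn m).
have [|x0 [x01 tx0 x0max]] := @trunc_attains _ _ _ m Y P (fun y => rnorm (y k)) (Sl P SP).
  by move=> y y'; rewrite (le_trans (ler_dist_rnorm _ _))// -c0NE -c0DE le_rnorm_c0.
have MA : A - e / 4 <= rnorm (P x0 k).
  apply: le_trans (x0max x1 x11).
  have := ler_rnormB (P x1 k) (P (d_trunc m x1) k - P x1 k).
  have -> : P x1 k + (P (d_trunc m x1) k - P x1 k) = P (d_trunc m x1) k.
    by rewrite addrC subrK.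
  rewrite rnormB.
  by have := hm x1 x11; move: kA; lra.
have D0 : 0 < A - e / 4 by move: A_big e0; lra.
(* The maximum of the truncated coordinate is at least [A - e / 4]; the factor [c] lifts it to at
   least [A], above all other coordinates. As [A > e / 2], one has [(c - 1) * A <= e / 2], and the
   truncation error [e / 8] brings the total to [5 e / 8]. *)
pose c := A / (A - e / 4).
have c0 : 0 <= c by rewrite divr_ge0// ltW//; move: A_big e0; lra.
have absc : absK (of_real c : K) = c by rewrite abs_of_real ger0_norm.
have cE : c * (A - e / 4) = A by rewrite divfK// gt_eqF.
have cA : A <= c * rnorm (P x0 k) by rewrite -{1}cE ler_wpM2l.
have c1A : (c - 1) * A <= e / 2.
  have -> : c - 1 = (e / 4) / (A - e / 4).
    apply: (mulIf (lt0r_neq0 D0)); rewrite mulrBl cE mul1r divfK ?lt0r_neq0//; ring.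
  by rewrite mulrAC ler_pdivrMr//; move: A_big e0; nra.
have c1 : 0 <= c - 1 by rewrite subr_ge0 ler_pdivlMr//; move: e0; lra.
pose Q := trunc_coord k m (of_real c) P.
have Qk x : rnorm (Q x k) = c * rnorm (P (d_trunc m x) k).
  by rewrite trunc_coord_eq absM absc.
have Qmax x : rnorm x <= 1 -> rnorm (Q x) <= c * rnorm (P x0 k).
  move=> x1'; apply: rnorm_c0_lub => j; have [->|jk] := eqVneq j k.
    by rewrite Qk ler_wpM2l// x0max.
  rewrite trunc_coord_neq//; apply: le_trans cA.
  exact: le_trans (le_rnorm_c0 _ _) (le_poly_norm bP x1').
have SQ : S Q by exact: Sm.
exists Q.
  split=> //; exists x0; first by rewrite /unit_ball/= le1_rnorm.
  apply/le_anti; rewrite (le_poly_norm (Sb _ SQ) x01)/=.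
  apply: poly_norm_lub => x x1'; apply: le_trans (Qmax x x1') _.
  by rewrite -{1}tx0 -Qk; exact: le_rnorm_c0.
apply: (@le_lt_trans _ _ (e * (5 / 8))); last by move: e0; lra.
apply: poly_norm_lub => x x1'; apply: rnorm_c0_lub => j.
change ((P \- Q) x j) with (P x j - Q x j); have [->|jk] := eqVneq j k; last first.
  by rewrite trunc_coord_neq// subrr rnorm0 mulr_ge0// ltW.
rewrite trunc_coord_eq.
have -> : P x k - of_real c * P (d_trunc m x) k =
    (P x k - P (d_trunc m x) k) + (- of_real (c - 1)) * P (d_trunc m x) k.
  by rewrite of_realB of_real1; ring.
apply: le_trans (rnormD _ _) _; rewrite absM rnormN abs_of_real ger0_norm//.
have h1 := hm x x1'.
have h2 : (c - 1) * rnorm (P (d_trunc m x) k) <= (c - 1) * A.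
  rewrite ler_wpM2l// (le_trans (le_rnorm_c0 _ _))// le_poly_norm//.
  exact: le_trans (rnorm_d_mask _ _) x1'.
by move: h1 h2 c1A; lra.
Qed.

End Density.

(** * The power polynomial when [w] is in [ell_N] *)

Section Summation.
Context {R : realType} {s : scalar_kind}.
Local Notation K := (scalar_field R s).
Implicit Types (f g : nat -> K) (l : K).

Definition has_sum f l := forall e : R, 0 < e -> exists n0, forall n, (n0 <= n)%N ->
  absK (l - \sum_(i < n) f i) <= e.

Definition abs_summable f (B : R) := forall n, \sum_(i < n) absK (f i) <= B.

Lemma has_sum_unique f l l' : has_sum f l -> has_sum f l' -> l = l'.
Proof.
move=> h h'; apply/eqP; rewrite -subr_eq0; apply/eqP/(@rnorm_eq0 R s K^o).
apply/le_anti; rewrite rnorm_ge0 andbT; apply/ler_addgt0Pr => e e0; rewrite add0r.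
have e20 : 0 < e / 2 by rewrite divr_gt0.
have [n hn] := h _ e20; have [n' hn'] := h' _ e20.
have h1 := hn _ (leq_maxl n n'); have h2 := hn' _ (leq_maxr n n').
set S := \sum_(i < _) _ in h1 h2.
have -> : l - l' = (l - S) - (l' - S) by rewrite opprB addrA subrK.
by rewrite (le_trans (rnormD _ _))// rnormN [leRHS]splitr lerD.
Qed.

Lemma has_sum_linear f g c l l' : has_sum f l -> has_sum g l' ->
  has_sum (fun i => c * f i + g i) (c * l + l').
Proof.
move=> h h' e e0; have e1 : 0 < e / 2 / (absK c + 1).
  by rewrite !divr_gt0// ltr_wpDl ?rnorm_ge0.
have e20 : 0 < e / 2 by rewrite divr_gt0.
have [n hn] := h _ e1; have [n' hn'] := h' _ e20; exists (maxn n n') => m.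
rewrite geq_max => /andP[/hn h1 /hn' h2]; rewrite big_split/= -mulr_sumr.
rewrite opprD addrACA -mulrBr (le_trans (rnormD _ _))// absM [leRHS]splitr lerD//.
apply: (@le_trans _ _ (absK c * (e / 2 / (absK c + 1)))).
  by rewrite ler_wpM2l ?rnorm_ge0.
rewrite mulrCA ler_piMr ?divr_ge0 ?(ltW e0)//.
by rewrite ler_pdivrMr ?mul1r ?lerDl// ltr_wpDl ?rnorm_ge0.
Qed.

Lemma has_sum_single f n : (forall i, i != n -> f i = 0) -> has_sum f (f n).
Proof.
move=> fn e e0; exists n.+1 => m nm.
rewrite (bigD1 (Ordinal nm))//= big1 ?addr0 ?subrr ?rnorm0 ?ltW// => i ne.
exact: fn.
Qed.

Lemma has_sum_abs_le f l B : abs_summable f B -> has_sum f l -> absK l <= B.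
Proof.
move=> fB h; apply/ler_addgt0Pr => e /h[n /(_ n (leqnn n)) hn].
have -> : l = \sum_(i < n) f i + (l - \sum_(i < n) f i) by rewrite addrC subrK.
rewrite (le_trans (rnormD _ _))// lerD// (le_trans _ (fB n))//.
exact: (@rnorm_sum R s K^o).
Qed.

Lemma real_summable (a : nat -> R) B : (forall n, \sum_(i < n) `|a i| <= B) -> cvgn (series a).
Proof.
move=> aB; apply: normed_cvg; apply: nondecreasing_is_cvgn.
  by apply: nondecreasing_series => i _ _; exact: normr_ge0.
exists B => _ [n _ <-]; have := aB n; by rewrite -(big_mkord xpredT (fun i => `|a i|)).
Qed.

(** Completeness is taken from [R], through real and imaginary parts. *)
Lemma summable_has_sum f B : abs_summable f B -> exists l, has_sum f l.
Proof.
move=> fB; have /choice[ab abP] : forall i, exists ab : R * R,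
    f i = of_real ab.1 + imag_unit * of_real ab.2 /\
    (`|ab.1| <= absK (f i) /\ `|ab.2| <= absK (f i)).
  by move=> i; have [ab h1 h2] := scalar_parts (f i); exists ab.
have sa : cvgn (series (fun i => (ab i).1)).
  apply: (@real_summable _ B) => n; apply: le_trans (fB n).
  by apply: ler_sum => i _; exact: (abP i).2.1.
have sb : cvgn (series (fun i => (ab i).2)).
  apply: (@real_summable _ B) => n; apply: le_trans (fB n).
  by apply: ler_sum => i _; exact: (abP i).2.2.
exists (of_real (limn (series (fun i => (ab i).1))) +
  imag_unit * of_real (limn (series (fun i => (ab i).2)))) => e e0.
have e20 : 0 < e / 2 by rewrite divr_gt0.
have /cvgrPdist_le/(_ _ e20)[n _ hn] := sa.
have /cvgrPdist_le/(_ _ e20)[n' _ hn'] := sb.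
exists (maxn n n') => m; rewrite geq_max => /andP[nm n'm].
have := hn m nm; have := hn' m n'm; rewrite /series/= !big_mkord => h2 h1.
have -> : \sum_(i < m) f i = of_real (\sum_(i < m) (ab i).1) +
    imag_unit * of_real (\sum_(i < m) (ab i).2).
  rewrite !(big_morph _ (@of_realD R s) (of_real0 R s)) mulr_sumr -big_split/=.
  by apply: eq_bigr => i _; exact: (abP i).1.
rewrite opprD addrACA -mulrBr -!of_realB (le_trans (rnormD _ _))// absM !abs_of_real.
rewrite [leRHS]splitr lerD// (le_trans _ h2)// ler_piMl//.
exact: abs_imag_unit.
Qed.

Definition Ksum f : K :=
  if pselect (exists l, has_sum f l) is left h then projT1 (cid h) else 0.

Lemma has_sum_Ksum f l : has_sum f l -> Ksum f = l.
Proof.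
move=> h; rewrite /Ksum; case: pselect => [h'|]; last by case; exists l.
by case: cid => l' /= hl'; exact: has_sum_unique hl' h.
Qed.

Lemma summable_Ksum f B : abs_summable f B -> has_sum f (Ksum f).
Proof. by move=> /summable_has_sum[l h]; rewrite (has_sum_Ksum h). Qed.

Lemma abs_Ksum_le f B : abs_summable f B -> absK (Ksum f) <= B.
Proof. by move=> h; exact: has_sum_abs_le h (summable_Ksum h). Qed.

End Summation.

Lemma has_sum_real_ge0 (R : realType) (f : nat -> scalar_field R RealScalars) l :
  (forall i, 0 <= f i) -> has_sum f l -> 0 <= l.
Proof.
move=> f0 h; rewrite leNgt; apply/negP => l0.
have e0 : (0 : R) < - l / 2 by rewrite divr_gt0// oppr_gt0.
have [n /(_ n (leqnn n))] := h _ e0; rewrite /rnorm/= ler_norml => /andP[+ _].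
have : 0 <= \sum_(i < n) f i by apply: sumr_ge0.
have H (a b : R) : a < 0 -> 0 <= b -> - (- a / 2) <= a - b -> False by lra.
exact: H l0.
Qed.

Section PhaseRoot.
Context {R : realType} {s : scalar_kind}.
Local Notation K := (scalar_field R s).

(** For real scalars -1 is an [M]-th power of a sign only if [M] is odd, whence the hypothesis. In
    the application [S] is a sum of [M]-th powers, so it is nonnegative when [M] is even. *)
Lemma phase_root M (S : K) : (0 < M)%N ->
  (s = RealScalars -> ~~ odd M -> 0 <= S) ->
  exists2 u : K, absK u = 1 & u ^+ M * of_real (absK S) = S.
Proof.
move=> M0; have [v v1 vS] := normalize_phase S.
case: s S v v1 vS => [S v v1 vS|S v v1 vS _].
  move=> /(_ erefl); case: (boolP (odd M)) => [oM _|_ /(_ isT) S0].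
    have [S0|S0] := leP 0 S.
      by exists 1; rewrite ?rnorm1// expr1n mul1r /rnorm/= ger0_norm.
    exists (-1); first by rewrite rnormN rnorm1.
    by rewrite -signr_odd oM expr1 /rnorm/= ltr0_norm// mulN1r opprK.
  by exists 1; rewrite ?rnorm1// expr1n mul1r /rnorm/= ger0_norm.
have rK : (M.-root (v : R[i])) ^+ M = v by exact: rootCK.
exists (M.-root (v : R[i])); last by rewrite rK.
apply/eqP; rewrite -(@pexpr_eq1 _ _ M)//; last exact: rnorm_ge0.
by rewrite -absX rK v1.
Qed.

(* If [r t] has degree [n], then [r (2 t) - 2 ^ n * r t] has degree less than [n]. *)
Lemma coef_bound n : forall h : R, 0 < h -> exists2 C : R, 0 <= C & forall (c : nat -> K) (e : R),
  (forall t : R, 0 <= t <= h -> absK (\sum_(b < n) of_real t ^+ b * c b) <= e) ->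
  forall b, (b < n)%N -> absK (c b) <= C * e.
Proof.
elim: n => [|n IH] h h0; first by exists 0.
have h20 : 0 < h / 2 by rewrite divr_gt0.
have [C0 C00 hC0] := IH _ h20.
pose D : R := C0 * (1 + 2 ^+ n).
have D0 : 0 <= D by rewrite mulr_ge0// addr_ge0// exprn_ge0.
pose D' : R := (1 + \sum_(b < n) D * h ^+ b) / h ^+ n.
have D'0 : 0 <= D'.
  rewrite divr_ge0 ?exprn_ge0 ?(ltW h0)// addr_ge0// sumr_ge0// => b _.
  by rewrite mulr_ge0// exprn_ge0// ltW.
exists (D + D'); first exact: addr_ge0.
move=> c e hc.
have e0 : 0 <= e by apply: le_trans (rnorm_ge0 _) (hc 0 _); rewrite lexx ltW.
have lo b : (b < n)%N -> absK (c b) <= D * e.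
  (* The interval is halved to keep [2 t] in [[0, h]]; [|2 ^ b - 2 ^ n| >= 1] then recovers [c b]
     from [c' b]. *)
  move=> bn; pose c' b := (2 ^+ b - 2 ^+ n) * c b.
  have hc' t : 0 <= t <= h / 2 -> absK (\sum_(b < n) of_real t ^+ b * c' b) <= (1 + 2 ^+ n) * e.
    move=> /andP[t0 th].
    have E : \sum_(b < n) of_real t ^+ b * c' b =
        \sum_(b < n.+1) of_real (2 * t) ^+ b * c b - 2 ^+ n * \sum_(b < n.+1) of_real t ^+ b * c b.
      have of2 : of_real (2 : R) = 2 :> K by rewrite (_ : 2 = 1 + 1)// of_realD of_real1.
      rewrite mulr_sumr -sumrB big_ord_recr/= of_realM of2 exprMn.
      rewrite [X in _ = _ + X](_ : _ = 0) ?addr0; last by ring.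
      by apply: eq_bigr => i _; rewrite exprMn /c'; ring.
    rewrite E (le_trans (rnormD _ _))// rnormN absM [leRHS]mulrDl [X in _ <= X + _]mul1r lerD//.
      by apply: hc; rewrite mulr_ge0//= mulrC -ler_pdivlMr.
    apply: ler_pM; rewrite ?rnorm_ge0//.
      rewrite absX; have -> : absK (2 : K) = 2; last by [].
      by rewrite (_ : 2 = 1 + 1)// -(@of_real1 R s) -of_realD abs_of_real ger0_norm.
    by apply: hc; rewrite t0 (le_trans th)// ler_pdivrMr// ler_peMr ?ler1n// ltW.
  have := hC0 c' _ hc' b bn; rewrite /c' absM mulrA; apply: le_trans.
  rewrite -[leLHS]mul1r ler_wpM2r ?rnorm_ge0//.
  have -> : (2 ^+ b - 2 ^+ n : K) = of_real (2 ^+ b - 2 ^+ n).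
    have of2 k : of_real (2 ^+ k : R) = 2 ^+ k :> K.
      elim: k => [|k IHk]; rewrite ?expr0 ?of_real1// !exprS of_realM IHk.
      by congr (_ * _); rewrite (_ : 2 = 1 + 1)// of_realD of_real1.
    by rewrite of_realB !of2.
  rewrite abs_of_real distrC ger0_norm; last first.
    by rewrite subr_ge0 ler_weXn2l ?ler1n// ltnW.
  have : (2 ^+ b.+1 : R) <= 2 ^+ n by rewrite ler_weXn2l ?ler1n.
  have : (1 : R) <= 2 ^+ b by rewrite exprn_ege1 ?ler1n.
  by rewrite exprS; lra.
move=> b; rewrite ltnS leq_eqVlt => /orP[/eqP ->|bn]; last first.
  by apply: le_trans (lo b bn) _; rewrite ler_wpM2r// lerDl.
apply: (@le_trans _ _ (D' * e)); last by rewrite ler_wpM2r// lerDr.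
rewrite mulrAC ler_pdivlMr ?exprn_gt0// mulrDl mul1r mulr_suml.
have hh : absK (of_real h ^+ n : K) = h ^+ n by rewrite absX abs_of_real ger0_norm// ltW.
rewrite -{1}hh mulrC -absM.
have := hc h; rewrite lexx ltW//= big_ord_recr/= => /(_ isT) top.
have -> : of_real h ^+ n * c n = (\sum_(b < n) of_real h ^+ b * c b + of_real h ^+ n * c n)
   - \sum_(b < n) of_real h ^+ b * c b by rewrite addrAC subrr add0r.
rewrite (le_trans (rnormD _ _))// rnormN lerD// (le_trans (@rnorm_sum R s K^o _ _ _ _))//.
apply: ler_sum => i _; rewrite absM absX abs_of_real ger0_norm ?(ltW h0)//.
by rewrite [D * _]mulrC -mulrA ler_wpM2l ?exprn_ge0 ?(ltW h0)// lo.
Qed.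

End PhaseRoot.

(** * Majorization and sums of powers *)

Section Majorization.
Context {R : realType}.

(** Summation by parts: the partial sums of [b - a] are nonnegative and the multipliers [c]
    decrease. *)
Lemma abel_sum_le (a b c : nat -> R) n :
  (forall i, 0 <= c i) -> (forall i, c i.+1 <= c i) ->
  (forall k, (k <= n)%N -> \sum_(i < k) a i <= \sum_(i < k) b i) ->
  \sum_(i < n) c i * a i <= \sum_(i < n) c i * b i.
Proof.
move=> c0 cn ab; rewrite -subr_ge0 -sumrB.
case: n ab => [|n] ab; first by rewrite big_ord0.
suff H k : (k <= n)%N ->
    c k * (\sum_(i < k.+1) b i - \sum_(i < k.+1) a i) <= \sum_(i < k.+1) (c i * b i - c i * a i).
  by apply: le_trans (H n (leqnn n)); rewrite mulr_ge0// subr_ge0 ab.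
elim: k => [|k IH] kn; first by rewrite !big_ord1 mulrBr.
rewrite big_ord_recr/= [in X in _ <= X]big_ord_recr/=.
rewrite [X in c k.+1 * (_ - X)]big_ord_recr/= opprD addrACA mulrDr -!mulrBr lerD//.
apply: le_trans (IH (ltnW kn)); rewrite ler_wpM2r ?cn// subr_ge0.
exact: ab (leqW kn).
Qed.

(* Hardy-Littlewood-Polya for [t -> t^M], by exchanging one factor [a i] for
   [b i] at a time. *)
Lemma sum_pow_majorized (a b : nat -> R) n M :
  (forall i, 0 <= a i) -> (forall i, a i.+1 <= a i) ->
  (forall i, 0 <= b i) -> (forall i, b i.+1 <= b i) ->
  (forall k, (k <= n)%N -> \sum_(i < k) a i <= \sum_(i < k) b i) ->
  \sum_(i < n) a i ^+ M <= \sum_(i < n) b i ^+ M.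
Proof.
move=> a0 an b0 bn ab.
suff H j : (j <= M)%N -> \sum_(i < n) a i ^+ M <= \sum_(i < n) a i ^+ (M - j) * b i ^+ j.
  apply: le_trans (H M (leqnn M)) _; rewrite subnn.
  by apply: ler_sum => i _; rewrite expr0 mul1r.
elim: j => [|j IH] jM.
  by rewrite subn0; apply: ler_sum => i _; rewrite expr0 mulr1.
apply: le_trans (IH (ltnW jM)) _.
have E : (M - j = (M - j.+1).+1)%N by rewrite subnSK.
have := @abel_sum_le a b (fun i => a i ^+ (M - j.+1) * b i ^+ j) n _ _ ab.
rewrite E; set S1 := \sum_(i < n) _; set S2 := \sum_(i < n) _; move=> h.
have <- : S1 = \sum_(i < n) a i ^+ (M - j.+1).+1 * b i ^+ j.
  by apply: eq_bigr => i _; rewrite exprSr mulrAC.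
have <- : S2 = \sum_(i < n) a i ^+ (M - j.+1) * b i ^+ j.+1.
  by apply: eq_bigr => i _; rewrite exprSr mulrA.
apply: h => i; first by rewrite mulr_ge0// exprn_ge0.
by rewrite ler_pM ?exprn_ge0// lerXn2r ?nnegrE.
Qed.

Lemma prod_le_sumX (I : finType) (J : {set I}) (a : I -> R) : J != finset.set0 ->
  (forall i, 0 <= a i) -> \prod_(i in J) a i <= \sum_(i in J) a i ^+ #|J|.
Proof.
move=> /finset.set0Pn[i0 i0J] a0.
have [j jJ jmax] := @Order.TotalTheory.arg_maxP _ _ _ i0 (mem J) a i0J.
apply: (@le_trans _ _ (a j ^+ #|J|)).
  by rewrite -prodr_const; apply: ler_prod => i iJ; rewrite a0/=; exact: jmax.
by rewrite (bigD1 j)//= lerDl sumr_ge0// => i _; rewrite exprn_ge0.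
Qed.

End Majorization.

Section PowerSum.
Context {R : realType} {s : scalar_kind} {w : admissible R}.
Local Notation K := (scalar_field R s).
Local Notation X := (d_star s w).
Implicit Types (x : X).

(** Sorted decreasingly, the moduli of [x] over [t] are majorized by [D * w]: apply [d_star_normP]
    to the initial segments. *)
Lemma d_star_sum_pow x (D : R) M t : rnorm x <= D -> uniq t ->
  \sum_(i <- t) rnorm (x i) ^+ M <= D ^+ M * \sum_(i < size t) w i ^+ M.
Proof.
move=> xD ut; have D0 : 0 <= D by apply: le_trans xD; exact: rnorm_ge0.
pose r : rel nat := fun i j => rnorm (x j) <= rnorm (x i).
pose ts := sort r t; pose n := size t.
have sts : size ts = n by rewrite size_sort.
have rtot : total r by move=> i j; exact: le_total.
have rtr : transitive r by move=> i j k h1 h2; exact: le_trans h2 h1.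
pose a k := if (k < n)%N then rnorm (x (nth 0%N ts k)) else 0.
have aE m : (m <= n)%N -> \sum_(i < m) a i = \sum_(i <- take m ts) rnorm (x i).
  move=> mn; rewrite (big_nth 0%N) big_mkord size_take sts.
  have -> : (if (m < n)%N then m else n) = m.
    by case: ltnP => // nm; apply/eqP; rewrite eqn_leq nm mn.
  by apply: eq_bigr => i _; rewrite /a (leq_trans (ltn_ord i) mn) nth_take.
have -> : \sum_(i <- t) rnorm (x i) ^+ M = \sum_(i < n) a i ^+ M.
  rewrite -(perm_big _ (permEl (perm_sort r t)))/= -/ts (big_nth 0%N) big_mkord sts.
  by apply: eq_bigr => i _; rewrite /a ltn_ord.
have -> : D ^+ M * \sum_(i < n) w i ^+ M = \sum_(i < n) (D * w i) ^+ M.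
  by rewrite mulr_sumr; apply: eq_bigr => i _; rewrite exprMn.
apply: (@sum_pow_majorized R a (fun i => D * w i)) => [i|i|i|i|k kn].
- by rewrite /a; case: ifP => // _; exact: rnorm_ge0.
- rewrite /a; case: ifPn => [iSn|_]; last by case: ifP => // _; exact: rnorm_ge0.
  rewrite ltnW//; apply: (sorted_leq_nth rtr _ 0%N (sort_sorted rtot t)) => //.
  + by move=> j; rewrite /r.
  + by rewrite inE sts ltnW.
  + by rewrite inE sts.
- by rewrite mulr_ge0// weight_ge0.
- by rewrite ler_wpM2l// weight_nonincreasing.
rewrite aE// -mulr_sumr.
have uts : uniq (take k ts) by rewrite take_uniq// sort_uniq.
apply: le_trans ((d_star_normP x D).1 xD _ uts) _.
rewrite size_take sts.
have -> // : (if (k < n)%N then k else n) = k.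
by case: ltnP => // nm; apply/eqP; rewrite eqn_leq nm kn.
Qed.

End PowerSum.

Section PowerForm.
Context {R : realType} {s : scalar_kind} {w : admissible R}.
Local Notation K := (scalar_field R s).
Local Notation X := (d_star s w).
Context {N : nat} (J : {set 'I_N}) (J0 : J != finset.set0) (wJ : in_ell #|J| w).
Implicit Types (x : 'I_N -> X).

Definition slot (j : 'I_N) (i : nat) := if j \in J then i.+1 else 0%N.

Definition power_term x (i : nat) : K := \prod_(j < N) x j (slot j i).

(* With [h := #|~: J|], on the diagonal this is the polynomial
   [x_0^h * \sum_(i >= 1) x_i^#|J|]. *)
Definition power_form x : K^o := Ksum (power_term x).

(** The product over [J] is at most the sum of the [#|J|]-th powers of its factors, and these are
    summable in each slot because [w] is in [ell_#|J|]. *)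
Lemma power_term_summable (D : R) : 1 <= D -> exists2 B : R, 0 <= B & forall x,
  (forall j, rnorm (x j) <= D) -> abs_summable (power_term x) B.
Proof.
move=> D1; have D0 : 0 <= D by exact: le_trans D1.
have [S hS] := (in_ellP w #|J|).1 wJ.
have S0 : 0 <= S by have := hS 0%N; rewrite big_ord0.
exists (D ^+ N * (N%:R * (D ^+ #|J| * S))).
  by rewrite !mulr_ge0 ?exprn_ge0.
move=> x xD n.
have le i : absK (power_term x i) <= D ^+ N * \sum_(j in J) rnorm (x j i.+1) ^+ #|J|.
  rewrite /power_term abs_prod (bigID (mem J))/= mulrC; apply: ler_pM.
  - by apply: prodr_ge0 => j _; exact: rnorm_ge0.
  - by apply: prodr_ge0 => j _; exact: rnorm_ge0.
  - apply: (@le_trans _ _ (\prod_(j < N | j \notin J) D)).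
      apply: ler_prod => j _; rewrite rnorm_ge0/=.
      exact: le_trans (le_rnorm_coord _ _) (xD j).
    rewrite prodr_const; apply: ler_weXn2l => //.
    by rewrite (leq_trans (max_card _))// card_ord.
  - apply: le_trans (prod_le_sumX J0 _); last by move=> j; exact: rnorm_ge0.
    by rewrite le_eqVlt; apply/orP; left; apply/eqP; apply: eq_bigr => j jJ; rewrite /slot jJ.
apply: (@le_trans _ _ (\sum_(i < n) D ^+ N * \sum_(j in J) rnorm (x j i.+1) ^+ #|J|)).
  exact: ler_sum.
rewrite -mulr_sumr ler_wpM2l ?exprn_ge0// exchange_big/=.
apply: (@le_trans _ _ (\sum_(j in J) D ^+ #|J| * S)); last first.
  rewrite sumr_const -[leLHS]mulr_natl ler_wpM2r ?mulr_ge0 ?exprn_ge0// ler_nat.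
  by rewrite (leq_trans (max_card _))// card_ord.
apply: ler_sum => j _.
have := d_star_sum_pow #|J| (xD j) (iota_uniq 1 n).
rewrite -[1%N]addn0 iotaDl big_map size_map size_iota => h.
apply: le_trans (_ : _ <= D ^+ #|J| * S); last by [].
rewrite -(big_mkord xpredT (fun i => rnorm (x j i.+1) ^+ #|J|)) /index_iota subn0.
apply: le_trans h _; by rewrite ler_wpM2l ?exprn_ge0.
Qed.

Lemma power_form_has_sum x : has_sum (power_term x) (power_form x).
Proof.
have D1 : 1 <= 1 + \sum_j rnorm (x j) by rewrite lerDl sumr_ge0// => i _; exact: rnorm_ge0.
have [B B0 hB] := power_term_summable D1.
apply: (summable_Ksum (hB x _)) => j; rewrite (bigD1 j)//= addrCA lerDl addr_ge0//.
by apply: sumr_ge0 => i _; exact: rnorm_ge0.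
Qed.

Lemma power_form_multilinear : multilinear power_form.
Proof.
move=> j v c a b.
have termE d i : power_term (dfwith v j d) i =
    d (slot j i) * \prod_(k < N | k != j) v k (slot k i).
  rewrite /power_term (bigD1 j)//= dfwithin; congr (_ * _).
  by apply: eq_bigr => k kj; rewrite dfwithout 1?eq_sym.
have := has_sum_linear c (power_form_has_sum (dfwith v j a)) (power_form_has_sum (dfwith v j b)).
move=> /has_sum_Ksum <-; rewrite /power_form; congr Ksum; apply/funext => i.
by rewrite !termE d_starDE d_starZE /GRing.scale/= mulrDl mulrA.
Qed.

Lemma power_form_bounded : exists C, bounded_on_ball power_form C.
Proof.
have [B B0 hB] := power_term_summable (lexx 1).
by exists B => x x1; exact: abs_Ksum_le (hB x x1).
Qed.

(** If [S] differs from [J] but has its size, some slot outside [J] holds [u *: d_basis n.+1]; that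
    slot reads coordinate 0, which vanishes, and so does every term. *)
Lemma power_form_slice (a : X) (u : K) n (S : {set 'I_N}) : #|S| = #|J| ->
  power_form (mix S (fun=> u *: d_basis n.+1) (fun=> a)) =
  if S == J then a 0%N ^+ #|~: J|%SET * u ^+ #|J| else 0.
Proof.
move=> SJ; apply: has_sum_Ksum; case: eqP => [->|SnJ].
  have -> : a 0%N ^+ #|~: J|%SET * u ^+ #|J| =
      power_term (mix J (fun=> u *: d_basis n.+1) (fun=> a)) n.
    rewrite /power_term (bigID (mem J))/= mulrC; congr (_ * _).
      rewrite -prodr_const; apply: eq_bigr => j jJ; rewrite /mix /slot jJ.
      by rewrite d_starZE d_basisE eqxx /GRing.scale/= mulr1.
    rewrite -prodr_const; apply: eq_big => [j|j]; first by rewrite inE.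
    by rewrite inE => /negPf jJ; rewrite /mix /slot jJ.
  apply: has_sum_single => i ni; have /finset.set0Pn[j jJ] := J0.
  rewrite /power_term (bigD1 j)//= /mix /slot jJ d_starZE d_basisE eqSS (negPf ni).
  by rewrite scaler0 mul0r.
have [j jS jJ] : exists2 j, j \in S & j \notin J.
  apply: contrapT => h; apply: SnJ; apply/eqP; rewrite eqEcard SJ leqnn andbT.
  by apply/fintype.subsetP => j jS; apply: contrapT => /negP jJ; apply: h; exists j.
have -> : (0 : K) = power_term (mix S (fun=> u *: d_basis n.+1) (fun=> a)) 0.
  rewrite /power_term (bigD1 j)//= /mix /slot jS (negPf jJ) d_starZE d_basisE.
  by rewrite scaler0 mul0r.
apply: has_sum_single => i _.
rewrite /power_term (bigD1 j)//= /mix /slot jS (negPf jJ) d_starZE d_basisE.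
by rewrite scaler0 mul0r.
Qed.

Definition tail_power_sum (a : X) : K := Ksum (fun i => a i.+1 ^+ #|J|).

Lemma tail_power_sumP (a : X) (S : R) : rnorm a <= 1 ->
  (forall n, \sum_(i < n) w i ^+ #|J| <= S) ->
  has_sum (fun i => a i.+1 ^+ #|J|) (tail_power_sum a) /\ absK (tail_power_sum a) <= S.
Proof.
move=> a1 hS; have sm : abs_summable (fun i => a i.+1 ^+ #|J| : K) S.
  move=> n; apply: le_trans (hS n).
  have := d_star_sum_pow #|J| a1 (iota_uniq 1 n).
  rewrite -[1%N]addn0 iotaDl big_map size_map size_iota expr1n mul1r; apply: le_trans.
  rewrite -(big_mkord xpredT (fun i => absK (a i.+1 ^+ #|J| : K))) /index_iota subn0.
  by apply: ler_sum => i _; rewrite absX.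
by split; [exact: summable_Ksum sm|exact: abs_Ksum_le sm].
Qed.

Lemma power_form_diag (a : X) : rnorm a <= 1 ->
  power_form (fun=> a) = a 0%N ^+ #|~: J|%SET * tail_power_sum a.
Proof.
move=> a1; have [S hS] := (in_ellP w #|J|).1 wJ.
have [h _] := tail_power_sumP a1 hS.
apply: has_sum_Ksum; have h0 : has_sum (fun=> 0 : K) 0.
  by move=> e e0; exists 0%N => n _; rewrite big1// subr0 rnorm0 ltW.
have := has_sum_linear (a 0%N ^+ #|~: J|%SET) h h0; rewrite addr0.
congr (has_sum _ _); apply/funext => i; rewrite addr0 /power_term (bigID (mem J))/= mulrC.
congr (_ * _); rewrite -prodr_const; apply: eq_big => [j|j]; rewrite ?inE//.
  by move=> jJ; rewrite /slot jJ.
by move=> /negPf jJ; rewrite /slot jJ.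
Qed.

End PowerForm.

(** * Coefficients of polynomials along a line *)

Section Coefficients.
Context {R : realType} {s : scalar_kind} {w : admissible R}.
Local Notation K := (scalar_field R s).
Local Notation X := (d_star s w).
Local Notation Y := (c0 R s).

Section Form.
Context {n : nat} (phi : ('I_n -> X) -> K^o) (hphi : multilinear phi).

Definition slice_coef (b : nat) (x y : X) : K :=
  \sum_(S : {set 'I_n} | #|S| == b) phi (mix S (fun=> y) (fun=> x)).

(** The common range [N], possibly larger than [n], lets the expansions of homogeneous parts of
    different degrees be added. *)
Lemma slice_expand N x y (c : K) : (n <= N)%N ->
  phi (fun=> x + c *: y) = \sum_(b < N.+1) c ^+ b * slice_coef b x y.
Proof.
move=> nN; rewrite (multilinear_expand hphi (fun=> x) (fun=> y)).
rewrite (partition_big (fun S : {set 'I_n} => inord #|S| : 'I_N.+1) xpredT)//=.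
apply: eq_bigr => b _; rewrite /slice_coef mulr_sumr; apply: eq_big => [S|S].
  by rewrite -val_eqE/= inordK// ltnS (leq_trans (max_card _))// card_ord.
move=> /eqP Sb; have <- : #|S| = b.
  by rewrite -Sb inordK// ltnS (leq_trans (max_card _))// card_ord.
by [].
Qed.

Context (C : R) (bC : bounded_on_ball phi C).

Lemma slice_coef_bounded (x : X) : rnorm x <= 1 -> exists2 D : R, 0 <= D &
  forall b y, rnorm y <= 1 -> absK (slice_coef b x y) <= D.
Proof.
move=> x1; have C0 := bounded_on_ball_ge0 bC.
exists (\sum_(S : {set 'I_n}) C); first exact: sumr_ge0.
move=> b y y1; apply: le_trans (@rnorm_sum R s K^o _ _ _ _) _.
rewrite [leRHS](bigID (fun S : {set 'I_n} => #|S| == b))/=.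
rewrite -[leLHS]addr0 lerD ?sumr_ge0//; apply: ler_sum => S _; apply: bC => i.
by rewrite /mix; case: ifP.
Qed.

(** Unit vectors are weight-bounded, so a term with [b] slots at [u *: d_basis k] that stays away
    from 0 for infinitely many [k] would contradict [diagonal_contra]. *)
Lemma slice_coef_vanishes b (x : X) (u : K) (e : R) : (0 < b)%N -> ~ in_ell b w -> 0 < e ->
  exists n0, forall k, (n0 <= k)%N -> absK (slice_coef b x (u *: d_basis k)) <= e.
Proof.
move=> b0 nl e0.
pose d := e / (#|{: {set 'I_n}}|%:R + 1); have d0 : 0 < d by rewrite divr_gt0// ltr_wpDl.
have /fin_all_exists[g gP] : forall S : {set 'I_n}, exists n0, #|S| == b -> forall k, (n0 <= k)%N ->
    rnorm (phi (mix S (fun=> u *: d_basis k) (fun=> x))) <= d.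
  move=> S; have [/eqP Sb|_] := boolP (#|S| == b); last by exists 0%N.
  apply: contrapT => h.
  have fr (l k : nat) : exists2 k', (k <= k')%N &
      d <= rnorm (phi (mix S (fun=> u *: d_basis k') (fun=> x))).
    apply: contrapT => h2; apply: h; exists k => _ k' kk; rewrite leNgt; apply/negP => lt.
    by apply: h2; exists k' => //; exact: ltW.
  have [sg shomo sP] := subseq_of_frequent fr.
  apply: (@diagonal_contra _ _ _ _ phi hphi C bC S (fun=> x)
    (fun k => fun=> u *: d_basis (sg k)) d) => //.
  - by rewrite -card_gt0 Sb.
  - by rewrite Sb.
  - move=> i _; apply: (weight_boundedZ u (weight_bounded_basis _)).
    exact: homo_ltn_inj.
exists (\max_S g S) => k hk; apply: le_trans (@rnorm_sum R s K^o _ _ _ _) _.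
apply: (@le_trans _ _ (\sum_(S : {set 'I_n}) d)).
  rewrite [leRHS](bigID (fun S : {set 'I_n} => #|S| == b))/= -[leLHS]addr0 lerD//.
    by apply: ler_sum => S Sb; apply: gP => //; apply: leq_trans hk; exact: leq_bigmax.
  by apply: sumr_ge0 => S _; exact: ltW.
rewrite sumr_const -[leLHS]mulr_natl /d mulrCA ler_piMr ?(ltW e0)//.
by rewrite ler_pdivrMr ?mul1r ?lerDl// ltr_wpDl.
Qed.

End Form.

Lemma polynomial_slice N M (Q : X -> Y) (x : X) (u : K) : polynomial_le X Y N Q ->
  (forall b, (0 < b < M)%N -> ~ in_ell b w) -> rnorm x <= 1 -> absK u = 1 ->
  exists c : nat -> nat -> K,
  [/\ forall k (t : K), Q (x + t *: (u *: d_basis k)) 0%N = \sum_(b < N.+1) t ^+ b * c k b,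
      exists2 D : R, 0 <= D & forall k b, absK (c k b) <= D &
      forall b (e : R), (0 < b < M)%N -> 0 < e -> exists n0, forall k, (n0 <= k)%N ->
        absK (c k b) <= e].
Proof.
move=> [p ph ->] nl x1 u1.
have /fin_all_exists[c cP] : forall j : 'I_N.+1, exists c : nat -> nat -> K,
  [/\ forall k (t : K), p j (x + t *: (u *: d_basis k)) 0%N = \sum_(b < N.+1) t ^+ b * c k b,
      exists2 D : R, 0 <= D & forall k b, absK (c k b) <= D &
      forall b (e : R), (0 < b < M)%N -> 0 < e -> exists n0, forall k, (n0 <= k)%N ->
        absK (c k b) <= e].
  move=> j; have /hom_polynomialP[phi [hphi [C bC] ->]] := ph j.
  have hk : multilinear (fun v => phi v 0%N).
    by move=> i v a y y'; rewrite (multilinearD hphi) (multilinearZ hphi) c0DE c0ZE.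
  have bk : bounded_on_ball (fun v => phi v 0%N) C.
    by move=> v v1; exact: le_trans (le_rnorm_c0 _ _) (bC v v1).
  exists (fun k b => slice_coef (fun v => phi v 0%N) b x (u *: d_basis k)); split.
  - by move=> k t; rewrite (slice_expand hk (N := N))// -ltnS.
  - have [D D0 hD] := slice_coef_bounded bk x1; exists D => // k b; apply: hD.
    by rewrite rnormZ u1 mul1r rnorm_d_basis.
  - move=> b e /[dup] /andP[b0 _] /nl nlb e0; exact: (slice_coef_vanishes hk bk).
exists (fun k b => \sum_j c j k b); split.
- move=> k t; rewrite c0_sumE.
  under [RHS]eq_bigr do rewrite mulr_sumr.
  rewrite exchange_big/=; apply: eq_bigr => j _.
  by have [-> _ _] := cP j.
- have /fin_all_exists2[D D0 hD] := fun j => let: And3 _ h _ := cP j in h.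
  exists (\sum_j D j) => [|k b]; first exact: sumr_ge0.
  apply: le_trans (@rnorm_sum R s K^o _ _ _ _) _.
  by apply: ler_sum => j _; exact: hD.
- move=> b e bM e0; have e'0 : 0 < e / N.+1%:R by rewrite divr_gt0.
  have /fin_all_exists[g gP] : forall j : 'I_N.+1, exists n0, forall k, (n0 <= k)%N ->
      absK (c j k b) <= e / N.+1%:R.
    by move=> j; have [_ _ h] := cP j; exact: h.
  exists (\max_j g j) => k hk; apply: le_trans (@rnorm_sum R s K^o _ _ _ _) _.
  apply: (@le_trans _ _ (\sum_(j < N.+1) e / N.+1%:R)).
    by apply: ler_sum => j _; apply: gP; apply: leq_trans hk; exact: leq_bigmax.
  by rewrite sumr_const card_ord -[leLHS]mulr_natr divfK// pnatr_eq0.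
Qed.

Lemma polynomial_homogeneous N (Q : X -> Y) : polynomial_le X Y N Q ->
  exists q : nat -> X -> K, forall x (t : K), Q (t *: x) 0%N = \sum_(b < N.+1) t ^+ b * q b x.
Proof.
move=> [p ph ->]; exists (fun b x => if insub b is Some j then p j x 0%N else 0) => x t.
rewrite c0_sumE; apply: eq_bigr => j _; rewrite valK.
have /hom_polynomialP[phi [hphi _ ->]] := ph j.
have := multilinear_scale hphi [set: 'I_j]%SET (fun=> t) (fun=> x) (fun=> x); rewrite !mixT => ->.
by rewrite prodr_const cardsT card_ord c0ZE.
Qed.

(** The homogeneous parts of [P - Q] at [y] are the coefficients of a polynomial in [t] that is
    small for [t <= 1 / 2], so [coef_bound] applies. The constant is uniform in [P] and [Q]. *)
Lemma polynomial_close N : exists2 C : R, 0 <= C & forall (P Q : X -> Y) (e : R),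
  polynomial_le X Y N P -> polynomial_le X Y N Q ->
  (forall x, rnorm x <= 1 -> absK (P x 0%N - Q x 0%N) <= e) ->
  forall y, rnorm y <= 2 -> absK (P y 0%N - Q y 0%N) <= C * e.
Proof.
have h0 : (0 : R) < 2^-1 by rewrite invr_gt0.
have [C C0 hC] := coef_bound (s := s) N.+1 h0.
exists (N.+1%:R * C); first by rewrite mulr_ge0.
move=> P Q e /polynomial_homogeneous[p pE] /polynomial_homogeneous[q qE] PQ y y2.
have D (t : K) : P (t *: y) 0%N - Q (t *: y) 0%N = \sum_(b < N.+1) t ^+ b * (p b y - q b y).
  by rewrite pE qE -sumrB; apply: eq_bigr => b _; rewrite mulrBr.
have := D 1; rewrite scale1r => ->.
apply: le_trans (@rnorm_sum R s K^o _ _ _ _) _.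
apply: (@le_trans _ _ (\sum_(b < N.+1) C * e)); last first.
  by rewrite sumr_const card_ord -[leLHS]mulr_natl mulrA.
apply: ler_sum => b _; rewrite expr1n mul1r.
apply: (hC (fun b => p b y - q b y)); last exact: ltn_ord.
move=> t /andP[t0 t1]; rewrite -D; apply: PQ; rewrite rnormZ abs_of_real ger0_norm//.
rewrite -(mulVf (_ : 2 != 0 :> R))//; apply: ler_pM => //; exact: rnorm_ge0.
Qed.

End Coefficients.

(** * The power polynomial stays away from norm attaining polynomials *)

Section NotDense.
Context {R : realType} {s : scalar_kind} {w : admissible R}.
Local Notation K := (scalar_field R s).
Local Notation X := (d_star s w).
Local Notation Y := (c0 R s).
Context {N : nat} (J : {set 'I_N}) (J2 : (0 < #|J|)%N) (wJ : in_ell #|J| w).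
Context (nl : forall b, (0 < b < #|J|)%N -> ~ in_ell b w).

Let J0 : J != finset.set0. Proof. by rewrite -card_gt0. Qed.
Local Notation M := #|J|.

Definition power_poly (x : X) : Y := power_form J (fun=> x) *: c0_unit 0.

Lemma power_poly0 x : power_poly x 0%N = power_form J (fun=> x).
Proof. by rewrite /power_poly c0ZE c0_unitE /GRing.scale/= mulr1. Qed.

Lemma power_poly_neq0 x k : k != 0%N -> power_poly x k = 0.
Proof. by move=> /negPf k0; rewrite /power_poly c0ZE c0_unitE k0 scaler0. Qed.

Lemma hom_power_poly : hom_polynomial X Y N power_poly.
Proof.
apply/hom_polynomialP; exists (fun x => power_form J x *: c0_unit 0); split=> //.
  move=> i v c x y; have -> := power_form_multilinear J0 wJ i v c x y.
  by rewrite scalerDl scalerA.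
have [C bC] := power_form_bounded (s := s) J0 wJ.
exists C => x x1; rewrite rnormZ -[leRHS]mulr1 ler_pM ?rnorm_ge0 ?rnorm_c0_unit//.
exact: bC.
Qed.

Lemma poly_norm_power_poly : 0 < poly_norm power_poly.
Proof.
pose c : K := of_real 2^-1.
have absc : absK c = 2^-1 by rewrite abs_of_real ger0_norm// invr_ge0.
pose x : X := c *: d_basis 0 + c *: d_basis 1.
have x1 : rnorm x <= 1.
  rewrite /x (le_trans (rnormD _ _))// !rnormZ absc.
  rewrite [leRHS](splitr 1) mul1r lerD// -[leRHS]mulr1 ler_wpM2l ?invr_ge0 ?rnorm_d_basis//.
have c0 : absK c != 0 by rewrite absc invr_eq0.
apply: lt_le_trans (le_poly_norm (hom_polynomial_bounded hom_power_poly) x1).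
apply: lt_le_trans (le_rnorm_c0 _ 0).
rewrite power_poly0 (power_form_diag wJ)//.
have tE : tail_power_sum J x = c ^+ M.
  apply: has_sum_Ksum; have E : x 1%N = c.
    by rewrite d_starDE !d_starZE !d_basisE /= scaler0 add0r /GRing.scale/= mulr1.
  rewrite -E; apply: (@has_sum_single R s (fun i => x i.+1 ^+ M) 0) => -[//|i] _.
  rewrite d_starDE !d_starZE !d_basisE /= !scaler0 addr0 expr0n.
  by case: (#|J|) J2.
have xE : x 0%N = c.
  by rewrite d_starDE !d_starZE !d_basisE /= scaler0 addr0 /GRing.scale/= mulr1.
by rewrite tE xE absM !absX absc mulr_gt0// exprn_gt0// invr_gt0.
Qed.

Lemma power_poly_slice (a : X) (u t : K) n :
  power_poly (a + t *: (u *: d_basis n.+1)) 0%N = \sum_(b < N.+1) t ^+ b *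
    slice_coef (power_form J) b a (u *: d_basis n.+1).
Proof.
rewrite power_poly0.
exact: (slice_expand (power_form_multilinear J0 wJ) a (u *: d_basis n.+1) t (leqnn N)).
Qed.

Lemma power_poly_coef (a : X) (u : K) n :
  slice_coef (power_form J) M a (u *: d_basis n.+1) = a 0%N ^+ #|~: J|%SET * u ^+ M.
Proof.
rewrite /slice_coef (bigD1 J)//= (power_form_slice J0)// eqxx big1 ?addr0//.
by move=> S /andP[/eqP SM /negPf SJ]; rewrite (power_form_slice J0)// SJ.
Qed.

(** Coordinates of [Q] other than the first are at most [e] on the ball, which is below
    [poly_norm power_poly - e <= poly_norm Q]. *)
Lemma near_attaining_coord0 (Q : X -> Y) (x0 : X) (e : R) : polynomial_le X Y N Q ->
  poly_norm (power_poly \- Q) < e -> e * 2 < poly_norm power_poly ->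
  rnorm x0 <= 1 -> rnorm (Q x0) = poly_norm Q ->
  [/\ forall x, rnorm x <= 1 -> absK (power_poly x 0%N - Q x 0%N) <= e,
      poly_norm power_poly - e <= absK (Q x0 0%N) &
      forall x, rnorm x <= 1 -> absK (Q x 0%N) <= absK (Q x0 0%N)].
Proof.
move=> hQ PQ eA x01 att; set A := poly_norm _ in eA *.
have [CP hCP] := hom_polynomial_bounded hom_power_poly.
have bQ := polynomial_le_bounded hQ; have [CQ hCQ] := bQ.
have bPQ : ball_bounded (power_poly \- Q).
  exists (CP + CQ) => x x1; rewrite (le_trans (rnormD _ _))// rnormN lerD//.
    exact: hCP.
  exact: hCQ.
have close x : rnorm x <= 1 -> rnorm (power_poly x - Q x) <= e.
  move=> x1; apply: le_trans (ltW PQ); exact: (le_poly_norm bPQ).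
have QA : A - e <= poly_norm Q.
  rewrite lerBlDr; apply: poly_norm_lub => x x1.
  have -> : power_poly x = Q x + (power_poly x - Q x) by rewrite addrC subrK.
  by rewrite (le_trans (rnormD _ _))// lerD ?close// le_poly_norm.
have Q0 : poly_norm Q <= absK (Q x0 0%N).
  rewrite leNgt; apply/negP => lt.
  have : rnorm (Q x0) <= Num.max (absK (Q x0 0%N)) e.
    apply: rnorm_c0_lub => k; have [->|k0] := eqVneq k 0%N; first by rewrite le_max lexx.
    rewrite le_max; apply/orP; right; apply: le_trans (close x0 x01).
    rewrite rnormB; apply: le_trans (le_rnorm_c0 _ k).
    by rewrite c0DE c0NE power_poly_neq0// subr0.
  rewrite att le_max leNgt lt/= => Qe.
  by have := le_trans QA Qe; move: eA; lra.
split=> [x x1||x x1].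
- by apply: le_trans (close x x1); rewrite -c0NE -c0DE; exact: le_rnorm_c0.
- exact: le_trans QA Q0.
- by apply: le_trans (le_rnorm_c0 _ _) _; apply: le_trans Q0; exact: le_poly_norm.
Qed.

(** Attainment gives [absK E <= absK q0] for the perturbed value [E], while
    [(sg + t ^+ M) * absK q0] exceeds [sg * absK E] by small terms at most. Cancelling
    [sg * absK q0] and dividing by [t ^+ M] makes [q0] too small. Working with multiples of [sg]
    avoids a separate case [sg = 0]. *)
Lemma power_poly_not_approx : exists2 e : R, 0 < e & forall Q : X -> Y,
  polynomial_le X Y N Q -> norm_attaining Q -> e <= poly_norm (power_poly \- Q).
Proof.
have [S hS] := (in_ellP w M).1 wJ.
have S0 : 0 <= S by have := hS 0%N; rewrite big_ord0.
have [C1 C10 hC1] := polynomial_close (s := s) (w := w) N.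
have [C2 C20 hC2] := @coef_bound R s N.+1 1 ltr01.
set A := poly_norm power_poly; have A0 : 0 < A by exact: poly_norm_power_poly.
(* The final bound becomes [absK q0 <= e + S * (C2 * C1) * e + A / 8 = A / 4], against
   [absK q0 >= A - e >= 7 A / 8]. *)
pose e := A / (8 * (1 + S * (C2 * C1))).
have SK0 : 0 <= S * (C2 * C1) by rewrite !mulr_ge0.
have e0 : 0 < e by rewrite divr_gt0// mulr_gt0// ltr_wpDr.
have eE : e * 8 + S * (C2 * C1) * e * 8 = A.
  have : e * (8 * (1 + S * (C2 * C1))) = A by rewrite divfK// gt_eqF// mulr_gt0// ltr_wpDr.
  by move=> <-; ring.
have SKe0 : 0 <= S * (C2 * C1) * e by rewrite mulr_ge0// ltW.
exists e => // Q hQ [x0]; rewrite /unit_ball/= le1_rnorm => x01 att.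
rewrite leNgt; apply/negP => PQ.
have [|close q0A qmax] := near_attaining_coord0 hQ PQ _ x01 att.
  by rewrite -/A; move: eE e0 SKe0; lra.
rewrite -/A in q0A.
pose Sg := tail_power_sum J x0; pose sg := absK Sg.
have [hSg sgS] := tail_power_sumP x01 hS.
have [u u1 uE] : exists2 u : K, absK u = 1 & u ^+ M * of_real sg = Sg.
  apply: phase_root => // sE Meven; rewrite /Sg.
  move: hSg; rewrite /tail_power_sum; clear -sE Meven; move: (Ksum _).
  case: s sE x0 => // _ x0 l; apply: has_sum_real_ge0 => i.
  by rewrite exprn_even_ge0.
pose d := x0 0%N ^+ #|~: J|%SET * u ^+ M.
have dE : d * of_real sg = power_poly x0 0%N.
  by rewrite power_poly0 (power_form_diag wJ)// /d -mulrA uE.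
have [c [cE [D D0 cD] csmall]] := polynomial_slice hQ nl x01 u1.
have c0E k : c k 0%N = Q x0 0%N.
  have := cE k 0; rewrite scale0r addr0 => ->.
  by rewrite big_ord_recl/= expr0 mul1r big1 ?addr0// => i _; rewrite exprS !mul0r.
have ue k : rnorm (u *: d_basis k : X) <= 1 by rewrite rnormZ u1 mul1r rnorm_d_basis.
have MN : (M < N.+1)%N by rewrite ltnS -[leqRHS]card_ord max_card.
have cM k : absK (c k.+1 M - d) <= C2 * (C1 * e).
  rewrite rnormB /d -(power_poly_coef x0 u k).
  apply: (hC2 (fun b => slice_coef (power_form J) b x0 (u *: d_basis k.+1) - c k.+1 b)) => //.
  move=> t /andP[t0 t1].
  under eq_bigr do rewrite mulrBr; rewrite sumrB -power_poly_slice -cE.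
  apply: hC1 => //; first exact/hom_polynomial_le/hom_power_poly.
  rewrite (le_trans (rnormD _ _))// [leRHS](_ : 2 = 1 + 1)// lerD// rnormZ abs_of_real ger0_norm//.
  by rewrite -[leRHS]mulr1 ler_pM ?rnorm_ge0.
(* The at most [N.+1] remaining terms will each be at most [t ^+ M * tau]; multiplied by [sg <= S]
   they total at most [t ^+ M * (A / 8)]. *)
pose tau := A / (8 * (S + 1) * N.+1%:R).
have tau0 : 0 < tau by rewrite divr_gt0// !mulr_gt0// ltr_wpDl.
have [dl dl0 [n0 hn0]] := d_star_perturb x01.
(* Small enough that [t ^+ b * D <= t ^+ M * tau] for [b > M]. It is fixed before [k], which must
   make the coefficients with [0 < b < M] small relative to [t ^+ M]. *)
pose t := Num.min 1 (Num.min dl (tau / (D + 1))).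
have D10 : 0 < D + 1 by rewrite ltr_wpDl.
have t0 : 0 < t by rewrite !lt_min ltr01 dl0 divr_gt0.
have t1 : t <= 1 by rewrite ge_min lexx.
have tdl : t <= dl by rewrite !ge_min lexx orbT.
have tD : t * D <= tau.
  have : t * (D + 1) <= tau by rewrite -ler_pdivlMr// !ge_min lexx !orbT.
  by rewrite mulrDr mulr1; move: t0; lra.
have tM0 : 0 < t ^+ M by rewrite exprn_gt0.
have /fin_all_exists[g gP] : forall b : 'I_N.+1, exists n1, (0 < b < M)%N ->
    forall k, (n1 <= k)%N -> absK (c k b) <= t ^+ M * tau.
  move=> b; have [bM|_] := boolP (0 < b < M)%N; last by exists 0%N.
  by have [n1 hn1] := csmall b (t ^+ M * tau) bM (mulr_gt0 tM0 tau0); exists n1.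
pose k := maxn n0 (\max_b g b).
pose y := x0 + of_real t *: (u *: d_basis k.+1).
have y1 : rnorm y <= 1.
  rewrite /y scalerA; apply: hn0; first by rewrite /k leqW// leq_maxl.
  by rewrite absM u1 mulr1 abs_of_real ger0_norm// ltW.
have := qmax y y1; rewrite /y cE.
have absT b : absK (of_real t ^+ b : K) = t ^+ b by rewrite absX abs_of_real ger0_norm// ltW.
pose M' := Ordinal MN.
rewrite (bigD1 ord0)//= (bigD1 M')/=; last by rewrite -val_eqE/= -lt0n.
rewrite expr0 mul1r c0E; set rest := \sum_(b < N.+1 | _) _.
have restE : absK rest <= N.+1%:R * (t ^+ M * tau).
  apply: le_trans (@rnorm_sum R s K^o _ _ _ _) _.
  apply: (@le_trans _ _ (\sum_(b < N.+1) t ^+ M * tau)); last first.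
    by rewrite sumr_const card_ord -[leLHS]mulr_natl.
  rewrite big_mkcond/=; apply: ler_sum => b _; case: ifP => [/andP[b0 bM]|_]; last first.
    by rewrite mulr_ge0// ltW.
  rewrite absM absT.
  have [bltM|Mltb|bEM] := ltngtP (b : nat) M.
  - rewrite -[leRHS]mul1r ler_pM ?rnorm_ge0 ?exprn_ge0 ?(ltW t0)//.
      by rewrite exprn_ile1// ltW.
    apply: gP; first by rewrite bltM andbT lt0n.
    by rewrite /k leqW// leq_max; apply/orP; right; exact: leq_bigmax.
  - have -> : (b = M + (b - M).-1.+1 :> nat)%N by rewrite prednK ?subn_gt0// subnKC// ltnW.
    rewrite exprD -mulrA ler_wpM2l ?exprn_ge0 ?(ltW t0)//.
    apply: le_trans tD; rewrite exprSr mulrAC -[leRHS]mul1r [t * D]mulrC mulrA.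
    rewrite ler_wpM2r ?(ltW t0)// ler_pM ?rnorm_ge0 ?exprn_ge0 ?(ltW t0)//.
    by rewrite exprn_ile1// ltW.
  - by move: bM; rewrite -val_eqE/= bEM eqxx.
set q0 := Q x0 0%N in q0A qmax *; set E := q0 + _ => Ele.
(* The coefficient [d] of [t ^+ M] in [power_poly] satisfies
   [d * sg = power_poly x0 0], so it has the phase of [q0] up to [e]. *)
have key : (sg + t ^+ M) * absK q0 <= sg * absK E + t ^+ M * e +
    sg * (t ^+ M * (C2 * (C1 * e))) + sg * (N.+1%:R * (t ^+ M * tau)).
  have id : of_real (sg + t ^+ M) * q0 = of_real sg * E
      + of_real (t ^+ M) * (q0 - power_poly x0 0%N)
      + of_real sg * (of_real (t ^+ M) * (d - c k.+1 M)) - of_real sg * rest.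
    have of_realX b : of_real (t ^+ b) = of_real t ^+ b :> K.
      by elim: b => [|b IHb]; rewrite ?of_real1// !exprS of_realM IHb.
    by rewrite -dE /E of_realD of_realX; ring.
  have sg0 : 0 <= sg by exact: rnorm_ge0.
  have tM0' := ltW tM0.
  have absr (r : R) (a : K) : 0 <= r -> absK (of_real r * a) = r * absK a.
    by move=> r0; rewrite absM abs_of_real ger0_norm.
  rewrite -absr ?addr_ge0// id.
  rewrite (le_trans (rnormD _ _))// rnormN lerD//; last first.
    by rewrite absr// ler_wpM2l.
  rewrite (le_trans (rnormD _ _))// lerD//; last first.
    by rewrite absr// ler_wpM2l// absr// ler_wpM2l// rnormB.
  rewrite (le_trans (rnormD _ _))// lerD//; first by rewrite absr.
  by rewrite absr// ler_wpM2l// rnormB close.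
have sg0 : 0 <= sg by exact: rnorm_ge0.
have h1 : sg * absK E <= sg * absK q0 by rewrite ler_wpM2l.
have h2 : sg * (C2 * (C1 * e)) <= S * (C2 * C1) * e.
  have -> : S * (C2 * C1) * e = S * (C2 * (C1 * e)) by ring.
  by apply: ler_wpM2r; [rewrite mulr_ge0// mulr_ge0// ltW|exact: sgS].
have h3 : sg * (N.+1%:R * tau) <= A / 8.
  have -> : N.+1%:R * tau = A / 8 / (S + 1).
    rewrite /tau; field; rewrite nat1r pnatr_eq0 andbT.
    by rewrite gt_eqF// ltr_wpDl.
  rewrite mulrC mulrAC ler_pdivrMr; last by rewrite ltr_wpDl.
  apply: ler_wpM2l; first by rewrite divr_ge0// ltW.
  by apply: (le_trans sgS); rewrite lerDl ler01.
have h4 : absK q0 <= e + S * (C2 * C1) * e + A / 8.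
  rewrite -(ler_pM2l tM0).
  have h2' := ler_wpM2l (ltW tM0) h2; have h3' := ler_wpM2l (ltW tM0) h3.
  have -> : t ^+ M * (e + S * (C2 * C1) * e + A / 8) =
    t ^+ M * e + t ^+ M * (S * (C2 * C1) * e) + t ^+ M * (A / 8) by ring.
  move: key h1 h2' h3'; rewrite mulrDl.
  rewrite [sg * (t ^+ M * _)]mulrCA [N.+1%:R * (t ^+ M * tau)]mulrCA [sg * (t ^+ M * _)]mulrCA.
  lra.
by move: h4 q0A eE e0 SKe0; lra.
Qed.

End NotDense.

Lemma ord_set_card N M : (M <= N)%N -> exists J : {set 'I_N}, #|J| = M.
Proof.
move=> MN; exists (imset (widen_ord MN) (mem [set: 'I_M]%SET)).
rewrite card_imset; first by rewrite cardsT card_ord.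
by move=> i j /(congr1 val) /= ij; exact: val_inj.
Qed.

(** The counterexample is homogeneous and excludes all nearby norm attaining polynomials of degree
    at most [N], so any class [S] in between is covered. *)
Lemma not_dense_of_in_ell (R : realType) (s : scalar_kind) (w : admissible R) (N : nat)
    (S : set (d_star s w -> c0 R s)) :
  in_ell N w -> hom_polynomial (d_star s w) (c0 R s) N `<=` S ->
  S `<=` polynomial_le (d_star s w) (c0 R s) N -> ~ norm_dense (NA S) S.
Proof.
move=> wN homS Sle dense.
have exM : exists M, `[< in_ell M w >] by exists N; apply/asboolP.
case: (ex_minnP exM) => M /asboolP wM minM.
have M0 : (0 < M)%N.
  by case: M wM {minM} => // /(in_ell_le (leq0n 1))/not_in_ell1.
have [J JM] : exists J : {set 'I_N}, #|J| = M.
  by apply: ord_set_card; apply: minM; apply/asboolP.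
have nl b : (0 < b < #|J|)%N -> ~ in_ell b w.
  move=> /andP[_]; rewrite JM ltnNge => /negP bM wb; apply: bM.
  by apply: minM; apply/asboolP.
have J1 : (0 < #|J|)%N by rewrite JM.
have wJ : in_ell #|J| w by rewrite JM.
have [e e0 he] := power_poly_not_approx (s := s) J1 wJ nl.
have [Q [SQ attQ]] := dense _ (homS _ (hom_power_poly J1 wJ)) e e0.
by rewrite ltNge he//; exact: Sle.
Qed.

Theorem proposition4p6 (R : realType) (s : scalar_kind) (w : admissible R)
    (N : nat) (hN : (2 <= N)%N) :
  (norm_dense (NA (hom_polynomial (d_star s w) (c0 R s) N))
     (hom_polynomial (d_star s w) (c0 R s) N)
   <-> ~ in_ell N w) /\
  (norm_dense (NA (polynomial_le (d_star s w) (c0 R s) N))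
     (polynomial_le (d_star s w) (c0 R s) N)
   <-> ~ in_ell N w).
Proof.
split; split=> [dense wN|nl].
- by apply: (not_dense_of_in_ell wN _ _ dense) => // P; exact: hom_polynomial_le.
- apply: NA_dense.
  + exact: hom_polynomial_cst0.
  + by move=> P; exact: hom_polynomial_bounded.
  + by move=> P k m c; exact: hom_polynomial_trunc_coord.
  + by move=> P; exact: hom_polynomial_truncatable.
  + by move=> P; exact: hom_polynomial_lipschitz.
- by apply: (not_dense_of_in_ell wN _ _ dense) => // P; exact: hom_polynomial_le.
- apply: NA_dense.
  + exact: polynomial_le_cst0.
  + by move=> P; exact: polynomial_le_bounded.
  + by move=> P k m c; exact: polynomial_le_trunc_coord.
  + by move=> P; exact: polynomial_le_truncatable.
  + by move=> P; exact: polynomial_le_lipschitz.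
Qed.
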